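(* Let $p>1$, $\alpha_0\ge 0$, $\alpha_1\ge 0$, $\theta\ge 0$ be real numbers with $\alpha_1-p+1>0$, $\alpha_0\ge \alpha_1-p$ and $\theta>\alpha_1-p$, and put $p^*=\frac{(\theta+1)p}{\alpha_1-p+1}$. If $\tau\ge1$ and $0<\beta<\min\big\{\frac{\theta+1}{p},\frac{\alpha_1-p+1}{p-1}\big\}$, then the supremum $$\mathcal{F}_{\tau,\beta,\theta}=\sup\Big\{\int_0^1 r^\theta|u|^{p^*}\big|\ln(\tau+|u|)\big|^{r^\beta}dr:\ u\in X^{1,p}_1(\alpha_0,\alpha_1),\ \|u\|=1\Big\}$$ is attained, i.e. there is $u\in X^{1,p}_1(\alpha_0,\alpha_1)$ with $\|u\|=1$ and $\int_0^1 r^\theta|u|^{p^*}|\ln(\tau+|u|)|^{r^\beta}dr=\mathcal{F}_{\tau,\beta,\theta}$.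
   Context: For $\gamma\ge0$ and $q\ge1$, $L^q_\gamma=L^q_\gamma(0,1)$ is the Lebesgue space $L^q$ on $(0,1)$ with respect to the measure $r^\gamma dr$. $AC_{loc}(0,1)$ is the set of locally absolutely continuous functions on $(0,1)$. The weighted Sobolev space is $X^{1,p}_1(\alpha_0,\alpha_1)=\mathrm{cl}\{u\in AC_{loc}(0,1): \lim_{r\to1}u(r)=0,\ u\in L^p_{\alpha_0},\ u'\in L^p_{\alpha_1}\}$, the closure being with respect to the norm $(\|u\|^p_{L^p_{\alpha_0}}+\|u'\|^p_{L^p_{\alpha_1}})^{1/p}$. Under the stated assumptions this norm is equivalent to the gradient norm $\|u\|:=\|u'\|_{L^p_{\alpha_1}}=\big(\int_0^1 r^{\alpha_1}|u'|^p\,dr\big)^{1/p}$, and $\|\cdot\|$ always denotes this gradient norm. *)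

(* Defs.v *)
From HB Require Import structures.
From mathcomp Require Import all_boot all_order all_algebra.
From mathcomp Require Import all_classical all_reals all_analysis.

Set Implicit Arguments.
Unset Strict Implicit.
Unset Printing Implicit Defensive.

Import Order.TTheory GRing.Theory Num.Theory.
Import numFieldNormedType.Exports.

Local Open Scope classical_set_scope.
Local Open Scope ring_scope.

(* A function on the interval (0,1) is represented by a total function
   R -> R, of which every definition below only uses the values on (0,1). *)

(* The subintervals are allowed to be empty (x i = y i) and to share
   endpoints. *)
Definition abs_continuous (R : realType) (a b : R) (f : R -> R) : Prop :=
  forall e : R, 0 < e -> exists2 d : R, 0 < d &
    forall (n : nat) (x y : 'I_n -> R),
      (forall i, a <= x i /\ x i <= y i /\ y i <= b) ->
      trivIset [set: 'I_n] (fun i => `]x i, y i[%classic) ->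
      \sum_(i < n) (y i - x i) < d ->
      \sum_(i < n) `|f (y i) - f (x i)| < e.

Definition AC_loc01 (R : realType) (f : R -> R) : Prop :=
  forall a b : R, 0 < a -> a < b -> b < 1 -> abs_continuous a b f.

Section weighted_spaces.
Local Open Scope ereal_scope.

(* \int_0^1 r^g |f|^q dr, that is ||f||^q in L^q_g *)
Definition wint (R : realType) (q g : R) (f : R -> R) : \bar R :=
  \int[lebesgue_measure]_(r in `](0 : R)%R, 1%R[) (r `^ g * `|f r| `^ q)%:E.

(* Membership in L^q_g = L^q((0,1), r^g dr) *)
Definition wL (R : realType) (q g : R) (f : R -> R) : Prop :=
  measurable_fun `](0 : R)%R, 1%R[ f /\ wint q g f < +oo.

(* (||u||^p + ||u'||^p)^(1/p).  The derivative u' is the pointwise one; a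
   function in AC_loc01 is derivable almost everywhere on (0,1), so the default
   values of derive1 elsewhere do not affect the integral. *)
Definition sobolev_norm (R : realType) (p a0 a1 : R) (u : R -> R) : \bar R :=
  (wint p a0 u + wint p a1 (derive1 u)) `^ p^-1.

Definition grad_norm (R : realType) (p a1 : R) (u : R -> R) : \bar R :=
  (wint p a1 (derive1 u)) `^ p^-1.

(* The ambient space in which the closure defining X1p is taken. *)
Definition wsobolev (R : realType) (p a0 a1 : R) : set (R -> R) :=
  [set u : R -> R | [/\ AC_loc01 u, wL p a0 u & wL p a1 (derive1 u)]].

Definition wsobolev0 (R : realType) (p a0 a1 : R) : set (R -> R) :=
  [set u | wsobolev p a0 a1 u /\ u r @[r --> 1^'-] --> (0 : R)%R].

Definition X1p (R : realType) (p a0 a1 : R) : set (R -> R) :=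
  [set u | wsobolev p a0 a1 u /\
    forall e : R, (0 < e)%R ->
      exists2 v, wsobolev0 p a0 a1 v &
        sobolev_norm p a0 a1 (fun r => u r - v r)%R < e%:E].

Definition pstar (R : realType) (p a1 theta : R) : R :=
  ((theta + 1) * p / (a1 - p + 1))%R.

Definition log_functional (R : realType) (p a1 theta tau beta : R)
    (u : R -> R) : \bar R :=
  \int[lebesgue_measure]_(r in `](0 : R)%R, 1%R[)
    (r `^ theta * `|u r| `^ pstar p a1 theta
     * `|ln (tau + `|u r|)| `^ (r `^ beta))%:E.

Definition log_sup (R : realType) (p a0 a1 theta tau beta : R) : \bar R :=
  ereal_sup [set log_functional p a1 theta tau beta u |
    u in [set u | X1p p a0 a1 u /\ grad_norm p a1 u = 1]].

End weighted_spaces.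

(* Main.v *)
Require Import Defs.
From HB Require Import structures.
From mathcomp Require Import all_boot all_order all_algebra finmap.
From mathcomp Require Import all_classical all_reals all_analysis.
From mathcomp Require Import measurable_realfun ring lra.

Set Implicit Arguments.
Unset Strict Implicit.
Unset Printing Implicit Defensive.

Import Order.TTheory GRing.Theory Num.Theory.
Import numFieldNormedType.Exports.

Local Open Scope classical_set_scope.
Local Open Scope ring_scope.

(** * Absolutely continuous functions and densities *)

Section absolute_continuity.
Context {R : realType}.
Implicit Types (a b : R) (f g : R -> R).

(** Compactness can only be lost by concentration at the origin. A concentrating sequence reaches at
    most the level of a Bliss inequality, and the supremum F lies strictly above that level.

    Replacing [u] by [tail (derive1 u)], the integral of |u'| from r to 1, keeps the gradient norm
    and does not decrease the functional, so the analysis concerns nonincreasing nonnegative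
    profiles v. At energy 1 they satisfy v(r) <= K r^(-(a1-p+1)/p) ([tail_growth]), so the
    logarithmic factor is at most exp(B r^(beta/2)) ([log_factor_le]): it is bounded, and near the
    origin its bound tends to 1. There the functional is thus controlled by the pure power integral,
    for which [bliss_ineq] gives the bound S E^(P/p), with E the energy and P = [pstar]. That
    inequality is proved by mass transport: a monotone map carries r^theta v^P onto the density of
    the Bliss extremal cut off at a length L, and the arithmetic-geometric mean inequality, an
    integration by parts and Young's inequality do the rest. The constant S = [bS L] depends on L,
    which is free.

    The same cut-off extremal, dilated, lowered so as to vanish at 1 and normalised, is the test
    function [tfun L]. Compared with [bS L] it loses, up to a common factor, terms of orders
    L^(-(c-e)) and L^(-x), where c = (a1-p+1)/(p-1), e > 0 is arbitrarily small and x < (theta+1)/p,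
    while the logarithm contributes a gain of order L^(-beta) at the scale 1/L. The bounds on beta
    make the gain win for large L ([tfun_exceeds]), hence S < F.

    For a maximising sequence, Tychonoff's theorem and a common modulus of continuity yield a
    pointwise limit c of the profiles along selected indices ([tail_extraction]). It belongs to the
    space, and its energy T is at most 1 by lower semicontinuity ([tail_energy_lsc],
    [wint_limit_le1]). Cutting (0,1) at a small d, dominated convergence handles (d,1), and the
    Bliss inequality, applied to the derivatives truncated to (0,d] whose energy is at most about 1
    - T, handles the rest. As (1-T)^(P/p) <= 1 - T, this gives F <= S (1 - T) + Phi, with Phi the
    functional at c ([limit_energy_gap]). Normalising c gives Phi <= T F ([functional_scale]).
    Together (F - S)(1 - T) <= 0, so T = 1 and Phi = F. *)

Lemma abs_continuous_fin a b f : abs_continuous a b f ->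
  forall e : R, 0 < e -> exists2 d : R, 0 < d &
    forall (I : finType) (x y : I -> R),
      (forall i, a <= x i /\ x i <= y i /\ y i <= b) ->
      trivIset [set: I] (fun i => `]x i, y i[%classic) ->
      \sum_i (y i - x i) < d ->
      \sum_i `|f (y i) - f (x i)| < e.
Proof.
move=> acf e e0; have [d d0 H] := acf e e0; exists d => // I x y xy tI xyd.
have E (F : I -> R) : \sum_i F i = \sum_(k < #|I|) F (enum_val k).
  by rewrite (reindex (@enum_val I predT)) //; exact/onW_bij/enum_val_bij.
rewrite E; apply: (H #|I| (x \o enum_val) (y \o enum_val)) => /=.
- by move=> i; exact: xy.
- by move=> i j _ _ ne; apply: enum_val_inj; exact: (tI (enum_val i) (enum_val j)).
- by rewrite -(E (fun i => y i - x i)).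
Qed.

Lemma itv_partition_nth a b s i : itv_partition a b s -> (i < size s)%N ->
  [/\ a <= nth b (a :: s) i, nth b (a :: s) i < nth b (a :: s) i.+1 &
      nth b (a :: s) i.+1 <= b].
Proof.
elim: s a i => // x s ih a i abs; have /= [/andP[ax _] _] := abs.
have xbs := itv_partition_cons abs.
case: i => [_|i /= si]; first by split => //; exact: itv_partition_le xbs.
have [h1 h2 h3] := ih x i xbs si; split => //; first exact: le_trans (ltW ax) h1.
Qed.

Lemma itv_partition_nth_le a b s i j : itv_partition a b s ->
  (i <= j <= size s)%N -> nth b (a :: s) i <= nth b (a :: s) j.
Proof.
move=> abs /andP[]; elim: j => [|j ih]; first by rewrite leqn0 => /eqP ->.
rewrite leq_eqVlt ltnS => /predU1P[-> //|ij js].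
apply: le_trans (ih ij (ltnW js)) _.
by have [_ /ltW] := itv_partition_nth abs js.
Qed.

Lemma itv_partition_telescope a b s : itv_partition a b s ->
  \sum_(i < size s) (nth b (a :: s) i.+1 - nth b (a :: s) i) = b - a.
Proof.
move=> abs; rewrite -(big_mkord xpredT (fun i => nth b (a :: s) i.+1 - nth b (a :: s) i)).
rewrite telescope_sumr//= ; congr (_ - _).
by case: abs => _ /eqP {2}<-; rewrite (last_nth b).
Qed.

(** Splitting every interval along its partition gives a finer disjoint family of the same total
    length, so the [d] of absolute continuity still serves. The cells are indexed by the dependent
    pairs [J], hence the need for families over arbitrary finite types. *)
Lemma abs_continuous_variation a b f : abs_continuous a b f ->
  forall e : R, 0 < e -> exists2 d : R, 0 < d &
    forall (I : finType) (x y : I -> R) (s : I -> seq R),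
      (forall i, a <= x i /\ y i <= b) ->
      (forall i, itv_partition (x i) (y i) (s i)) ->
      trivIset [set: I] (fun i => `]x i, y i[%classic) ->
      \sum_i (y i - x i) < d ->
      \sum_i variation (x i) (y i) f (s i) < e.
Proof.
move=> /abs_continuous_fin acf e e0; have [d d0 H] := acf e e0.
exists d => // I x y s xy xys tI xyd.
pose J := {i : I & 'I_(size (s i))}.
pose X (p : J) := nth (y (tag p)) (x (tag p) :: s (tag p)) (tagged p).
pose Y (p : J) := nth (y (tag p)) (x (tag p) :: s (tag p)) (tagged p).+1.
have := H J X Y; rewrite /X /Y.
rewrite -(@sig_big_dep _ _ _ I (fun i => 'I_(size (s i))) predT (fun=> predT)
  (fun i k => nth (y i) (x i :: s i) k.+1 - nth (y i) (x i :: s i) k))/=.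
rewrite -(@sig_big_dep _ _ _ I (fun i => 'I_(size (s i))) predT (fun=> predT)
  (fun i k => `|f (nth (y i) (x i :: s i) k.+1) - f (nth (y i) (x i :: s i) k)|))/=.
move=> {}H; under eq_bigr => i _ do rewrite /variation big_mkord.
apply: H.
- move=> [i k] /=; have [h1 h2 h3] := itv_partition_nth (xys i) (ltn_ord k).
  have [ax yb] := xy i; split; first exact: le_trans h1.
  by split; [exact: ltW|exact: le_trans yb].
- move=> [i k] [i' k'] _ _ /= [z /=]; rewrite !in_itv/= => -[/andP[z1 z2] /andP[z3 z4]].
  have [h1 h2 h3] := itv_partition_nth (xys i) (ltn_ord k).
  have [h4 h5 h6] := itv_partition_nth (xys i') (ltn_ord k').
  have ii' : i = i'.
    apply: tI => //; exists z; split; rewrite /= in_itv/=; apply/andP; split.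
    + exact: le_lt_trans z1.
    + exact: lt_le_trans h3.
    + exact: le_lt_trans z3.
    + exact: lt_le_trans h6.
  subst i'; congr existT; apply/val_inj => /=.
  have [kk|kk|//] := ltngtP k k'.
    have := @itv_partition_nth_le _ _ _ k.+1 k' (xys i).
    rewrite kk/= (ltnW (ltn_ord k')) => /(_ isT) Hle.
    by have := lt_trans (le_lt_trans Hle z3) z2; rewrite ltxx.
  have := @itv_partition_nth_le _ _ _ k'.+1 k (xys i).
  rewrite kk/= (ltnW (ltn_ord k)) => /(_ isT) Hle.
  by have := lt_trans (le_lt_trans Hle z1) z4; rewrite ltxx.
- by under eq_bigr => i _ do rewrite (itv_partition_telescope (xys i)).
Qed.

End absolute_continuity.

(** * Total variation of absolutely continuous functions *)

Section absolute_continuity2.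
Context {R : realType}.
Implicit Types (a b : R) (f g : R -> R).

(** Intervals shorter than [d] have variation at most 1, and finitely many of them cover [a, b]. *)
Lemma abs_continuous_bounded_variation a b f :
  a <= b -> abs_continuous a b f -> bounded_variation a b f.
Proof.
move=> ab acf; have [d d0 H] := abs_continuous_variation acf ltr01.
have small x y : a <= x -> x <= y -> y <= b -> y - x < d ->
    bounded_variation x y f.
  move=> ax xy yb xyd; exists 1 => _ [s xys <-].
  have := H unit (fun=> x) (fun=> y) (fun=> s).
  rewrite !big_const !card_unit /= !addr0 => {}H; apply/ltW/H => //.
  by move=> [] [] _ _.
have step (n : nat) x : a <= x -> x <= b -> x - a <= n%:R * (d / 2) ->
    bounded_variation a x f.
  elim: n x => [|n ih] x ax xb.
    rewrite mul0r subr_le0 => xa; have -> : x = a by apply/le_anti/andP.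
    exact: bounded_variationxx.
  move=> xn; pose z := Num.max a (x - d / 2).
  have az : a <= z by rewrite le_max lexx.
  have zx : z <= x by rewrite ge_max ax/= lerBlDr lerDl; lra.
  apply/bounded_variationP => //.
  rewrite (total_variationD _ az zx) fin_numD; apply/andP; split.
    apply/bounded_variationP => //; apply: ih => //; first exact: le_trans xb.
    rewrite /z maxEle; case: ifPn => _.
      by move: xn; rewrite -natr1 mulrDl mul1r; lra.
    by rewrite subrr mulr_ge0//; lra.
  apply/bounded_variationP => //; apply: small => //.
  have : x - d / 2 <= z by rewrite le_max lexx orbT.
  lra.
apply: (step (Num.trunc ((b - a) / (d / 2))).+1) => //.
by rewrite -ler_pdivrMr ?divr_gt0//; apply/ltW/truncnS_gt.
Qed.

Lemma abs_continuousB a b f g : abs_continuous a b f -> abs_continuous a b g ->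
  abs_continuous a b (f \- g).
Proof.
move=> acf acg e e0; have e2 : 0 < e / 2 by rewrite divr_gt0.
have [d d0 H] := acf _ e2; have [d' d'0 H'] := acg _ e2.
exists (Num.min d d'); first by rewrite lt_min d0.
move=> n x y xy tI; rewrite lt_min => /andP[xyd xyd'].
rewrite (splitr e); apply: le_lt_trans (ltrD (H n x y xy tI xyd) (H' n x y xy tI xyd')).
rewrite -big_split; apply: ler_sum => i _ /=.
have -> : f (y i) - g (y i) - (f (x i) - g (x i)) =
  f (y i) - f (x i) - (g (y i) - g (x i)) by ring.
exact: ler_normB.
Qed.

Lemma abs_continuousZ a b (c : R) f : abs_continuous a b f ->
  abs_continuous a b (fun x => c * f x).
Proof.
move=> acf e e0; have c1 : 0 < `|c| + 1 by rewrite ltr_wpDl.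
have [d d0 H] := acf (e / (`|c| + 1)) (divr_gt0 e0 c1).
exists d => // n x y xy tI xyd.
have := H n x y xy tI xyd; rewrite ltr_pdivlMr// mulrC => {H}.
apply: le_lt_trans; rewrite mulr_sumr; apply: ler_sum => i _.
by rewrite -mulrBr normrM ler_wpM2r// lerDl.
Qed.

Lemma total_variation_fineB a b f x y : a <= x -> x <= y -> y <= b ->
  bounded_variation a b f ->
  fine (total_variation a y f) - fine (total_variation a x f) =
  fine (total_variation x y f).
Proof.
move=> ax xy yb bvf; have ay := le_trans ax xy.
have := bounded_variationl ay yb bvf => bvy.
rewrite (total_variationD _ ax xy) fineD; first by rewrite addrC addKr.
- exact/(bounded_variationP _ ax)/(bounded_variationl ax xy).
- exact/(bounded_variationP _ xy)/(bounded_variationr ax xy).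
Qed.

(** On each interval some partition has a variation within [eta] of the supremum; the [n] errors add
    up to at most [e / 2]. *)
Lemma abs_continuous_total_variation a b f : a <= b -> abs_continuous a b f ->
  abs_continuous a b (fun x => fine (total_variation a x f)).
Proof.
move=> ab acf e e0; have bvf := abs_continuous_bounded_variation ab acf.
have e2 : 0 < e / 2 by rewrite divr_gt0.
have [d d0 H] := abs_continuous_variation acf e2.
exists d => // n x y xy tI xyd.
pose eta := e / 2 / n.+1%:R.
have eta0 : 0 < eta by rewrite divr_gt0.
have S i : exists s, itv_partition (x i) (y i) s /\
    fine (total_variation (x i) (y i) f) < variation (x i) (y i) f s + eta.
  have [ax [xyi yb]] := xy i.
  have bvi : bounded_variation (x i) (y i) f.
    exact/(bounded_variationr ax xyi)/(bounded_variationl (le_trans ax xyi) yb).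
  have Tfin := (bounded_variationP _ xyi).1 bvi.
  have [z [_ [s xys <-] <-] h] := ub_ereal_sup_adherent eta0 Tfin.
  exists s; split => //; rewrite -ltrBlDr -lte_fin EFinB fineK//.
have /choice[s Hs] := S.
have Hv := H _ x y s _ (fun i => (Hs i).1) tI xyd.
have {}Hv := Hv (fun i => conj (xy i).1 (xy i).2.2).
apply: (@le_lt_trans _ _ (\sum_(i < n) (variation (x i) (y i) f (s i) + eta))).
  apply: ler_sum => i _; have [ax [xyi yb]] := xy i.
  rewrite (total_variation_fineB ax xyi yb bvf) ger0_norm; first exact/ltW/(Hs i).2.
  by apply/fine_ge0/total_variation_ge0.
rewrite big_split/= sumr_const card_ord -mulr_natr /eta.
rewrite [ltRHS](splitr e); apply: (ltr_leD Hv).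
by rewrite mulrAC ler_pdivrMr// ler_wpM2l ?ler_nat// ltW.
Qed.

(** Composing with [clamp a b] extends a function on [a, b] to the line by its end values, so that
    results on total functions (continuity, Stieltjes measures) apply to it. *)
Definition clamp a b x : R := Num.max a (Num.min b x).

Lemma clamp_id a b x : a <= x <= b -> clamp a b x = x.
Proof. by move=> /andP[ax xb]; rewrite /clamp (min_idPr xb); exact/max_idPr. Qed.

Lemma clamp_itv a b x : a <= b -> a <= clamp a b x <= b.
Proof. by move=> ab; rewrite le_max lexx/= ge_max ab/= ge_min lexx. Qed.

Lemma le_clamp a b : {homo clamp a b : x y / x <= y}.
Proof.
move=> x y xy; rewrite /clamp ge_max le_max lexx/= le_max; apply/orP; right.
by rewrite le_min ge_min lexx/= ge_min xy orbT.
Qed.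

Lemma clamp_dist a b x y : x <= y -> clamp a b y - clamp a b x <= y - x.
Proof.
move=> xy; rewrite /clamp !maxEle !minEle.
by do ! case: ifPn => //; rewrite -?ltNge => *; lra.
Qed.

Lemma clamp_continuous a b : continuous (clamp a b).
Proof.
move=> x; apply: (@continuous_max _ _ (cst a)); first exact: cvg_cst.
apply: (@continuous_min _ _ (cst b)); first exact: cvg_cst.
exact: cvg_id.
Qed.

Lemma abs_continuous_continuous_clamp a b f : a <= b ->
  abs_continuous a b f -> continuous (f \o clamp a b).
Proof.
move=> ab acf.
suff H x e : 0 < e -> exists2 d, 0 < d & forall y, `|x - y| < d ->
   `|f (clamp a b x) - f (clamp a b y)| < e.
  move=> x; apply/cvgrPdist_lt => e e0; have [d d0 {}H] := H x e e0.
  by near=> y; apply: H; near: y; apply: cvgr_dist_lt => //.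
move=> e0; have [d d0 H] := acf e e0; exists d => // y xyd.
wlog xy : x y xyd / x <= y.
  move=> W; have [xy|/ltW yx] := leP x y; first exact: W.
  by rewrite distrC; apply: W => //; rewrite distrC.
have := H 1%N (fun=> clamp a b x) (fun=> clamp a b y).
rewrite !big_ord1 distrC; apply.
- move=> _; have /andP[-> _] := clamp_itv x ab; have /andP[_ ->] := clamp_itv y ab.
  by rewrite le_clamp.
- by move=> i j _ _ _; rewrite !ord1.
- by apply: le_lt_trans xyd; rewrite distrC ger0_norm ?subr_ge0// clamp_dist.
Unshelve. all: by end_near. Qed.

End absolute_continuity2.

(** * Absolutely continuous functions as indefinite integrals *)

Section lebesgue_stieltjes_domination.
Context {R : realType}.
Local Notation mu := (@lebesgue_measure R).
Implicit Types (a b : R) (f g : R -> R).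

Lemma lebesgue_stieltjes_measure_ocitv (G : cumulative R R) x y : x <= y ->
  lebesgue_stieltjes_measure G `]x, y] = (G y - G x)%:E.
Proof.
move=> xy; rewrite -(wlength_itv_bnd G false false xy).
by apply: (measurable_mu_extE (wlength G)); exact: is_ocitv.
Qed.

Lemma lebesgue_measure_ocitv (x y : R) : x <= y -> mu `]x, y] = (y - x)%:E.
Proof. by move=> xy; apply: lebesgue_stieltjes_measure_ocitv. Qed.

Lemma ocitv_le (X : set R) : ocitv X -> exists p : R * R, p.1 <= p.2 /\ X = `]p.1, p.2]%classic.
Proof.
move=> [[x y] _ /= <-]; exists (x, Num.max x y) => /=; split; first by rewrite le_max lexx.
by case: (leP x y) => // yx; rewrite !set_itv_ge// bnd_simp -leNgt ?lexx// ltW.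
Qed.

Section monotone.
Variables (a b : R) (g : R -> R).
Hypothesis ab : a < b.
Hypothesis ndg : {in `[a, b] &, {homo g : x y / x <= y}}.
Hypothesis acg : abs_continuous a b g.

Let G := g \o clamp a b.

Let G_nd : {homo G : x y / x <= y}.
Proof.
move=> x y xy; apply: ndg; last exact: le_clamp.
- by rewrite in_itv/= clamp_itv// ltW.
- by rewrite in_itv/= clamp_itv// ltW.
Qed.

Let G_rc : right_continuous G.
Proof.
apply: right_continuousW => x.
exact: (abs_continuous_continuous_clamp (ltW ab) acg).
Qed.

HB.instance Definition _ := isCumulative.Build R _ R G G_nd G_rc.

Let nu := lebesgue_stieltjes_measure G.

Let nu_ocitv x y : x <= y -> nu `]x, y] = (G y - G x)%:E.
Proof. exact: lebesgue_stieltjes_measure_ocitv. Qed.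

(** Absolute continuity of [g] read on finite disjoint families of half-open intervals. Clamping the
    end points shortens an interval and leaves its [nu]-measure unchanged. *)
Let small (e : R) : 0 < e -> exists2 d : R, 0 < d &
  forall B : {fset (set R)}, {in B, forall X, ocitv X} ->
    trivIset [set` B] id -> (\sum_(X <- B) mu X < d%:E)%E ->
    (\sum_(X <- B) nu X <= e%:E)%E.
Proof.
move=> e0; have [d d0 H] := abs_continuous_fin acg e0; exists d => // B oB tB.
have /choice[p Hp] (X : B) : exists p : R * R, p.1 <= p.2 /\ \val X = `]p.1, p.2]%classic.
  by apply/ocitv_le/oB; exact: valP.
rewrite !big_seq_fsetE/=.
under eq_bigr => X _ do rewrite (Hp X).2 lebesgue_measure_ocitv ?(Hp X).1//.
under [X in _ -> (X <= _)%E]eq_bigr => X _ do rewrite (Hp X).2 nu_ocitv ?(Hp X).1//.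
rewrite !sumEFin lte_fin lee_fin => Bd; apply/ltW.
have := H _ (fun X => clamp a b (p X).1) (fun X => clamp a b (p X).2).
move=> {}H; apply: le_lt_trans (H _ _ _) => //.
- by apply: ler_sum => X _; rewrite ler_norm.
- move=> X; have /andP[-> _] := clamp_itv (p X).1 (ltW ab).
  by have /andP[_ ->] := clamp_itv (p X).2 (ltW ab); rewrite le_clamp ?(Hp X).1.
- move=> X Y _ _ [z [/= zX zY]]; apply/val_inj.
  apply: tB; [exact: (valP X)|exact: (valP Y)|exists z].
  rewrite (Hp X).2 (Hp Y).2 /=.
  have key (q : R * R) : z \in `]clamp a b q.1, clamp a b q.2[ -> z \in `]q.1, q.2].
    rewrite !in_itv/= => /andP[]; rewrite /clamp.
    rewrite gt_max lt_max lt_min => /andP[az qz] /orP[za|/andP[zb zq]].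
      by have := lt_trans az za; rewrite ltxx.
    rewrite (ltW zq) andbT; move: qz; rewrite gt_min => /orP[bz|//].
    by have := lt_trans bz zb; rewrite ltxx.
  by split; apply: key.
- by apply: le_lt_trans Bd; apply: ler_sum => X _; rewrite clamp_dist ?(Hp X).1.
Qed.

(** A null set is covered by half-open intervals of total length below [d]. Each finite union of
    them has [nu]-measure at most [e] by [small], and continuity from below extends this to the
    whole cover. *)
Let nu_mu (A : set R) : measurable A -> mu A = 0 -> nu A = 0.
Proof.
move=> mA A0; apply/eqP; rewrite eq_le measure_ge0 andbT.
apply/lee_addgt0Pr => e e0; rewrite add0e.
have [d d0 H] := small e0.
have : (mu A < d%:E)%E by rewrite A0 lte_fin.
rewrite {1}/lebesgue_measure {1}/lebesgue_stieltjes_measure /=.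
rewrite /measure_extension /mu_ext.
move=> /ereal_inf_lt [_ [F [mF AF] <-] Fd].
pose F' : nat -> set R := F.
have mF' k : measurable (F' k) by apply: sub_sigma_algebra; exact: mF.
have {}AF : A `<=` \bigcup_k F' k by [].
have cov : (nu A <= nu (\bigcup_k F' k))%E.
  by apply: le_measure => //; rewrite inE//; apply: bigcupT_measurable.
apply: le_trans cov _.
have -> : \bigcup_k F' k = \bigcup_n \big[setU/set0]_(k < n.+1) F' k by rewrite bigcup_bigsetU_bigcup.
have mU n : measurable (\big[setU/set0]_(k < n.+1) F' k) by apply: bigsetU_measurable => k _; exact: mF'.
have ndU : {homo (fun n => \big[setU/set0]_(k < n.+1) F' k) : n m / (n <= m)%N >-> (n <= m)%O}.
  by move=> n m nm; apply/subsetPset; exact: subset_bigsetU.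
have cv := @nondecreasing_cvg_mu _ _ _ nu _ mU (bigcupT_measurable _ mU) ndU.
have -> : nu (\bigcup_n \big[setU/set0]_(k < n.+1) F' k) =
    limn (nu \o (fun n => \big[setU/set0]_(k < n.+1) F' k)).
  by apply/esym/cvg_lim.
apply: lime_le; first by apply/cvg_ex; eexists; exact: cv.
near=> n => /=.
(* The cover need not be disjoint; but a finite union lies in the ring generated by half-open
   intervals, whose members are finite disjoint unions of such intervals. *)
have : measurable (\big[setU/set0]_(k < n.+1) F' k : set (SetRing.type (ocitv_type R))).
  by apply: bigsetU_measurable => k _; apply: SetRing.measurable_subring; exact: mF.
move=> /SetRing.ring_finite_set[B [finB _ tB mB UB]].
have tB' : trivIset [set` fset_set B] id by rewrite fset_setK.
have oB X : X \in fset_set B -> ocitv X by rewrite in_fset_set// => /mB.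
have UBE : \big[setU/set0]_(k < n.+1) F' k = \bigcup_(X in B) X.
  by rewrite UB; apply: eq_bigcupl; split.
have sumB (m : {measure set (measurableTypeR R) -> \bar R}) :
    m (\big[setU/set0]_(k < n.+1) F' k) = (\sum_(X <- fset_set B) m X)%E.
  rewrite UBE measure_fin_bigcup//; first by rewrite fsbig_finite.
  by move=> X BX; apply: sub_sigma_algebra; apply: mB; rewrite inE.
apply: (@le_trans _ _ (\sum_(X <- fset_set B) nu X)%E); first by have /= <- := sumB nu.
apply: H => //; have /= <- := sumB mu.
apply: le_lt_trans Fd.
apply: (@le_trans _ _ (\sum_(k < n.+1) mu (F' k))%E); first by apply: Boole_inequality => k _; exact: mF'.
rewrite (eq_bigr (fun k : 'I_n.+1 => wlength idfun (F' k))); last first.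
  by move=> k _; apply: (measurable_mu_extE (wlength idfun)); exact: mF.
rewrite -(big_mkord xpredT (fun k => wlength idfun (F' k))).
by apply: nneseries_lim_ge => k _ _; exact: (wlength_ge0 idfun).
Unshelve. all: by end_near. Qed.

Let nuD_lty : (nu `]a, b] < +oo)%E.
Proof. by rewrite nu_ocitv ?ltry// ltW. Qed.

(** The Stieltjes measure of the clamped function, restricted to []a, b]], is dominated by Lebesgue
    measure; the density is its Radon-Nikodym derivative. *)
Lemma monotone_abs_continuous_density :
  exists h : R -> R, [/\ mu.-integrable setT (EFin \o h) &
    forall x y, a <= x -> x <= y -> y <= b ->
      g y - g x = (\int[mu]_(t in `]x, y]) h t)%R].
Proof.
pose nuD := mfrestr (f := nu) (measurable_itv `]a, b]) nuD_lty.
have dom : nuD `<< mu.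
  apply/null_content_dominatesP => A mA A0.
  rewrite /nuD /mfrestr /mrestr; apply/eqP; rewrite eq_le measure_ge0 andbT.
  rewrite -(nu_mu mA A0); apply: le_measure; rewrite ?inE//.
  exact: measurableI.
have [h [hfin inth hE]] : exists h : R -> \bar R, [/\ (forall x, h x \is a fin_num),
    mu.-integrable (setT : set R) h &
    forall A : set R, measurable A -> nuD A = (\int[mu]_(x in A) h x)%E].
  by have [h [h0 hfin inth hE]] := radon_nikodym_sigma_finite dom; exists h.
have hK x : (fine (h x))%:E = h x by rewrite fineK.
exists (fine \o h); split.
  by apply: eq_integrable inth => // x _ /=; rewrite hK.
move=> x y ax xy yb; rewrite /Rintegral.
under eq_integral do rewrite /= hK.
have <- := hE `]x, y]%classic (measurable_itv _).
rewrite /nuD /mfrestr /mrestr setIidl; last first.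
  by move=> z /=; rewrite !in_itv/= => /andP[xz zy]; rewrite (le_lt_trans ax) ?(le_trans zy).
rewrite nu_ocitv//= /G /= !clamp_id ?ax ?(le_trans xy)//.
by rewrite yb (le_trans ax xy).
Qed.

End monotone.

(** Jordan decomposition: [f = V - (V - f)] with [V] the total variation function, both terms being
    nondecreasing and absolutely continuous. *)
Lemma abs_continuous_density a b f : a < b -> abs_continuous a b f ->
  exists h : R -> R, [/\ mu.-integrable setT (EFin \o h) &
    forall x y, a <= x -> x <= y -> y <= b ->
      f y - f x = (\int[mu]_(t in `]x, y]) h t)%R].
Proof.
move=> ab acf; have bvf := abs_continuous_bounded_variation (ltW ab) acf.
pose V x := fine (total_variation a x f).
have acV : abs_continuous a b V := abs_continuous_total_variation (ltW ab) acf.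
have ndV : {in `[a, b] &, {homo V : x y / x <= y}}.
  move=> x y; rewrite !in_itv/= => /andP[ax xb] /andP[ay yb] xy.
  rewrite -subr_ge0 (total_variation_fineB ax xy yb bvf).
  exact/fine_ge0/total_variation_ge0.
have ndVf : {in `[a, b] &, {homo (V \- f) : x y / x <= y}}.
  move=> x y; rewrite !in_itv/= => /andP[ax xb] /andP[ay yb] xy.
  rewrite -subr_ge0 [leRHS](_ : _ = (V y - V x) - (f y - f x)); last by ring.
  rewrite subr_ge0 (total_variation_fineB ax xy yb bvf).
  have bvxy := bounded_variationr ax xy (bounded_variationl ay yb bvf).
  rewrite -lee_fin fineK; last exact/(bounded_variationP _ xy).
  by apply: le_trans (total_variation_ge _ xy); rewrite lee_fin ler_norm.
have [h [inth hE]] := monotone_abs_continuous_density ab ndV acV.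
have [k [intk kE]] := monotone_abs_continuous_density ab ndVf (abs_continuousB acV acf).
exists (h \- k); split.
  by have := integrableB measurableT inth intk; apply: eq_integrable => // x _ /=.
move=> x y ax xy yb.
rewrite RintegralB//; [|exact: integrableS inth|exact: integrableS intk].
by rewrite -hE// -kE//=; ring.
Qed.

End lebesgue_stieltjes_domination.

(** * Measurability and almost everywhere existence of derivatives *)

Section derivative_measurable.
Context {R : realType}.
Local Notation mu := (@lebesgue_measure R).
Implicit Types (a b : R) (f g : R -> R).

(** By the Cauchy criterion the set where the difference quotients converge is a countable
    intersection of countable unions of closed sets. There the derivative is a limit of continuous
    quotients; elsewhere [derive1] takes a constant default value. *)
Lemma continuous_measurable_derive1 f : continuous f ->
  measurable_fun setT (derive1 f).
Proof.
move=> cf.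
pose q (h x : R) := h^-1 * (f (h + x) - f x).
have cq h : continuous (q h).
  move=> x; apply: cvgM; first exact: cvg_cst.
  apply: cvgB; last exact: cf.
  apply: (@cvg_comp _ _ _ (fun x => h + x) f _ (nbhs (h + x))); last exact: cf.
  by apply: cvgD; [exact: cvg_cst|exact: cvg_id].
(* The union runs over uncountably many pairs of increments, but all its members are open. *)
pose U (e d : R) : set R := \bigcup_(p in [set p : R * R |
   [/\ p.1 != 0, p.2 != 0, `|p.1| < d & `|p.2| < d]]) [set x | e < `|q p.1 x - q p.2 x|].
have oU e d : open (U e d).
  apply: bigcup_open => -[r s] _ /=.
  have cqq : continuous (fun x => `|q r x - q s x|).
    by move=> x; apply: cvg_norm; apply: cvgB; exact: cq.
  exact: (open_comp (fun x _ => cqq x) (@open_gt R e)).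
pose D : set R := \bigcap_k \bigcup_m ~` U k.+1%:R^-1 m.+1%:R^-1.
have mD : measurable D.
  apply: bigcapT_measurable => k; apply: bigcupT_measurable => m.
  by apply: measurableC; apply: open_measurable; exact: oU.
have derE x : derive1 f x = lim (q h x @[h --> 0^']) by [].
have qD x : D x -> cvg (q h x @[h --> 0^']).
  move=> Dx; apply/cauchy_cvgP/cauchyP => e e0.
  have [k _ /= ke] := near_infty_natSinv_lt (PosNum e0).
  have [m _ /= Um] := Dx k I.
  have d0 : 0 < m.+1%:R^-1 / 2 :> R by rewrite divr_gt0.
  exists (q (m.+1%:R^-1 / 2) x).
  rewrite /= /nbhs/= /dnbhs /within /=.
  exists m.+1%:R^-1 => [|h /=]; first by rewrite /= invr_gt0.
  rewrite /ball/= sub0r normrN => hm h0.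
  rewrite /ball/=; apply: (@le_lt_trans _ _ k.+1%:R^-1); last exact: ke (leqnn k).
  rewrite leNgt; apply/negP => lt; apply: Um; exists (m.+1%:R^-1 / 2, h) => //=.
  have d1 : `|m.+1%:R^-1 / 2| < m.+1%:R^-1 :> R.
    by rewrite gtr0_norm// ltr_pdivrMr// ltr_pMr// ltr1n.
  by split => //; rewrite lt0r_neq0.
have Dq x : cvg (q h x @[h --> 0^']) -> D x.
  move=> /cvg_ex[l ql] k _.
  have k0 : 0 < k.+1%:R^-1 / 2 :> R by rewrite divr_gt0.
  have /cvgrPdist_lt/(_ _ k0) := ql.
  rewrite /= /nbhs/= /dnbhs /within /= => -[d /= d0 Hd].
  have [m _ /= md] := near_infty_natSinv_lt (PosNum d0).
  exists m => // -[[r s] [/= r0 s0 rd sd]]; apply/negP; rewrite -leNgt.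
  have {}md := md m (leqnn m).
  have Hr := Hd r; have Hs := Hd s; rewrite /ball/= !sub0r !normrN in Hr Hs.
  have {}Hr := Hr (lt_trans rd md) r0; have {}Hs := Hs (lt_trans sd md) s0.
  rewrite (_ : q r x - q s x = (l - q s x) - (l - q r x)); last by ring.
  by apply: le_trans (ler_normB _ _) _; rewrite (splitr k.+1%:R^-1) lerD// ltW.
rewrite -(setUv D); apply/measurable_funU => //; first exact: measurableC.
split.
  apply: (@measurable_realfun.measurable_fun_cvg _ _ _ D (fun n => q n.+1%:R^-1)).
    by move=> n; apply: measurable_funTS; exact: continuous_measurable_fun.
  move=> x Dx; have /cvgr_dnbhsP qx := qD x Dx.
  apply: qx; split; last exact: cvg_harmonic.
  by move=> n; rewrite invr_neq0.
apply: (eq_measurable_fun (cst (point : R))); last exact: measurable_cst.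
move=> x; rewrite inE => Dx; rewrite derE; apply/esym/dvgP => /Dq.
exact: Dx.
Qed.

Lemma near_itv_oo a b x : a < x < b -> \forall y \near x, a < y < b.
Proof.
move=> /andP[ax xb].
have : x \in `]a, b[ by rewrite in_itv/= ax xb.
move=> /near_in_itvoo; apply: filterS => y.
by rewrite in_itv.
Qed.

Lemma eq_derive1_itv a b f g x : {in `]a, b[, f =1 g} -> a < x < b ->
  derive1 f x = derive1 g x /\ (derivable f x 1 -> derivable g x 1).
Proof.
move=> fg /near_itv_oo axb.
have nfg : \near x, f x = g x.
  by apply: filterS axb => y yab; apply: fg; rewrite in_itv.
split; first by rewrite !derive1E; exact: near_eq_derive.
exact: near_eq_derivable.
Qed.

(** Lebesgue differentiation of the indefinite integral of [h], from which [f] differs by a constant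
    on the open interval. *)
Lemma density_derivative a b f (h : R -> R) :
  mu.-integrable setT (EFin \o h) ->
  (forall x y, a <= x -> x <= y -> y <= b ->
    f y - f x = (\int[mu]_(t in `]x, y]) h t)%R) ->
  {ae mu, forall x, a < x < b -> derivable f x 1 /\ derive1 f x = h x}.
Proof.
move=> inth hE.
have intay y : mu.-integrable [set` Interval (BRight a) (BRight y)] (EFin \o h).
  exact: integrableS inth.
have loch : locally_integrable setT h.
  have := integrable_locally measurableT inth; rewrite (_ : h \_ setT = h)//.
  by apply/funext => x; rewrite patchE in_setT.
have := FTC1 intay loch; apply: filterS; first exact: (ae_filter_ringOfSetsType mu).
move=> x Hx /andP[ax xb].
have [|dF FE] := Hx; first by rewrite ?bnd_simp.
have Ff : {in `]a, b[, (fun y => \int[mu]_(t in [set` Interval (BRight a) (BRight y)]) h t) =1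
     (fun y => f y - f a)}.
  by move=> y; rewrite in_itv/= => /andP[ay yb]; rewrite hE// ?ltW.
have axb : a < x < b by rewrite ax.
have [e1 d1] := eq_derive1_itv Ff axb.
have d2 : derivable (fun y => f y - f a) x 1 by exact: d1.
have d3 : derivable f x 1.
  have -> : f = (fun y => f y - f a) \+ cst (f a) by apply/funext => y /=; rewrite subrK.
  exact: derivableD.
split => //; rewrite -FE e1 !derive1E deriveB//=.
by rewrite derive_cst subr0.
Qed.

Lemma abs_continuous_derivative a b f : a < b -> abs_continuous a b f ->
  exists h : R -> R, [/\ mu.-integrable setT (EFin \o h),
    (forall x y, a <= x -> x <= y -> y <= b ->
      f y - f x = (\int[mu]_(t in `]x, y]) h t)%R) &
    {ae mu, forall x, a < x < b -> derivable f x 1 /\ derive1 f x = h x}].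
Proof.
move=> ab acf; have [h [inth hE]] := abs_continuous_density ab acf.
by exists h; split => //; exact: density_derivative.
Qed.

End derivative_measurable.

(** * Locally absolutely continuous functions on (0,1) *)

Section locally_absolutely_continuous.
Context {R : realType}.
Local Notation mu := (@lebesgue_measure R).
Implicit Types (a b : R) (f g : R -> R).

Lemma itv01_exhaust (x : R) : 0 < x < 1 ->
  \forall n \near \oo, n.+3%:R^-1 < x < 1 - n.+3%:R^-1.
Proof.
move=> /andP[x0 x1]; have m0 : 0 < Num.min x (1 - x) by rewrite lt_min x0 subr_gt0.
have := near_infty_natSinv_lt (PosNum m0); apply: filterS => n /=; rewrite lt_min => /andP[nx nx'].
have le3 : n.+3%:R^-1 <= n.+1%:R^-1 :> R.
  by rewrite lef_pV2 ?posrE// ler_nat ltnS ltnW.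
by rewrite (le_lt_trans le3 nx)/= ltrBrDr addrC -ltrBrDr (le_lt_trans le3).
Qed.

(** Starting the denominators at 3 keeps 1/(n+3) below 1/2, so that no interval of the exhaustion is
    empty. *)
Lemma itv01_seq (n : nat) : 0 < n.+3%:R^-1 :> R /\
  n.+3%:R^-1 < 1 - n.+3%:R^-1 :> R /\ 1 - n.+3%:R^-1 < 1 :> R.
Proof.
have n0 : 0 < n.+3%:R^-1 :> R by rewrite invr_gt0.
have n2 : n.+3%:R^-1 < 2^-1 :> R by rewrite ltf_pV2 ?posrE// ltr_nat.
move: n0 n2; move: (n.+3%:R^-1 : R) => c c0 c2; split => //; split; lra.
Qed.

Lemma AC_loc01_derivable f : AC_loc01 f ->
  {ae mu, forall x, 0 < x < 1 -> derivable f x 1}.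
Proof.
move=> acf.
have H (n : nat) : {ae mu, forall x, n.+3%:R^-1 < x < 1 - n.+3%:R^-1 -> derivable f x 1}.
  have [n0 [n1 n2]] := itv01_seq n.
  have [h [_ _]] := abs_continuous_derivative n1 (acf _ _ n0 n1 n2).
  apply: (@filterS _ _ (ae_filter_ringOfSetsType mu)).
  by move=> x Hx /Hx[].
have := ae_foralln H; apply: (@filterS _ _ (ae_filter_ringOfSetsType mu)).
move=> x Hx /itv01_exhaust[n _ /(_ n (leqnn n))]; exact: Hx.
Qed.

Lemma AC_loc01_continuous f x : AC_loc01 f -> 0 < x < 1 -> {for x, continuous f}.
Proof.
move=> acf /itv01_exhaust[n _ /(_ n (leqnn n))] /= xn.
have [n0 [n1 n2]] := itv01_seq n.
have cc := abs_continuous_continuous_clamp (ltW n1) (acf _ _ n0 n1 n2).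
have /near_itv_oo nx := xn.
have fx : (f \o clamp n.+3%:R^-1 (1 - n.+3%:R^-1)) x = f x.
  by rewrite /= clamp_id//; case/andP: xn => /ltW -> /ltW ->.
have := cc x; rewrite /continuous_at fx; apply: cvg_trans.
apply: near_eq_cvg; apply: filterS nx => y /andP[y1 y2] /=.
by rewrite clamp_id// (ltW y1) ltW.
Qed.

Lemma AC_loc01_within_continuous f : AC_loc01 f -> {in `]0, 1[, continuous f}.
Proof. by move=> acf x; rewrite in_itv/= => x01; exact: AC_loc01_continuous. Qed.

Lemma AC_loc01_measurable f : AC_loc01 f -> measurable_fun `](0 : R), 1[%classic f.
Proof.
move=> acf; apply: open_continuous_measurable_fun; first exact: interval_open.
by move=> x; rewrite inE/=; apply: AC_loc01_within_continuous.
Qed.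

Lemma itv01_bigcup : `](0 : R), 1[%classic =
  \bigcup_n (`]n.+3%:R^-1, 1 - n.+3%:R^-1[%classic).
Proof.
apply/seteqP; split => x /=.
  rewrite in_itv/= => /itv01_exhaust[n _ /(_ n (leqnn n))] xn.
  by exists n => //=; rewrite in_itv.
move=> [n _ /=]; have [n0 [n1 n2]] := itv01_seq n.
rewrite !in_itv/= => /andP[xn nx].
by rewrite (lt_trans n0)// (lt_trans nx).
Qed.

Lemma AC_loc01_measurable_derive1 f : AC_loc01 f ->
  measurable_fun `](0 : R), 1[%classic (derive1 f).
Proof.
move=> acf; rewrite itv01_bigcup; apply/measurable_fun_bigcup => // n.
have [n0 [n1 n2]] := itv01_seq n.
have cc := abs_continuous_continuous_clamp (ltW n1) (acf _ _ n0 n1 n2).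
apply: (eq_measurable_fun (derive1 (f \o clamp n.+3%:R^-1 (1 - n.+3%:R^-1)))); last first.
  by apply: measurable_funTS; exact: continuous_measurable_derive1.
move=> x; rewrite inE/= in_itv/= => xn.
apply: (eq_derive1_itv _ xn).1 => y; rewrite in_itv/= => /andP[y1 y2].
by rewrite clamp_id// (ltW y1) ltW.
Qed.

(** The density of [f] on a slightly larger compact interval agrees almost everywhere with
    [derive1 f] and can be replaced by it. *)
Lemma AC_loc01_FTC f x y : AC_loc01 f -> 0 < x -> x <= y -> y < 1 ->
  mu.-integrable `]x, y] (EFin \o derive1 f) /\
  f y - f x = (\int[mu]_(t in `]x, y]) derive1 f t)%R.
Proof.
move=> acf x0 xy y1.
have [a [b [a0 ax yb b1]]] : exists a b, [/\ 0 < a, a < x, y < b & b < 1].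
  by exists (x / 2), ((y + 1) / 2); split; lra.
have ab : a < b by apply: (lt_trans ax); exact: (le_lt_trans xy).
have [h [inth hE dE]] := abs_continuous_derivative ab (acf _ _ a0 ab b1).
have mD : measurable_fun `]x, y]%classic (derive1 f).
  apply: measurable_funS (AC_loc01_measurable_derive1 acf) => //.
  by move=> z /=; rewrite !in_itv/= => /andP[xz zy]; rewrite (lt_trans x0 xz) (le_lt_trans zy).
have mh : measurable_fun `]x, y]%classic h.
  apply: measurable_funTS; apply/measurable_EFinP; exact: measurable_int inth.
have ae : ae_eq mu `]x, y]%classic (EFin \o h) (EFin \o derive1 f).
  move: dE; apply: (@filterS _ _ (ae_filter_ringOfSetsType mu)).
  move=> z Hz /=; rewrite in_itv/= => /andP[xz zy].
  by have [|_ ->] := Hz => //; rewrite (lt_trans ax xz) (le_lt_trans zy).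
split.
  apply/integrableP; split; first exact/measurable_EFinP.
  have E : (\int[mu]_(t in `]x, y]) `|(EFin \o h) t| =
      \int[mu]_(t in `]x, y]) `|(EFin \o derive1 f) t|)%E.
    apply: ae_eq_integral => //.
    - by apply: measurableT_comp => //; exact/measurable_EFinP.
    - by apply: measurableT_comp => //; exact/measurable_EFinP.
    - by move: ae; apply: (@filterS _ _ (ae_filter_ringOfSetsType mu)) => z Hz /= /Hz /= [->].
  rewrite -E.
  by have /integrableP[] : mu.-integrable `]x, y]%classic (EFin \o h) by exact: integrableS inth.
rewrite hE//; [|exact: ltW..]; rewrite /Rintegral; congr fine; apply: ae_eq_integral => //; exact/measurable_EFinP.
Qed.

End locally_absolutely_continuous.

(** * Powers and integrals on (0,1) *)

Section real_powers.
Context {R : realType}.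
Implicit Types x y a b p q c : R.

Lemma powR_expR x y : (expR x) `^ y = expR (x * y).
Proof. by rewrite /powR gt_eqF ?expR_gt0// expRK mulrC. Qed.

(** Either [x] is below the constant, or c x^(p-1) >= 1. This additive substitute for the inequality
    of Hölder, with a free weight [c], is what bounds tails by the energy. *)
Lemma young_split p c x : 1 < p -> 0 < c -> 0 <= x ->
  x <= c * x `^ p + c `^ (- (p - 1)^-1).
Proof.
move=> p1 c0 x0; have p10 : 0 < p - 1 by rewrite subr_gt0.
have [xc|cx] := leP x (c `^ (- (p - 1)^-1)).
  by rewrite (le_trans xc)// lerDr mulr_ge0 ?powR_ge0// ltW.
have x0' : 0 < x by apply: le_lt_trans cx; exact: powR_ge0.
apply: (@le_trans _ _ (c * x `^ p)); last by rewrite lerDl powR_ge0.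
have -> : p = 1 + (p - 1) by ring.
rewrite powRD; last by rewrite (gt_eqF x0') implybT.
rewrite powRr1// mulrCA ler_pMr//.
have : (c `^ (- (p - 1)^-1)) `^ (p - 1) <= x `^ (p - 1).
  by rewrite ge0_ler_powR ?nnegrE ?powR_ge0 ?ltW.
rewrite -powRrM mulNr mulVf ?gt_eqF// powR_inv1 ?(ltW c0)//.
by move=> H; rewrite -ler_pdivrMl// mulr1.
Qed.

Lemma young_powR a b p q : 0 <= a -> 0 <= b -> 0 < p -> 0 < q ->
  p^-1 + q^-1 = 1 -> a * b <= a `^ p / p + b `^ q / q.
Proof. exact: conjugate_powR. Qed.

(** Young's inequality for [x] and 1 with the conjugate exponents [q] and [q / (q - 1)]. *)
Lemma bernoulli_powR x q : 0 <= x -> 1 < q -> 1 + q * (x - 1) <= x `^ q.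
Proof.
move=> x0 q1; have q0 : 0 < q by apply: lt_trans q1.
have q10 : 0 < q - 1 by rewrite subr_gt0.
have e : q^-1 + (q / (q - 1))^-1 = 1 by field; rewrite !gt_eqF.
have := conjugate_powR x0 ler01 q0 (divr_gt0 q0 q10) e.
rewrite powR1 mulr1 mul1r => H.
have : q * x <= q * (x `^ q / q + (q / (q - 1))^-1) by rewrite ler_pM2l.
rewrite (_ : q * (_ + _) = x `^ q + (q - 1)); last by field; rewrite !gt_eqF.
lra.
Qed.

(* Weighted AM-GM: the exponents [s] and [1 - s] are the weights. *)
Lemma weighted_amgm a b s : 0 < a -> 0 < b -> 0 < s < 1 ->
  a `^ s * b `^ (1 - s) <= s * a + (1 - s) * b.
Proof.
move=> a0 b0 /andP[s0 s1].
have s10 : 0 < 1 - s by rewrite subr_gt0.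
have e : s^-1^-1 + (1 - s)^-1^-1 = 1 by rewrite !invrK; ring.
have := conjugate_powR (powR_ge0 a s) (powR_ge0 b (1 - s)) _ _ e.
rewrite !invr_gt0 !invrK => /(_ s0 s10).
rewrite -!powRrM !divff ?gt_eqF// !powRr1 ?(ltW a0) ?(ltW b0)//.
by rewrite [a * _]mulrC [b * _]mulrC.
Qed.

(** [powR] does not vanish at negative bases, so it does not continue the power by 0 there. This
    truncation is differentiable on the whole line for exponents above 1, which the chain rule needs
    where a tail vanishes. *)
Definition pospow q x : R := if 0 < x then x `^ q else 0.

Lemma pospowE q x : 0 < q -> 0 <= x -> pospow q x = x `^ q.
Proof.
move=> q0; rewrite le_eqVlt /pospow => /predU1P[<-|->//].
by rewrite ltxx powR0// gt_eqF.
Qed.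

Lemma continuous_pospow s : 0 < s -> continuous (pospow s).
Proof.
move=> s0 x; have [x0|x0|->] := ltgtP x 0.
- have e : \near x, cst 0 x = pospow s x.
    near=> y; rewrite /pospow ltNge (_ : y <= 0)//; apply/ltW.
    by near: y; exact: lt_nbhsl.
  apply: cvg_trans; first exact: near_eq_cvg e.
  by rewrite /pospow ltNge (ltW x0)/=; exact: cvg_cst.
- have e : \near x, (@powR R)^~ s x = pospow s x.
    near=> y; rewrite /pospow (_ : 0 < y)//.
    by near: y; exact: lt_nbhsr.
  apply: cvg_trans; first exact: near_eq_cvg e.
  rewrite /pospow x0; have dp : derivable ((@powR R)^~ s) x 1.
    by apply: derivable_powR; rewrite in_itv/= x0.
  by move/derivable1_diffP : dp => /differentiable_continuous.
- apply/cvgrPdist_lt => e e0; rewrite /pospow ltxx.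
  exists (e `^ s^-1) => [|y /=]; first exact: powR_gt0.
  rewrite !sub0r !normrN; case: ifPn => [y0|_ _]; last by rewrite normr0.
  rewrite gtr0_norm// gtr0_norm ?powR_gt0// => ye.
  have -> : e = (e `^ s^-1) `^ s by rewrite -powRrM mulVf ?gt_eqF// powRr1// ltW.
  by rewrite gt0_ltr_powR// nnegrE ltW// powR_gt0.
Unshelve. all: by end_near. Qed.

Lemma is_derive_pospow q x : 1 < q ->
  is_derive x 1 (pospow q) (q * pospow (q - 1) x).
Proof.
move=> q1; have q10 : 0 < q - 1 by rewrite subr_gt0.
have [x0|x0|->] := ltgtP x 0.
- have e : {near x, cst 0 =1 pospow q}.
    near=> y; rewrite /pospow ltNge (_ : y <= 0)//; apply/ltW.
    by near: y; exact: lt_nbhsl.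
  rewrite /pospow [0 < x]ltNge (ltW x0)/= mulr0; apply: DeriveDef.
    by apply: near_eq_derivable e _; exact: derivable_cst.
  by rewrite -(near_eq_derive _ e) derive_cst.
- have e : {near x, (@powR R)^~ q =1 pospow q}.
    near=> y; rewrite /pospow (_ : 0 < y)//.
    by near: y; exact: lt_nbhsr.
  have [d1 d2] := is_derive1_powR q x0.
  rewrite {2}/pospow x0; apply: DeriveDef.
    exact: near_eq_derivable e d1.
  by rewrite -(near_eq_derive _ e).
(* At 0 the slope function is again a truncated power, continuous because [q - 1] is positive. *)
- apply/is_derive1_caratheodory; exists (pospow (q - 1)); split.
  + move=> z; rewrite !subr0 {2}/pospow ltxx subr0 /pospow.
    case: ifPn => [z0|_]; last by rewrite mul0r.
    by rewrite -{3}(powRr1 (ltW z0)) -powRD ?subrK// (gt_eqF z0) implybT.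
  + exact: continuous_pospow.
  + by rewrite /pospow ltxx mulr0.
Unshelve. all: by end_near. Qed.

End real_powers.

Section abs_continuous_algebra.
Context {R : realType}.
Local Notation mu := (@lebesgue_measure R).
Implicit Types (a b c d K : R) (f g F : R -> R).

Lemma C1_lipschitz c d F F' : (forall x, c <= x <= d -> is_derive x 1 F (F' x)) ->
  {within `[c, d], continuous F'} ->
  exists2 K, 0 <= K & forall x y, c <= x <= d -> c <= y <= d ->
    `|F x - F y| <= K * `|x - y|.
Proof.
move=> dF cF'.
have [cd|dc] := leP c d; last first.
  by exists 0 => // x y /andP[cx xd]; have := lt_le_trans dc (le_trans cx xd); rewrite ltxx.
have cN : {within `[c, d], continuous (fun x => `|F' x|)}.
  by move=> x; apply: cvg_norm; exact: cF'.
have [k _ Hk] := EVT_max cd cN.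
exists `|F' k| => // x y.
wlog xy : x y / x <= y.
  move=> W; have [xy|/ltW yx] := leP x y; first exact: W.
  by move=> h1 h2; rewrite distrC [ `|x - y| ]distrC; exact: W.
move=> /andP[cx xd] /andP[cy yd].
have dF' z : z \in `[x, y] -> is_derive z 1 F (F' z).
  by rewrite in_itv/= => /andP[xz zy]; apply: dF; rewrite (le_trans cx xz) (le_trans zy yd).
have dFoo z : z \in `]x, y[ -> is_derive z 1 F (F' z).
  by move=> zxy; apply: dF'; exact: subset_itv_oo_cc.
have cF : {within `[x, y], continuous F}.
  by apply: derivable_within_continuous => z zxy; have [] := dF' z zxy.
have [z zxy e] := MVT_segment xy dFoo cF.
rewrite distrC e normrM [ `|x - y| ]distrC ler_wpM2r//; apply: Hk.
move: zxy; rewrite !in_itv/= => /andP[xz zy].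
by rewrite (le_trans cx xz) (le_trans zy yd).
Qed.

Lemma abs_continuous_comp a b c d K f F : 0 <= K ->
  (forall x, a <= x <= b -> c <= f x <= d) ->
  (forall x y, c <= x <= d -> c <= y <= d -> `|F x - F y| <= K * `|x - y|) ->
  abs_continuous a b f -> abs_continuous a b (F \o f).
Proof.
move=> K0 fcd FK acf e e0; have K1 : 0 < K + 1 by rewrite ltr_wpDl.
have [D D0 H] := acf (e / (K + 1)) (divr_gt0 e0 K1).
exists D => // n x y xy tI xyd.
have := H n x y xy tI xyd; rewrite ltr_pdivlMr// mulrC; apply: le_lt_trans.
rewrite mulr_sumr; apply: ler_sum => i _ /=; have [ax [xyi yb]] := xy i.
apply: (@le_trans _ _ (K * `|f (y i) - f (x i)|)); last by rewrite ler_wpM2r// lerDl.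
by apply: FK; apply: fcd; rewrite ?ax ?yb ?(le_trans ax xyi) ?(le_trans xyi yb).
Qed.

Lemma abs_continuous_id a b : abs_continuous a b (@id R).
Proof.
move=> e e0; exists e => // n x y xy tI h. apply: le_lt_trans h.
by apply: ler_sum => i _; rewrite ger0_norm// subr_ge0; have [_ []] := xy i.
Qed.

Lemma abs_continuousM a b f g K : 0 <= K ->
  (forall x, a <= x <= b -> `|f x| <= K) -> (forall x, a <= x <= b -> `|g x| <= K) ->
  abs_continuous a b f -> abs_continuous a b g ->
  abs_continuous a b (fun x => f x * g x).
Proof.
move=> K0 fK gK acf acg e e0; have K1 : 0 < K + 1 by rewrite ltr_wpDl.
have e2 : 0 < e / 2 / (K + 1) by rewrite !divr_gt0.
have [d d0 H] := acf _ e2; have [d' d'0 H'] := acg _ e2.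
exists (Num.min d d'); first by rewrite lt_min d0.
move=> n x y xy tI; rewrite lt_min => /andP[xyd xyd'].
have := H n x y xy tI xyd; have := H' n x y xy tI xyd'.
rewrite !(ltr_pdivlMr _ _ K1) => h1 h2; rewrite (splitr e).
apply: le_lt_trans (ltrD h2 h1); rewrite !mulr_suml -big_split/=.
apply: ler_sum => i _; have [ax [xyi yb]] := xy i.
have -> : f (y i) * g (y i) - f (x i) * g (x i) =
   (f (y i) - f (x i)) * g (y i) + (g (y i) - g (x i)) * f (x i) by ring.
apply: le_trans (ler_normD _ _) _; rewrite !normrM; apply: lerD; apply: ler_wpM2l => //.
  by apply: le_trans (gK _ _) _; rewrite ?lerDl// yb (le_trans ax xyi).
by apply: le_trans (fK _ _) _; rewrite ?lerDl// ax (le_trans xyi yb).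
Qed.

End abs_continuous_algebra.

Section real_valued_nonneg_integral.
Context {R : realType}.
Local Notation mu := (@lebesgue_measure R).
Local Notation I01 := (`](0 : R)%R, 1%R[%classic).
Implicit Types (A B D : set R) (F G : R -> R).

Lemma int_le D F G : measurable D -> measurable_fun D F -> measurable_fun D G ->
  (forall x, D x -> 0 <= F x) -> (forall x, D x -> F x <= G x) ->
  (\int[mu]_(x in D) (F x)%:E <= \int[mu]_(x in D) (G x)%:E)%E.
Proof.
move=> mD mF mG F0 FG.
have mF' : measurable_fun D (EFin \o F) by exact/measurable_EFinP.
have mG' : measurable_fun D (EFin \o G) by exact/measurable_EFinP.
have G0 x : D x -> 0 <= G x by move=> Dx; rewrite (le_trans (F0 x Dx))// FG.
by apply: ge0_le_integral.
Qed.

Lemma int_subset A B F : measurable A -> measurable B -> measurable_fun B F ->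
  (forall x, B x -> 0 <= F x) -> A `<=` B ->
  (\int[mu]_(x in A) (F x)%:E <= \int[mu]_(x in B) (F x)%:E)%E.
Proof.
move=> mA mB mF F0 AB; apply: ge0_subset_integral => //.
exact/measurable_EFinP.
Qed.

Lemma int_add D F G : measurable D -> measurable_fun D F -> measurable_fun D G ->
  (forall x, D x -> 0 <= F x) -> (forall x, D x -> 0 <= G x) ->
  (\int[mu]_(x in D) (F x + G x)%:E =
   \int[mu]_(x in D) (F x)%:E + \int[mu]_(x in D) (G x)%:E)%E.
Proof.
move=> mD mF mG F0 G0; under eq_integral do rewrite EFinD.
by apply: ge0_integralD => //; exact/measurable_EFinP.
Qed.

Lemma int_scale D (k : R) F : measurable D -> measurable_fun D F ->
  (forall x, D x -> 0 <= F x) -> 0 <= k ->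
  (\int[mu]_(x in D) (k * F x)%:E = k%:E * \int[mu]_(x in D) (F x)%:E)%E.
Proof.
move=> mD mF F0 k0; under eq_integral do rewrite EFinM.
by rewrite ge0_integralZl_EFin//; exact/measurable_EFinP.
Qed.

Lemma int_cst D (k : R) : measurable D -> (\int[mu]_(x in D) k%:E = k%:E * mu D)%E.
Proof. by move=> mD; exact: (integral_cst mu mD k%:E). Qed.

Lemma int_ge0 D F : (forall x, D x -> 0 <= F x) -> (0 <= \int[mu]_(x in D) (F x)%:E)%E.
Proof. by move=> F0; apply: integral_ge0 => x Dx; rewrite lee_fin F0. Qed.

Lemma mu_itv_oc (x y : R) : x <= y -> mu `]x, y]%classic = (y - x)%:E.
Proof. exact: lebesgue_measure_ocitv. Qed.

Lemma mu_itv_oo (x y : R) : x <= y -> mu `]x, y[%classic = (y - x)%:E.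
Proof.
rewrite lebesgue_measure_itv/= lte_fin le_eqVlt => /predU1P[->|->//].
by rewrite ltxx subrr.
Qed.

Lemma ge0_int_integrable D F : measurable D -> measurable_fun D F ->
  (forall x, D x -> 0 <= F x) -> (\int[mu]_(x in D) (F x)%:E < +oo)%E ->
  mu.-integrable D (EFin \o F).
Proof.
move=> mD mF F0 Foo; apply/integrableP; split; first exact/measurable_EFinP.
apply: le_lt_trans Foo; rewrite le_eqVlt; apply/orP; left; apply/eqP.
by apply: eq_integral => x; rewrite inE => Dx /=; rewrite ger0_norm ?F0.
Qed.

(** Monotone convergence along the exhausting intervals. *)
Lemma int_exhaust01 F (K : \bar R) : measurable_fun I01 F ->
  (forall x, 0 < x < 1 -> 0 <= F x) ->
  (forall a b, 0 < a -> a < b -> b < 1 -> (\int[mu]_(x in `]a, b]) (F x)%:E <= K)%E) ->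
  (\int[mu]_(x in I01) (F x)%:E <= K)%E.
Proof.
move=> mF F0 H; rewrite itv01_bigcup.
pose I (n : nat) := `]n.+3%:R^-1 : R, 1 - n.+3%:R^-1[%classic.
have sub01 n : I n `<=` `](0 : R), 1[%classic by rewrite itv01_bigcup; exact: bigcup_sup.
have mI n : measurable_fun (I n) (EFin \o F).
  by apply/measurable_EFinP; apply: measurable_funS mF.
have ndI : {homo I : n m / (n <= m)%N >-> (n <= m)%O}.
  move=> n m nm; apply/subsetPset => x; rewrite /I /= !in_itv/= => /andP[nx xn].
  have mn : m.+3%:R^-1 <= n.+3%:R^-1 :> R by rewrite lef_pV2 ?posrE// ler_nat.
  by rewrite (le_lt_trans mn nx)/= (lt_le_trans xn)// lerB.
have cv : (\int[mu]_(x in I n) (F x)%:E)%E @[n --> \oo] -->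
    (\int[mu]_(x in \bigcup_i I i) (F x)%:E)%E.
  apply: ge0_nondecreasing_set_cvg_integral => //; first by move=> i; exact: measurable_itv.
  by move=> n x /sub01 H01; rewrite lee_fin; apply: F0; move: H01; rewrite /= in_itv.
rewrite -(cvg_lim _ cv)//; apply: lime_le; first by apply/cvg_ex; eexists; exact: cv.
apply: nearW => n; have [n0 [n1 n2]] := itv01_seq (R := R) n.
apply: le_trans (H _ _ n0 n1 n2); apply: int_subset => //.
- exact: measurable_itv.
- apply: measurable_funS mF => // x /=; rewrite !in_itv/= => /andP[nx xn].
  by rewrite (lt_trans n0 nx) (le_lt_trans xn).
- move=> x /=; rewrite in_itv/= => /andP[nx xn].
  by apply: F0; rewrite (lt_trans n0 nx) (le_lt_trans xn).
- exact: subset_itv_oo_oc.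
Qed.

End real_valued_nonneg_integral.

(** * Tails of functions with finite energy *)

Section power_integral.
Context {R : realType}.
Local Notation mu := (@lebesgue_measure R).

Lemma continuous_within_powR (s x y : R) : 0 < x ->
  {within `[x, y], continuous (fun r => r `^ s)}.
Proof.
move=> x0; apply: derivable_within_continuous => r; rewrite in_itv/= => /andP[xr _].
by apply: derivable_powR; rewrite in_itv/= (lt_le_trans x0).
Qed.

Lemma int_powR_le (s x y : R) : 1 < s -> 0 < x -> x < y ->
  (\int[mu]_(r in `]x, y[) (r `^ (- s))%:E <= (x `^ (1 - s) / (s - 1))%:E)%E.
Proof.
move=> s1 x0 xy; have s10 : 0 < s - 1 by rewrite subr_gt0.
pose F (r : R) := - (r `^ (1 - s) / (s - 1)).
have dF (r : R) : 0 < r -> is_derive r 1 F (r `^ (- s)).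
  move=> r0; have := is_derive1_powR (1 - s) r0 => d.
  have -> : r `^ (- s) = - ((s - 1)^-1 *: ((1 - s) * r `^ (1 - s - 1))).
    rewrite /GRing.scale/= (_ : 1 - s - 1 = - s); last by ring.
    by field; rewrite gt_eqF.
  rewrite (_ : F = - ((s - 1)^-1 *: (@powR R)^~ (1 - s))).
    exact: is_deriveN.
  by apply/funext => z; rewrite /F mulrC.
have cF r : r \in `[x, y] -> derivable F r 1.
  by rewrite in_itv/= => /andP[xr _]; have [] := dF r (lt_le_trans x0 xr).
apply: (@le_trans _ _ (\int[mu]_(r in `[x, y]) (r `^ (- s))%:E)%E).
  apply: int_subset => //; [|by move=> r _; exact: powR_ge0|exact: subset_itv_oo_cc].
  apply: subspace_continuous_measurable_fun => //.
  exact: continuous_within_powR.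
have := derivable_within_continuous cF => cwF.
rewrite (@continuous_FTC2 _ _ F)//.
- rewrite -EFinB lee_fin /F opprK addrC gerBl divr_ge0 ?powR_ge0//.
  exact: ltW.
- exact: continuous_within_powR.
- split.
  + by move=> r rxy; apply: cF; exact: subset_itv_oo_cc.
  + have /continuous_within_itvP[] := cwF; first exact: xy.
    by [].
  + have /continuous_within_itvP[] := cwF; first exact: xy.
    by [].
- move=> r; rewrite in_itv/= => /andP[xr _]; rewrite derive1E.
  by have [_ ->] := dF r (lt_trans x0 xr).
Qed.

End power_integral.

(** When [f] is the derivative of some [u] vanishing at 1, this nonincreasing function dominates |u|
    and has derivative -|f| almost everywhere, hence the same gradient norm. It stands in for [u]
    throughout. For [0 < x] the integral is finite by [tail_integrable]. *)
Definition tail {R : realType} (f : R -> R) (x : R) : R :=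
  (\int[@lebesgue_measure R]_(t in `]x, 1%R[) `|f t|)%R.

Section density.
Context {R : realType}.
Local Notation mu := (@lebesgue_measure R).
Local Notation I01 := (`](0 : R)%R, 1%R[%classic).
Context (p a1 : R) (hp : 1 < p) (ha1 : 0 <= a1) (hN : 0 < a1 - p + 1).

Lemma wdens_ge0 (f : R -> R) r : 0 <= r `^ a1 * `|f r| `^ p.
Proof. by rewrite mulr_ge0 ?powR_ge0. Qed.

Lemma wdens_measurable (q g : R) (f : R -> R) (D : set R) : measurable_fun D f ->
  measurable_fun D (fun r => r `^ g * `|f r| `^ q).
Proof.
move=> mf; apply: measurable_funM.
  by apply: measurable_funTS; exact: measurable_powR.
apply: (measurableT_comp (measurable_powR q)).
exact: measurableT_comp.
Qed.

Context (f : R -> R) (hf : wL p a1 f).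

Let mf : measurable_fun I01 f := hf.1.
Let dens r := r `^ a1 * `|f r| `^ p.
Let mdens : measurable_fun I01 dens.
Proof. exact: wdens_measurable. Qed.

Lemma wint_fin_num : wint p a1 f \is a fin_num.
Proof.
rewrite ge0_fin_numE; first exact: hf.2.
by apply: int_ge0 => x _; exact: wdens_ge0.
Qed.

Let p10 : 0 < p - 1. Proof. by rewrite subr_gt0. Qed.

(** [young_split] with weight eta r^a1, so that the p-th power becomes the energy density. *)
Lemma young_density (r eta : R) : 0 < eta -> 0 < r ->
  `|f r| <= eta * dens r + eta `^ (- (p - 1)^-1) * r `^ (- (a1 / (p - 1))).
Proof.
move=> e0 r0; have := young_split hp (mulr_gt0 e0 (powR_gt0 a1 r0)) (normr_ge0 (f r)).
by rewrite -mulrA powRM ?powR_ge0 ?(ltW e0)// -powRrM mulrN.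
Qed.

Lemma young_int (A : set R) (a eta : R) : 0 < a -> 0 < eta -> measurable A ->
  (forall x, A x -> a <= x < 1) ->
  (\int[mu]_(x in A) `|f x|%:E <= eta%:E * \int[mu]_(x in A) (dens x)%:E +
     (eta `^ (- (p - 1)^-1) * a `^ (- (a1 / (p - 1))))%:E * mu A)%E.
Proof.
move=> a0 e0 mA Aa1.
have A01 : A `<=` I01.
  by move=> x /Aa1 /andP[ax x1]; rewrite /= in_itv/= (lt_le_trans a0 ax).
have mdA : measurable_fun A dens by exact: measurable_funS mdens.
have mfA : measurable_fun A f by exact: measurable_funS mf.
rewrite -int_scale ?(ltW e0)//; last by move=> x _; exact: wdens_ge0.
rewrite -int_cst// -int_add//.
- apply: int_le => //.
  + exact: measurableT_comp.
  + by apply: measurable_funD => //; exact: measurable_funM.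
  + move=> x Ax; have /andP[ax x1] := Aa1 x Ax; have x0 := lt_le_trans a0 ax.
    apply: le_trans (young_density e0 x0) _; rewrite lerD2l ler_wpM2l ?powR_ge0//.
    rewrite !powRN lef_pV2 ?posrE ?powR_gt0//; apply: ge0_ler_powR => //.
    * by rewrite divr_ge0// ltW.
    * by rewrite nnegrE ltW.
    * by rewrite nnegrE ltW.
- exact: measurable_funM.
- by move=> x _; rewrite mulr_ge0 ?wdens_ge0// ltW.
- by move=> x _; rewrite mulr_ge0 ?powR_ge0.
Qed.

Lemma int_dens_le (A : set R) : measurable A -> A `<=` I01 ->
  (\int[mu]_(x in A) (dens x)%:E <= wint p a1 f)%E.
Proof. by move=> mA A01; apply: int_subset => // x _; exact: wdens_ge0. Qed.

Lemma tail_integrable (x : R) : 0 < x -> mu.-integrable `]x, 1[%classic (fun t => `|f t|%:E).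
Proof.
move=> x0; have x01 : `]x, 1[%classic `<=` I01.
  by move=> z /=; rewrite !in_itv/= => /andP[xz ->]; rewrite (lt_trans x0 xz).
apply: ge0_int_integrable => //.
  by apply: measurableT_comp => //; exact: measurable_funS mf.
have [x1|x1] := leP 1 x.
  by rewrite set_itv_ge ?integral_set0// bnd_simp -leNgt.
apply: le_lt_trans (young_int x0 ltr01 _ _) _ => //.
  by move=> z /=; rewrite in_itv/= => /andP[/ltW -> ->].
rewrite mul1e lte_add_pinfty//.
  by apply: le_lt_trans (int_dens_le _ x01) _ => //; exact: hf.2.
by rewrite (mu_itv_oo (ltW x1)) -EFinM ltry.
Qed.

Lemma tailE (x : R) : 0 < x -> (tail f x)%:E = (\int[mu]_(t in `]x, 1%R[) `|f t|%:E)%E.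
Proof.
move=> x0; rewrite /tail /Rintegral fineK//; apply: integrable_fin_num => //.
exact: tail_integrable.
Qed.

Lemma tail_ge0 (x : R) : 0 <= tail f x.
Proof. exact: Rintegral_ge0. Qed.

Lemma tail_split (x y : R) : 0 < x -> x <= y -> y < 1 ->
  tail f x - tail f y = (\int[mu]_(t in `]x, y]) `|f t|)%R.
Proof.
move=> x0 xy y1.
have := @Rintegral_itvB _ (fun t => `|f t|) (BRight x) (BLeft 1) y (tail_integrable x0).
rewrite !bnd_simp => /(_ xy y1) E; rewrite /tail -E; ring.
Qed.

Lemma tail_splitE (x y : R) : 0 < x -> x <= y -> y < 1 ->
  (tail f x - tail f y)%:E = (\int[mu]_(t in `]x, y]) `|f t|%:E)%E.
Proof.
move=> x0 xy y1; rewrite tail_split// /Rintegral fineK//; apply: integrable_fin_num => //.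
apply: integrableS (tail_integrable x0) => //.
by move=> z /=; rewrite !in_itv/= => /andP[-> zy]; rewrite (le_lt_trans zy).
Qed.

Lemma tail_le (x y : R) : 0 < x -> x <= y -> y < 1 -> tail f y <= tail f x.
Proof.
by move=> x0 xy y1; rewrite -subr_ge0 tail_split//; exact: Rintegral_ge0.
Qed.

(** The constant part of the bound on |f| over [a, 1) when [eta] times the energy density is split
    off. It does not depend on [f], so tails of bounded energy are equicontinuous away from 0. *)
Definition modulus_const (a eta : R) : R :=
  eta `^ (- (p - 1)^-1) * a `^ (- (a1 / (p - 1))).

Lemma modulus_const_ge0 a eta : 0 <= modulus_const a eta.
Proof. by rewrite mulr_ge0 ?powR_ge0. Qed.

Lemma tail_dist_le (a x y eta : R) : 0 < a -> a <= x -> x <= y -> y < 1 -> 0 < eta ->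
  ((`|tail f y - tail f x|)%:E <=
    eta%:E * \int[mu]_(t in `]x, y[) (dens t)%:E + (modulus_const a eta * (y - x))%:E)%E.
Proof.
move=> a0 ax xy y1 e0; have x0 := lt_le_trans a0 ax.
rewrite distrC ger0_norm ?subr_ge0 ?tail_le// tail_splitE//.
have mfxy : measurable_fun `]x, y[%classic f.
  apply: measurable_funS mf => // z /=; rewrite !in_itv/= => /andP[xz zy].
  by rewrite (lt_trans x0 xz) (lt_trans zy).
rewrite -integral_itv_bndo_bndc; last first.
  by apply/measurable_EFinP; exact: measurableT_comp.
apply: le_trans (young_int a0 e0 _ _) _ => //.
  move=> z /=; rewrite in_itv/= => /andP[xz zy].
  by rewrite (ltW (le_lt_trans ax xz)) (lt_trans zy).
by rewrite (mu_itv_oo xy) -EFinM.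
Qed.

(** The intervals are disjoint, so their energies add up to at most the whole energy. As [f] enters
    the bound only through its energy, the estimate passes to pointwise limits of tails. *)
Lemma sum_tail_dist_le (a b eta : R) n (x y : 'I_n -> R) : 0 < a -> b < 1 -> 0 < eta ->
  (forall i, a <= x i /\ x i <= y i /\ y i <= b) ->
  trivIset [set: 'I_n] (fun i => `]x i, y i[%classic) ->
  \sum_(i < n) `|tail f (y i) - tail f (x i)| <=
    eta * fine (wint p a1 f) + modulus_const a eta * \sum_(i < n) (y i - x i).
Proof.
move=> a0 b1 e0 xy tI; rewrite -lee_fin EFinD EFinM fineK ?wint_fin_num//.
rewrite -sumEFin; apply: (@le_trans _ _ (\sum_(i < n)
  (eta%:E * \int[mu]_(t in `]x i, y i[) (dens t)%:E +
   (modulus_const a eta * (y i - x i))%:E))%E).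
  apply: lee_sum => i _; have [ax [xyi yb]] := xy i.
  by apply: tail_dist_le => //; exact: le_lt_trans b1.
rewrite big_split/= mulr_sumr -sumEFin; apply: leeD => //.
rewrite -ge0_sume_distrr; last by move=> i _; apply: int_ge0 => t _; exact: wdens_ge0.
rewrite lee_pmul2l ?lte_fin//.
have sub i : `]x i, y i[%classic `<=` I01.
  have [ax [xyi yb]] := xy i; move=> z /=; rewrite !in_itv/= => /andP[xz zy].
  by rewrite (le_lt_trans _ xz) ?(lt_le_trans zy) ?(le_trans (ltW a0))// (le_trans yb) ?ltW.
rewrite -(@ge0_integral_bigsetU _ _ _ mu _ (fun i => `]x i, y i[%classic)
  (fun t => (dens t)%:E) (index_enum 'I_n))//.
- apply: int_dens_le; first by apply: bigsetU_measurable => i _; exact: measurable_itv.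
  by move=> z; rewrite -bigcup_seq => -[i _]; exact: sub.
- exact: index_enum_uniq.
- exact: sub_trivIset tI.
- apply/measurable_EFinP; apply: measurable_funS mdens => //.
  by move=> z; rewrite -bigcup_seq => -[i _]; exact: sub.
- by move=> t _; rewrite lee_fin; exact: wdens_ge0.
Qed.

Lemma tail_AC : AC_loc01 (tail f).
Proof.
move=> a b a0 ab b1 e e0.
pose K := fine (wint p a1 f) + 1.
have K0 : 0 < K.
  by rewrite ltr_wpDl// fine_ge0//; apply: int_ge0 => t _; exact: wdens_ge0.
pose eta := e / 2 / K; have eta0 : 0 < eta by rewrite !divr_gt0.
pose C := modulus_const a eta + 1.
have C0 : 0 < C by rewrite ltr_wpDl// modulus_const_ge0.
exists (e / 2 / C); first by rewrite !divr_gt0.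
move=> n x y xy tI; rewrite ltr_pdivlMr// => xyd.
apply: le_lt_trans (sum_tail_dist_le a0 b1 eta0 xy tI) _.
rewrite (splitr e); apply: ler_ltD.
  by rewrite /eta -mulrA ler_piMr ?divr_ge0 ?(ltW e0)// mulrC ler_pdivrMr// mul1r lerDl.
apply: le_lt_trans xyd; rewrite mulrC ler_wpM2l ?lerDl//.
by apply: sumr_ge0 => i _; rewrite subr_ge0; have [_ []] := xy i.
Qed.

Lemma tail_cvg1 : tail f r @[r --> 1^'-] --> (0 : R).
Proof.
apply/cvgrPdist_lt => e e0.
pose K := fine (wint p a1 f) + 1.
have K0 : 0 < K.
  by rewrite ltr_wpDl// fine_ge0//; apply: int_ge0 => t _; exact: wdens_ge0.
pose eta := e / 2 / K; have eta0 : 0 < eta by rewrite !divr_gt0.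
pose C := modulus_const 2^-1 eta + 1.
have C0 : 0 < C by rewrite ltr_wpDl// modulus_const_ge0.
have h2 : 2^-1 < 1 :> R by rewrite invf_lt1 ?ltr1n.
near=> r; rewrite sub0r normrN ger0_norm ?tail_ge0//.
have r1 : r < 1 by near: r; exact: nbhs_left_lt.
have r2 : 2^-1 <= r by near: r; exact: nbhs_left_ge.
have r0 : 0 < r by apply: lt_le_trans r2.
rewrite -lte_fin tailE//.
apply: le_lt_trans (young_int (a := 2^-1) (eta := eta) _ _ _ _) _ => //.
  by move=> z /=; rewrite in_itv/= => /andP[rz ->]; rewrite (le_trans r2 (ltW rz)).
rewrite (mu_itv_oo (ltW r1)) -EFinM.
have le1 : (\int[mu]_(t in `]r, 1%R[) (dens t)%:E <= wint p a1 f)%E.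
  apply: int_dens_le => // z /=; rewrite !in_itv/= => /andP[rz ->].
  by rewrite (lt_trans r0 rz).
apply: (@le_lt_trans _ _ ((eta * fine (wint p a1 f) + modulus_const 2^-1 eta * (1 - r))%:E)).
  rewrite EFinD; apply: leeD2r; rewrite (EFinM eta) fineK ?wint_fin_num// lee_pmul2l ?lte_fin//.
rewrite lte_fin (splitr e); apply: ler_ltD.
  by rewrite /eta -mulrA ler_piMr ?divr_ge0 ?(ltW e0)// mulrC ler_pdivrMr// mul1r lerDl.
have rC : 1 - r < e / 2 / C.
  rewrite ltrBlDr addrC -ltrBlDr; near: r; apply: nbhs_left_gt.
  by rewrite ltrBlDr ltrDl !divr_gt0.
move: rC; rewrite ltr_pdivlMr//; apply: le_lt_trans.
by rewrite mulrC ler_wpM2l ?lerDl// subr_ge0 ltW.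
Unshelve. all: by end_near. Qed.

Lemma tail_derive : {ae mu, forall x, 0 < x < 1 ->
  derivable (tail f) x 1 /\ derive1 (tail f) x = - `|f x|}.
Proof.
have H (n : nat) : {ae mu, forall x, n.+3%:R^-1 < x < 1 - n.+3%:R^-1 ->
   derivable (tail f) x 1 /\ derive1 (tail f) x = - `|f x|}.
  have [n0 [n1 n2]] := itv01_seq (R := R) n.
  set a := n.+3%:R^-1 in n0 n1 n2 *; set b := 1 - a in n1 n2 *.
  pose h := (fun t => - `|f t|) \_ `]a, 1[%classic.
  have inth : mu.-integrable setT (EFin \o h).
    have := (@integrable_mkcond _ _ _ mu _ _ (measurable_itv `]a, 1[)).1 (integrableN (tail_integrable n0)).
    apply: eq_integrable => //.
    by move=> x _ /=; rewrite /h !patchE; case: ifP.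
  have hE x y : a <= x -> x <= y -> y <= b ->
      tail f y - tail f x = (\int[mu]_(t in `]x, y]) h t)%R.
    move=> ax xy yb; have x0 : 0 < x := lt_le_trans n0 ax.
    have y1 : y < 1 := le_lt_trans yb n2.
    have xysub z : `]x, y]%classic z -> z \in `]a, 1[%classic.
      rewrite inE /= !in_itv/= => /andP[xz zy].
      by rewrite (le_lt_trans ax xz) (le_lt_trans zy).
    rewrite -opprB tail_split// -mulN1r -RintegralZl//; last first.
      apply: integrableS (tail_integrable n0) => // z /xysub; by rewrite inE.
    apply: eq_Rintegral => t /[!inE] txy.
    by rewrite /h patchE xysub// mulN1r.
  have := density_derivative inth hE.
  apply: (@filterS _ _ (ae_filter_ringOfSetsType mu)) => x Hx /[dup] xab /Hx[dx ->].
  split => //; rewrite /h patchE ifT// inE/= in_itv/=.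
  by case/andP : xab => -> xb; rewrite (lt_trans xb).
have := ae_foralln H; apply: (@filterS _ _ (ae_filter_ringOfSetsType mu)).
move=> x Hx /itv01_exhaust[n _ /(_ n (leqnn n))]; exact: Hx.
Qed.

(** With N = a1 - p + 1 and the weight [eta] = x^(-N/p), the energy term and the explicit integral
    of r^(-a1/(p-1)) carry the same power of [x]. That integral has size x^(1 - a1/(p-1)) because a1
    > p - 1. *)
Lemma tail_growth (x : R) : 0 < x -> x < 1 ->
  tail f x <= (fine (wint p a1 f) + (p - 1) / (a1 - p + 1)) * x `^ (- ((a1 - p + 1) / p)).
Proof.
move=> x0 x1; pose N := a1 - p + 1; pose s := a1 / (p - 1).
have p0 : 0 < p by apply: lt_trans hp.
have s1 : 1 < s by rewrite /s ltr_pdivlMr// mul1r; move: hN; lra.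
pose eta := x `^ (- (N / p)); have eta0 : 0 < eta by rewrite powR_gt0.
have mx : measurable_fun `]x, 1[%classic f.
  apply: measurable_funS mf => // z /=; rewrite !in_itv/= => /andP[xz ->].
  by rewrite (lt_trans x0 xz).
have mxd : measurable_fun `]x, 1[%classic dens by exact: wdens_measurable.
have mxs : measurable_fun `]x, 1[%classic (fun r => r `^ (- s)).
  by apply: measurable_funTS; exact: measurable_powR.
have le1 : (\int[mu]_(t in `]x, 1%R[) (dens t)%:E <= wint p a1 f)%E.
  apply: int_dens_le => // z /=; rewrite !in_itv/= => /andP[rz ->].
  by rewrite (lt_trans x0 rz).
rewrite -lee_fin tailE//.
apply: (@le_trans _ _ (\int[mu]_(t in `]x, 1%R[)
   (eta * dens t + eta `^ (- (p - 1)^-1) * t `^ (- s))%:E)%E).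
  apply: int_le => //; first exact: measurableT_comp.
    by apply: measurable_funD; exact: measurable_funM.
  move=> t /=; rewrite in_itv/= => /andP[xt _].
  by apply: young_density => //; exact: lt_trans xt.
rewrite int_add//; last 4 first.
- exact: measurable_funM.
- exact: measurable_funM.
- by move=> t _; rewrite mulr_ge0 ?wdens_ge0// ltW.
- by move=> t _; rewrite mulr_ge0 ?powR_ge0.
have mI : measurable `]x, 1[%classic by exact: measurable_itv.
rewrite (int_scale mI mxd (fun t _ => wdens_ge0 f t) (ltW eta0)).
rewrite (int_scale mI mxs (fun t _ => powR_ge0 t (- s)) (powR_ge0 eta _)).
apply: (@le_trans _ _ (eta%:E * wint p a1 f +
   (eta `^ (- (p - 1)^-1))%:E * (x `^ (1 - s) / (s - 1))%:E)%E).
  apply: leeD; rewrite lee_pmul2l ?lte_fin ?powR_gt0//.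
  exact: int_powR_le.
rewrite -(fineK wint_fin_num) -!EFinM -EFinD lee_fin mulrDl -/N.
rewrite [fine _ * _]mulrC lerD2l /eta -powRrM mulrA -powRD; last by rewrite (gt_eqF x0) implybT.
rewrite mulrC (_ : (s - 1)^-1 = (p - 1) / N); last first.
  by rewrite /s /N; field; rewrite !gt_eqF//=; move: hN; lra.
rewrite (_ : - (N / p) * - (p - 1)^-1 + (1 - s) = - (N / p))//.
by rewrite /s /N; field; rewrite !gt_eqF//; lra.
Qed.

End density.
Opaque tail.

(** * Integration by parts and the Hardy inequality *)

Section integration_by_parts.
Context {R : realType}.
Local Notation mu := (@lebesgue_measure R).
Local Notation I01 := (`](0 : R)%R, 1%R[%classic).
Context (p a1 : R) (hp : 1 < p) (ha1 : 0 <= a1) (hN : 0 < a1 - p + 1).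
Context (f : R -> R) (hf : wL p a1 f).
Local Notation v := (tail f).

(** The absolutely continuous function Z v^q has derivative Z' v^q - q Z v^(q-1) |f| almost
    everywhere. Its value at [a] is nonnegative and dropped, hence an inequality. *)
Lemma int_tail_ibp (q a b : R) (Z Z' : R -> R) : 1 < q -> 0 < a -> a < b -> b < 1 ->
  (forall r : R, a <= r <= b -> is_derive r 1 Z (Z' r)) ->
  {within `[a, b], continuous Z'} ->
  (forall r : R, a <= r <= b -> 0 <= Z r) -> (forall r : R, a <= r <= b -> 0 <= Z' r) ->
  (\int[mu]_(r in `]a, b]) (Z' r * v r `^ q)%:E <=
   (Z b * v b `^ q)%:E + \int[mu]_(r in `]a, b]) (q * Z r * v r `^ (q - 1) * `|f r|)%:E)%E.
Proof.
move=> q1 a0 ab b1 dZ cZ' Z0 Z'0.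
have q0 : 0 < q := lt_trans ltr01 q1.
have q10 : 0 < q - 1 by rewrite subr_gt0.
have sub01 : `]a, b]%classic `<=` I01.
  by move=> z /=; rewrite !in_itv/= => /andP[az zb]; rewrite (lt_trans a0 az) (le_lt_trans zb).
have subab : `]a, b]%classic `<=` `[a, b]%classic.
  by move=> z /=; rewrite !in_itv/= => /andP[/ltW -> ->].
have phiE s r : 0 < s -> v r `^ s = pospow s (v r) by move=> s0; rewrite pospowE ?tail_ge0.
pose G r := q * Z r * pospow (q - 1) (v r) * `|f r|.
pose F r := Z' r * pospow q (v r).
have G0 r : `]a, b]%classic r -> 0 <= G r.
  move=> /subab; rewrite /= in_itv/= => rab; rewrite /G -phiE//.
  by rewrite !mulr_ge0 ?powR_ge0 ?Z0// ltW.
have F0 r : `]a, b]%classic r -> 0 <= F r.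
  by move=> /subab; rewrite /= in_itv/= => rab; rewrite /F -phiE// mulr_ge0 ?powR_ge0 ?Z'0.
have EF : (\int[mu]_(r in `]a, b]) (Z' r * v r `^ q)%:E = \int[mu]_(r in `]a, b]) (F r)%:E)%E.
  by apply: eq_integral => r _; rewrite /F phiE.
have EG : (\int[mu]_(r in `]a, b]) (q * Z r * v r `^ (q - 1) * `|f r|)%:E =
    \int[mu]_(r in `]a, b]) (G r)%:E)%E.
  by apply: eq_integral => r _; rewrite /G phiE.
rewrite EF EG.
have cZ : {within `[a, b], continuous Z}.
  apply: derivable_within_continuous => r; rewrite in_itv/= => rab.
  by have [] := dZ r rab.
have mv : measurable_fun `]a, b]%classic v.
  by apply: measurable_funS (AC_loc01_measurable (tail_AC hp ha1 hf)).
have mpow s : 0 < s -> measurable_fun `]a, b]%classic (fun r => pospow s (v r)).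
  move=> s0; apply: (measurableT_comp _ mv).
  by apply: continuous_measurable_fun; exact: continuous_pospow.
have mwithin (g : R -> R) : {within `[a, b], continuous g} -> measurable_fun `]a, b]%classic g.
  move=> cg; apply: (@measurable_funS _ _ _ _ `[a, b]%classic) => //.
  by apply: subspace_continuous_measurable_fun.
have mF : measurable_fun `]a, b]%classic F.
  by apply: measurable_funM; [exact: mwithin|exact: mpow].
have mfab : measurable_fun `]a, b]%classic f by apply: measurable_funS hf.1.
have mG : measurable_fun `]a, b]%classic G.
  apply: measurable_funM; last exact: measurableT_comp.
  apply: measurable_funM; last exact: mpow.
  by apply: measurable_funM => //; exact: mwithin.
(* An infinite right-hand side leaves nothing to prove; otherwise [G] is integrable and the integral
   of [h + G] splits. *)
have [->|Gfin] := eqVneq (\int[mu]_(r in `]a, b]) (G r)%:E)%E +oo%E.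
  by rewrite addey// leey.
have intG : mu.-integrable `]a, b]%classic (EFin \o G).
  by apply: ge0_int_integrable => //; rewrite ltey.
pose Y r := Z r * pospow q (v r).
pose V := v a.
have v_le r : a <= r <= b -> 0 <= v r <= V.
  move=> /andP[ar rb]; rewrite tail_ge0 /V; apply: (tail_le hp ha1 hf) => //.
  exact: le_lt_trans b1.
have [K K0 KZ] := C1_lipschitz dZ cZ'.
have [L L0 Lphi] : exists2 L, 0 <= L & forall x y, 0 <= x <= V -> 0 <= y <= V ->
    `|pospow q x - pospow q y| <= L * `|x - y|.
  apply: (@C1_lipschitz _ 0 V (pospow q) (fun x => q * pospow (q - 1) x)).
    by move=> x _; exact: is_derive_pospow.
  apply: continuous_subspaceT => x; apply: cvgM; first exact: cvg_cst.
  exact: continuous_pospow.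
have acv : abs_continuous a b v by exact: (tail_AC hp ha1 hf).
have acZ : abs_continuous a b Z.
  exact: (abs_continuous_comp K0 (fun x xab => xab) KZ (@abs_continuous_id _ a b)).
have acphi : abs_continuous a b (fun r => pospow q (v r)).
  exact: (abs_continuous_comp L0 v_le Lphi acv).
pose B := Num.max (`|Z a| + K * (b - a)) (pospow q V).
have phiV r : a <= r <= b -> `|pospow q (v r)| <= pospow q V.
  move=> rab; have /andP[v0 vV] := v_le r rab.
  have V0 := le_trans v0 vV.
  rewrite (pospowE q0 v0) (pospowE q0 V0) (ger0_norm (powR_ge0 _ _)).
  exact: (ge0_ler_powR (ltW q0) v0 V0 vV).
have acY : abs_continuous a b Y.
  apply: (@abs_continuousM _ a b Z (fun r => pospow q (v r)) B) => //.
  - by rewrite le_max addr_ge0// mulr_ge0// subr_ge0 ltW.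
  - move=> r rab; rewrite le_max; apply/orP; left.
    have aab : a <= a <= b by rewrite lexx ltW.
    have := KZ r a rab aab; have := ler_normD (Z r - Z a) (Z a); rewrite subrK => h1 h2.
    apply: le_trans h1 _; rewrite addrC lerD2l; apply: le_trans h2 _.
    have /andP[ar rb] := rab.
    by rewrite ler_wpM2l// ger0_norm ?subr_ge0// lerB.
  - by move=> r rab; rewrite le_max phiV// orbT.
have [h [inth hE dY]] := abs_continuous_derivative ab acY.
have mh : measurable_fun `]a, b]%classic h.
  by apply: measurable_funTS; apply/measurable_EFinP; exact: measurable_int inth.
have inthab : mu.-integrable `]a, b]%classic (EFin \o h) by exact: integrableS inth.
have aeF : ae_eq mu `]a, b]%classic (EFin \o F) (EFin \o (fun r => h r + G r)).
  have : {ae mu, forall r, a < r < b -> derivable v r 1 /\ derive1 v r = - `|f r|}.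
    move: (tail_derive hp ha1 hf); apply: (@filterS _ _ (ae_filter_ringOfSetsType mu)).
    by move=> r Hr /andP[ar rb]; apply: Hr; rewrite (lt_trans a0 ar) (lt_trans rb).
  have neb : {ae mu, forall r, r != b}.
    exists [set b]; split; [exact: measurable_set1|exact: lebesgue_measure_set1|].
    by move=> r /= /negP; rewrite negbK => /eqP.
  apply: (@filterS3 _ _ (ae_filter_ringOfSetsType mu)) neb dY => r rb Yr vr /=.
  rewrite in_itv/= => /andP[ar rb']; congr EFin.
  have arb : a < r < b by rewrite ar lt_neqAle rb.
  have [_ <-] := Yr arb; have [dv vE] := vr arb.
  have arb' : a <= r <= b by rewrite (ltW ar).
  have dvr : is_derive r 1 v (- `|f r|) by apply: DeriveDef => //; rewrite -derive1E.
  have dp := is_derive_pospow (v r) q1.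
  have dpv : is_derive r 1 (pospow q \o v) ((q * pospow (q - 1) (v r)) * - `|f r|).
    exact: (is_derive1_comp dp dvr).
  have dZr := dZ r arb'.
  have dYr : is_derive r 1 (Z * (pospow q \o v)) _ := is_deriveM dZr dpv.
  rewrite derive1E (_ : Y = Z * (pospow q \o v))//.
  have [_ ->] := dYr; rewrite /F /G /GRing.scale/=; ring.
have -> : (\int[mu]_(r in `]a, b]) (F r)%:E = \int[mu]_(r in `]a, b]) (h r + G r)%:E)%E.
  apply: ae_eq_integral => //; first exact/measurable_EFinP.
  by apply/measurable_EFinP; exact: measurable_funD.
rewrite (@integralD _ _ _ mu _ (measurable_itv `]a, b]) _ _ inthab intG).
apply: leeD => //.
have -> : (\int[mu]_(r in `]a, b]) (h r)%:E = (Y b - Y a)%:E)%E.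
  by rewrite hE ?(ltW ab)// /Rintegral fineK//; exact: integrable_fin_num.
rewrite lee_fin phiE// lerBlDr lerDl /Y mulr_ge0 ?Z0 ?lexx ?(ltW ab)//.
by rewrite -phiE// powR_ge0.
Qed.

End integration_by_parts.

(** Young's inequality for k^s x and k^(-s) y with s = (p-1)/p. The weight [k] is tuned later so
    that one of the terms can be absorbed or cancelled. *)
Lemma young_weighted {R : realType} (p k x y : R) : 1 < p -> 0 < k -> 0 <= x -> 0 <= y ->
  x * y <= k * ((p - 1) / p) * x `^ (p / (p - 1)) + k `^ (1 - p) / p * y `^ p.
Proof.
move=> p1 k0 x0 y0; have p0 : 0 < p := lt_trans ltr01 p1.
have p10 : 0 < p - 1 by rewrite subr_gt0.
pose s := (p - 1) / p.
have e : (p / (p - 1))^-1 + p^-1 = 1 by field; rewrite !gt_eqF.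
have := conjugate_powR (mulr_ge0 (powR_ge0 k s) x0) (mulr_ge0 (powR_ge0 k (- s)) y0)
  (divr_gt0 p0 p10) p0 e.
rewrite !powRM ?powR_ge0// -!powRrM.
rewrite (_ : s * (p / (p - 1)) = 1); last by rewrite /s; field; rewrite !gt_eqF.
rewrite (_ : - s * p = 1 - p); last by rewrite /s; field; rewrite !gt_eqF.
rewrite powRr1 ?(ltW k0)// mulrACA -powRD; last by rewrite (gt_eqF k0) implybT.
rewrite subrr powRr0 mul1r invf_div => /le_trans; apply.
by rewrite le_eqVlt; apply/orP; left; apply/eqP; ring.
Qed.

Section hardy.
Context {R : realType}.
Local Notation mu := (@lebesgue_measure R).
Local Notation I01 := (`](0 : R)%R, 1%R[%classic).
Context (p a1 : R) (hp : 1 < p) (ha1 : 0 <= a1) (hN : 0 < a1 - p + 1).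
Context (f : R -> R) (hf : wL p a1 f).
Local Notation v := (tail f).

Let p0 : 0 < p. Proof. exact: lt_trans ltr01 hp. Qed.
Let p10 : 0 < p - 1. Proof. by rewrite subr_gt0. Qed.

Lemma hardy_young (N k r : R) : N = a1 - p + 1 -> 0 < k -> 0 < r ->
  p * r `^ N * v r `^ (p - 1) * `|f r| <=
  k * (p - 1) * (r `^ (N - 1) * v r `^ p) + k `^ (1 - p) * (r `^ a1 * `|f r| `^ p).
Proof.
move=> NE k0 r0.
pose X := r `^ ((N - 1) * (p - 1) / p) * v r `^ (p - 1).
pose Y := r `^ (a1 / p) * `|f r|.
have X0 : 0 <= X by rewrite mulr_ge0 ?powR_ge0.
have Y0 : 0 <= Y by rewrite mulr_ge0 ?powR_ge0.
have := young_weighted hp k0 X0 Y0; rewrite -(ler_pM2l p0).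
rewrite /X /Y !powRM ?powR_ge0// -!powRrM.
rewrite (_ : (N - 1) * (p - 1) / p * (p / (p - 1)) = N - 1); last by field; rewrite !gt_eqF.
rewrite (_ : (p - 1) * (p / (p - 1)) = p); last by field; rewrite gt_eqF.
rewrite (_ : a1 / p * p = a1); last by field; rewrite gt_eqF.
rewrite mulrACA -powRD; last by rewrite (gt_eqF r0) implybT.
rewrite (_ : (N - 1) * (p - 1) / p + a1 / p = N); last by rewrite NE; field; rewrite gt_eqF.
rewrite !mulrA => /le_trans; apply.
by rewrite le_eqVlt; apply/orP; left; apply/eqP; field; rewrite gt_eqF.
Qed.

(** Needed before a multiple of such an integral may be absorbed into the left-hand side. *)
Lemma tail_fin_int (a b s t : R) : 0 < a -> a < b -> b < 1 -> 0 <= t ->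
  (\int[mu]_(r in `]a, b]) (r `^ s * v r `^ t)%:E < +oo)%E.
Proof.
move=> a0 ab b1 t0.
have sub01 : `]a, b]%classic `<=` I01.
  by move=> z /=; rewrite !in_itv/= => /andP[az zb]; rewrite (lt_trans a0 az) (le_lt_trans zb).
have mv : measurable_fun `]a, b]%classic v.
  by apply: measurable_funS (AC_loc01_measurable (tail_AC hp ha1 hf)).
pose K := Num.max (a `^ s) (b `^ s).
have rK r : a <= r <= b -> r `^ s <= K.
  move=> /andP[ar rb]; have r0 := lt_le_trans a0 ar; have b0 := lt_trans a0 ab.
  rewrite le_max; have [s0|s0] := leP 0 s.
    by rewrite [X in _ || X](ge0_ler_powR s0 (ltW r0) (ltW b0) rb) orbT.
  have -> : s = - (- s) by rewrite opprK.
  rewrite !(powRN _ (- s)) lef_pV2 ?posrE ?powR_gt0//.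
  by rewrite (ge0_ler_powR _ (ltW a0) (ltW r0) ar)// oppr_ge0 ltW.
apply: (@le_lt_trans _ _ (\int[mu]_(r in `]a, b]) (K * v a `^ t)%:E)%E).
  apply: int_le; first exact: measurable_itv.
  - apply: measurable_funM; first by apply: measurable_funTS; exact: measurable_powR.
    exact: (measurableT_comp (measurable_powR t)).
  - exact: measurable_cst.
  - by move=> r _; rewrite mulr_ge0 ?powR_ge0.
  - move=> r /=; rewrite in_itv/= => /andP[ar rb].
    have rab : a <= r <= b by rewrite (ltW ar).
    have var : v r <= v a.
      by apply: (tail_le hp ha1 hf a0 (ltW ar)); exact: le_lt_trans b1.
    have vat := ge0_ler_powR t0 (tail_ge0 f r) (tail_ge0 f a) var.
    exact: (ler_pM (powR_ge0 _ _) (powR_ge0 _ _) (rK r rab) vat).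
rewrite int_cst; last exact: measurable_itv.
by rewrite (mu_itv_oc (ltW ab)) -EFinM ltry.
Qed.

(** Integration by parts with Z = r^N and exponent [p], then Young's inequality with a weight that
    lets half of the left-hand side be absorbed. *)
Lemma hardy_ineq : exists2 C : R, 0 <= C &
  (\int[mu]_(r in I01) (r `^ (a1 - p) * v r `^ p)%:E <= C%:E * wint p a1 f)%E.
Proof.
pose N := a1 - p + 1; have N0 : 0 < N := hN.
(* Chosen so that [k * (p - 1) = N / 2]: Young's inequality returns half of the left-hand
   integral. *)
pose k := N / (2 * (p - 1)); have k0 : 0 < k by rewrite divr_gt0 ?mulr_gt0.
pose E := fine (wint p a1 f).
have EE : E%:E = wint p a1 f by rewrite fineK// wint_fin_num.
have E0 : 0 <= E by apply: fine_ge0; apply: int_ge0 => r _; exact: wdens_ge0.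
pose C := 2 * k `^ (1 - p) / N.
have C0 : 0 <= C by rewrite divr_ge0 ?mulr_ge0 ?powR_ge0// ltW.
exists C => //.
have mv : measurable_fun I01 v by exact: (AC_loc01_measurable (tail_AC hp ha1 hf)).
have mF : measurable_fun I01 (fun r => r `^ (a1 - p) * v r `^ p).
  apply: measurable_funM; first by apply: measurable_funTS; exact: measurable_powR.
  exact: (measurableT_comp (measurable_powR p)).
have main a b : 0 < a -> a < b -> b < 1 ->
   (\int[mu]_(r in `]a, b]) (r `^ (a1 - p) * v r `^ p)%:E <=
     (2 / N * v b `^ p + C * E)%:E)%E.
  move=> a0 ab b1.
  have sub01 : `]a, b]%classic `<=` I01.
    by move=> z /=; rewrite !in_itv/= => /andP[az zb]; rewrite (lt_trans a0 az) (le_lt_trans zb).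
  have mFab := measurable_funS (measurable_itv _) sub01 mF.
  have mfab := measurable_funS (measurable_itv _) sub01 hf.1.
  set A := (X in (X <= _)%E).
  have Afin : A \is a fin_num.
    rewrite ge0_fin_numE; first exact: tail_fin_int (ltW p0).
    by apply: int_ge0 => r _; rewrite mulr_ge0 ?powR_ge0.
  have := @int_tail_ibp _ p a1 hp ha1 f hf p a b (fun r => r `^ N) (fun r => N * r `^ (N - 1))
    hp a0 ab b1.
  have d1 (r : R) : a <= r <= b -> is_derive r 1 (fun r => r `^ N) (N * r `^ (N - 1)).
    by move=> /andP[ar _]; apply: is_derive1_powR; exact: lt_le_trans ar.
  have c1 : {within `[a, b], continuous (fun r => N * r `^ (N - 1))}.
    by move=> x; apply: cvgM; [exact: cvg_cst|exact: continuous_within_powR].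
  move=> /(_ d1 c1 (fun r _ => powR_ge0 r N)
     (fun r _ => mulr_ge0 (ltW N0) (powR_ge0 r (N - 1)))).
  rewrite (_ : (\int[mu]_(r in `]a, b]) (N * r `^ (N - 1) * v r `^ p)%:E = N%:E * A)%E); last first.
    rewrite -(int_scale (measurable_itv _) mFab
      (fun r _ => mulr_ge0 (powR_ge0 r _) (powR_ge0 (v r) p)) (ltW N0)).
    by apply: eq_integral => r _; rewrite -mulrA /N addrK.
  move=> H; have {}H := le_trans H _.
  have {H} : (N%:E * A <= (v b `^ p)%:E + ((N / 2)%:E * A + (k `^ (1 - p))%:E * E%:E))%E.
    apply: H; apply: leeD.
      rewrite lee_fin -[leRHS]mul1r ler_wpM2r ?powR_ge0//.
      have b0 := lt_trans a0 ab.
      by have := ge0_ler_powR (ltW N0) (ltW b0) ler01 (ltW b1); rewrite powR1.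
    have mG : measurable_fun `]a, b]%classic (fun r => r `^ a1 * `|f r| `^ p).
      exact: wdens_measurable.
    apply: (@le_trans _ _ (\int[mu]_(r in `]a, b])
      (N / 2 * (r `^ (a1 - p) * v r `^ p) + k `^ (1 - p) * (r `^ a1 * `|f r| `^ p))%:E)%E).
      apply: int_le => //.
      - have mvab := measurable_funS (measurable_itv _) sub01 mv.
        apply: measurable_funM; last exact: measurableT_comp.
        apply: measurable_funM; last exact: (measurableT_comp (measurable_powR (p - 1))).
        by apply: measurable_funM => //; apply: measurable_funTS; exact: measurable_powR.
      - by apply: measurable_funD; exact: measurable_funM.
      - by move=> r _; rewrite !mulr_ge0 ?powR_ge0// ltW.
      - move=> r /=; rewrite in_itv/= => /andP[ar rb].
        have := hardy_young (erefl (a1 - p + 1)) k0 (lt_trans a0 ar).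
        by rewrite addrK (_ : k * (p - 1) = N / 2)// /k; field; rewrite gt_eqF.
    have N2 : 0 <= N / 2 by rewrite divr_ge0// ltW.
    have m1 : measurable_fun `]a, b]%classic (fun r => N / 2 * (r `^ (a1 - p) * v r `^ p)).
      exact: measurable_funM.
    have m2 : measurable_fun `]a, b]%classic (fun r => k `^ (1 - p) * (r `^ a1 * `|f r| `^ p)).
      exact: measurable_funM.
    rewrite (int_add (measurable_itv _) m1 m2
      (fun r _ => mulr_ge0 N2 (mulr_ge0 (powR_ge0 r _) (powR_ge0 (v r) p)))
      (fun r _ => mulr_ge0 (powR_ge0 k _) (wdens_ge0 p a1 f r))).
    rewrite (int_scale (measurable_itv _) mFab
      (fun r _ => mulr_ge0 (powR_ge0 r _) (powR_ge0 (v r) p)) N2).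
    rewrite (int_scale (measurable_itv _) mG (fun r _ => wdens_ge0 p a1 f r) (powR_ge0 k _)).
    rewrite leeD2l// EE; apply: lee_wpmul2l; first by rewrite lee_fin powR_ge0.
    exact: int_dens_le.
  rewrite -(fineK Afin) -!EFinM -!EFinD !lee_fin.
  move: (fine A) => x H.
  have : N / 2 * x <= v b `^ p + k `^ (1 - p) * E by move: H; lra.
  rewrite -ler_pdivlMl; last by rewrite divr_gt0.
  move/le_trans; apply; rewrite /C le_eqVlt; apply/orP; left; apply/eqP; field.
  by rewrite gt_eqF.
rewrite -EE -EFinM; apply: int_exhaust01 => //.
  by move=> r _; rewrite mulr_ge0 ?powR_ge0.
move=> a b a0 ab b1; apply/lee_addgt0Pr => e e0.
have e1 : 0 < (e * N / 2) `^ p^-1 by rewrite powR_gt0// !mulr_gt0.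
have := tail_cvg1 hp ha1 hf => /cvgrPdist_lt/(_ _ e1) near1.
(* Enlarging the interval up to a point [c] near 1 makes the boundary term, a multiple of v(c)^p,
   smaller than [e]. *)
near (1 : R)^'- => c.
have bc : b < c by near: c; exact: nbhs_left_gt.
have c1 : c < 1 by near: c; exact: nbhs_left_lt.
have vc : v c < (e * N / 2) `^ p^-1.
  have : `|0 - v c| < (e * N / 2) `^ p^-1 by near: c.
  by rewrite sub0r normrN ger0_norm ?tail_ge0.
have ac := lt_trans ab bc.
have sub : (\int[mu]_(r in `]a, b]) (r `^ (a1 - p) * v r `^ p)%:E <=
    \int[mu]_(r in `]a, c]) (r `^ (a1 - p) * v r `^ p)%:E)%E.
  apply: int_subset => [|||r _|].
  - exact: measurable_itv.
  - exact: measurable_itv.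
  - apply: measurable_funS mF; first exact: measurable_itv.
    move=> z /=; rewrite !in_itv/= => /andP[az zb].
    by rewrite (lt_trans a0 az) (le_lt_trans zb).
  - by rewrite mulr_ge0 ?powR_ge0.
  - by move=> z /=; rewrite !in_itv/= => /andP[-> zb]; rewrite (le_trans zb)// ltW.
apply: le_trans sub _.
apply: le_trans (main a c a0 ac c1) _; rewrite -EFinD lee_fin addrC lerD2l.
have : v c `^ p <= e * N / 2.
  have := ge0_ler_powR (ltW p0) (tail_ge0 f c) (powR_ge0 _ _) (ltW vc).
  by rewrite -powRrM mulVf ?gt_eqF// powRr1// !mulr_ge0// ltW.
move=> H; rewrite mulrAC ler_pdivrMr//; move: H; lra.
Unshelve. all: by end_near. Qed.

End hardy.

(** * The space X *)

Section sobolev_space.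
Context {R : realType}.
Local Notation mu := (@lebesgue_measure R).
Local Notation I01 := (`](0 : R)%R, 1%R[%classic).
Context (p a0 a1 : R) (hp : 1 < p) (ha0 : 0 <= a0) (ha1 : 0 <= a1)
  (hN : 0 < a1 - p + 1) (ha01 : a1 - p <= a0).

Let p0 : 0 < p. Proof. exact: lt_trans ltr01 hp. Qed.

Lemma AC_tail_dist (u : R -> R) x y : AC_loc01 u -> wL p a1 (derive1 u) ->
  0 < x -> x <= y -> y < 1 ->
  `|u y - u x| <= tail (derive1 u) x - tail (derive1 u) y.
Proof.
move=> acu wu x0 xy y1; have [intu ->] := AC_loc01_FTC acu x0 xy y1.
rewrite (tail_split hp ha1 wu)//; exact: le_normr_Rintegral.
Qed.

Lemma AC_le_tail (u : R -> R) x : AC_loc01 u -> wL p a1 (derive1 u) ->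
  u r @[r --> 1^'-] --> (0 : R) -> 0 < x < 1 -> `|u x| <= tail (derive1 u) x.
Proof.
move=> acu wu u1 /andP[x0 x1]; apply/ler_addgt0Pr => e e0.
have /cvgrPdist_lt/(_ _ e0) near1 := u1.
near (1 : R)^'- => y.
have xy : x < y by near: y; exact: nbhs_left_gt.
have y1 : y < 1 by near: y; exact: nbhs_left_lt.
have uy : `|u y| < e.
  have : `|0 - u y| < e by near: y.
  by rewrite sub0r normrN.
have H := AC_tail_dist acu wu x0 (ltW xy) y1.
have : `|u x| <= `|u y| + `|u y - u x|.
  have := ler_normB (u y) (u y - u x).
  by rewrite (_ : u y - (u y - u x) = u x)//; ring.
move/le_trans; apply; rewrite addrC; apply: lerD; last exact: ltW.
by apply: (le_trans H); rewrite gerBl tail_ge0.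
Unshelve. all: by end_near. Qed.

(** |u| is below the tail of its derivative, r^a0 <= r^(a1-p) on (0,1) because [a1 - p <= a0], and
    the Hardy inequality bounds the resulting integral. *)
Lemma wL_of_gradient (u : R -> R) : AC_loc01 u -> wL p a1 (derive1 u) ->
  u r @[r --> 1^'-] --> (0 : R) -> wL p a0 u.
Proof.
move=> acu wu u1; have mu_u := AC_loc01_measurable acu.
split; first exact: mu_u.
have [C C0 HC] := hardy_ineq hp ha1 hN wu.
have [_ /= Efin] := wu.
apply: (@le_lt_trans _ _ (C%:E * wint p a1 (derive1 u))%E); last first.
  by rewrite -(fineK (wint_fin_num wu)) -EFinM ltry.
apply: le_trans HC; apply: int_le.
- exact: measurable_itv.
- exact: wdens_measurable.
- apply: measurable_funM; first by apply: measurable_funTS; exact: measurable_powR.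
  apply: (measurableT_comp (measurable_powR p)).
  exact: (AC_loc01_measurable (tail_AC hp ha1 wu)).
- by move=> r _; exact: wdens_ge0.
- move=> r; rewrite /= in_itv/= => r01; have /andP[r0 r1] := r01.
  have up := ge0_ler_powR (ltW p0) (normr_ge0 (u r)) (tail_ge0 (derive1 u) r)
    (AC_le_tail acu wu u1 r01).
  apply: (ler_pM (powR_ge0 _ _) (powR_ge0 _ _) _ up).
  by rewrite !/powR gt_eqF// ler_expR ler_wnM2r// ln_le0// ltW.
Qed.

Lemma wint0 (q g : R) : 0 < q -> wint q g (cst (0 : R)) = 0%E.
Proof.
move=> q0; rewrite /wint; apply: integral0_eq => r _.
by rewrite /= normr0 powR0 ?mulr0// gt_eqF.
Qed.

(** Such a [u] already lies in the set whose closure is taken, and approximates itself at distance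
    0. *)
Lemma mem_X1p (u : R -> R) : AC_loc01 u -> wL p a1 (derive1 u) ->
  u r @[r --> 1^'-] --> (0 : R) -> X1p p a0 a1 u.
Proof.
move=> acu wu u1; have wu0 := wL_of_gradient acu wu u1.
split; first by split.
move=> e e0; exists u; first by split; first by split.
rewrite /sobolev_norm (_ : (fun r => u r - u r) = cst 0); last first.
  by apply/funext => r; rewrite subrr.
rewrite (_ : derive1 (cst 0) = cst (0 : R)); last first.
  by apply/funext => r; rewrite derive1E derive_cst.
by rewrite !wint0// adde0 poweR0r ?lte_fin// invr_neq0// gt_eqF.
Qed.

Lemma AC_loc01B (u w : R -> R) : AC_loc01 u -> AC_loc01 w ->
  AC_loc01 (fun r => u r - w r).
Proof. by move=> acu acw a b a0' ab b1; apply: abs_continuousB; [exact: acu|exact: acw]. Qed.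

Lemma wint_ge0 (q g : R) (u : R -> R) : (0 <= wint q g u)%E.
Proof. by apply: int_ge0 => r _; exact: wdens_ge0. Qed.

(* Away from 0 the Sobolev norm dominates the sup norm. *)
Lemma sobolev_sup_bound : exists2 K : R, 0 <= K &
  forall (w : R -> R) e, 0 < e -> AC_loc01 w -> (sobolev_norm p a0 a1 w < e%:E)%E ->
  forall r, 2^-1 < r < 1 -> `|w r| <= K * e.
Proof.
pose K0 := 2^-1 `^ (- (a1 / (p - 1))) : R.
pose K1 := (4 * 2 `^ a0) `^ p^-1 : R.
exists (1 + K0 + K1); first by rewrite !addr_ge0 ?powR_ge0.
move=> w e e0 acw we.
have p10 : 0 < p - 1 by rewrite subr_gt0.
have ABe : (wint p a0 w + wint p a1 (derive1 w) <= (e `^ p)%:E)%E.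
  rewrite leNgt; apply/negP => lt; move: we; apply/negP; rewrite -leNgt.
  have : ((e `^ p)%:E `^ p^-1 <= sobolev_norm p a0 a1 w)%E.
    apply: gt0_ler_poweR; rewrite ?in_itv/= ?leey ?andbT//.
    - by rewrite invr_ge0 ltW.
    - by rewrite lee_fin powR_ge0.
    - by rewrite adde_ge0// wint_ge0.
    - exact: ltW.
  by rewrite poweR_EFin -powRrM mulfV ?gt_eqF// powRr1// ltW.
have Ae : (wint p a0 w <= (e `^ p)%:E)%E.
  by apply: le_trans ABe; rewrite leeDl// wint_ge0.
have Be : (wint p a1 (derive1 w) <= (e `^ p)%:E)%E.
  by apply: le_trans ABe; rewrite leeDr// wint_ge0.
have ww : wL p a1 (derive1 w).
  split; first exact: AC_loc01_measurable_derive1.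
  by apply: le_lt_trans Be _; rewrite ltry.
have dist r s : 2^-1 < r -> r <= s -> s < 1 -> `|w s - w r| <= (1 + K0) * e.
  move=> r2 rs s1; have h0 : 0 < 2^-1 :> R by [].
  have r0 := lt_trans h0 r2.
  apply: le_trans (AC_tail_dist acw ww r0 rs s1) _.
  apply: le_trans (ler_norm _) _; rewrite distrC -lee_fin.
  (* This weight makes both terms of the tail estimate of order [e]. *)
  pose eta := e `^ (1 - p); have eta0 : 0 < eta by rewrite powR_gt0.
  apply: le_trans (tail_dist_le hp ha1 ww h0 (ltW r2) rs s1 eta0) _.
  apply: (@le_trans _ _ (eta%:E * (e `^ p)%:E + (modulus_const p a1 2^-1 eta * 1)%:E)%E).
    apply: leeD.
      apply: lee_wpmul2l; first by rewrite lee_fin ltW.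
      apply: le_trans Be; apply: int_dens_le => //.
      by move=> z /=; rewrite !in_itv/= => /andP[rz zs]; rewrite (lt_trans r0 rz) (lt_trans zs).
    rewrite lee_fin ler_wpM2l ?modulus_const_ge0//; lra.
  rewrite -EFinM -EFinD lee_fin /modulus_const /eta -powRrM.
  rewrite (_ : (1 - p) * - (p - 1)^-1 = 1); last by field; rewrite gt_eqF.
  rewrite -powRD; last by rewrite (gt_eqF e0) implybT.
  by rewrite subrK powRr1 ?(ltW e0)// mulrDl mul1r mulr1 mulrC.
(* Otherwise the weighted integral over (1/2, 1) would be at least 2 e^p; the factor 4 in [K1] is
   there for this contradiction, and 2^a0 compensates the weight. *)
have [s s2 ws] : exists2 s, 2^-1 < s < 1 & `|w s| <= K1 * e.
  apply: contrapT => noS.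
  have big r : 2^-1 < r < 1 -> (K1 * e) `^ p <= `|w r| `^ p.
    move=> r2; apply: (ge0_ler_powR (ltW p0)); rewrite ?nnegrE ?mulr_ge0 ?powR_ge0 ?(ltW e0)//.
    by rewrite leNgt; apply/negP => lt; apply: noS; exists r => //; exact: ltW.
  have : ((4 * e `^ p)%:E * (2^-1)%:E <= (e `^ p)%:E)%E.
    apply: le_trans Ae.
    have h21 : 2^-1 <= 1 :> R by rewrite invf_le1// ler1n.
    pose D := `]2^-1 : R, 1[%classic.
    have <- : mu D = (2^-1)%:E.
      by rewrite (mu_itv_oo h21); congr EFin; lra.
    rewrite -int_cst; last exact: measurable_itv.
    apply: (@le_trans _ _ (\int[mu]_(r in D) (r `^ a0 * `|w r| `^ p)%:E)%E).
      apply: int_le.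
      - exact: measurable_itv.
      - exact: measurable_cst.
      - apply: wdens_measurable; apply: measurable_funS (AC_loc01_measurable acw).
          exact: measurable_itv.
        by move=> z; rewrite /D /= !in_itv/= => /andP[z2 z1]; rewrite z1 andbT (lt_trans _ z2).
      - by move=> r _; rewrite mulr_ge0 ?powR_ge0.
      - move=> r; rewrite /D /= in_itv/= => r2.
        have h2 : 2^-1 `^ a0 <= r `^ a0.
          have /andP[/ltW h _] := r2; apply: (ge0_ler_powR ha0) => //; rewrite nnegrE//.
          exact: le_trans h.
        apply: le_trans (ler_pM (powR_ge0 _ _) (powR_ge0 _ _) h2 (big r r2)).
        rewrite powRM ?powR_ge0 ?(ltW e0)// /K1 -powRrM mulVf ?gt_eqF// powRr1; last first.
          by rewrite mulr_ge0 ?powR_ge0.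
        rewrite mulrA [in leRHS]mulrCA -powRM// mulVf// powR1 mulr1.
        exact: lexx.
    apply: int_subset.
    - exact: measurable_itv.
    - exact: measurable_itv.
    - by apply: wdens_measurable; exact: AC_loc01_measurable.
    - by move=> r _; exact: wdens_ge0.
    - by move=> z; rewrite /D /= !in_itv/= => /andP[z2 z1]; rewrite z1 andbT (lt_trans _ z2).
  rewrite -EFinM lee_fin; have := powR_gt0 p e0; move: (e `^ p) => x; lra.
move=> r r2; have -> : w r = (w r - w s) + w s by ring.
apply: le_trans (ler_normD _ _) _; rewrite mulrDl; apply: lerD => //.
have /andP[r2' r1] := r2; have /andP[s2' s1] := s2.
have [rs|/ltW sr] := leP r s; first by rewrite distrC; exact: dist.
exact: dist.
Qed.

(** Convergence in the norm is uniform on (1/2, 1), so the boundary value at 1 survives the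
    closure. *)
Lemma X1p_vanish (u : R -> R) : X1p p a0 a1 u -> u r @[r --> 1^'-] --> (0 : R).
Proof.
move=> [[acu wu0 wu1] cl].
have [K K0 HK] := sobolev_sup_bound.
apply/cvgrPdist_lt => e e0.
pose d := e / 2 / (K + 1).
have K1 : 0 < K + 1 by rewrite ltr_wpDl.
have d0 : 0 < d by rewrite !divr_gt0.
have [v [[acv _ _] v1] uv] := cl d d0.
have bound := HK _ _ d0 (AC_loc01B acu acv) uv.
have e2 : 0 < e / 2 by rewrite divr_gt0.
have /cvgrPdist_lt/(_ _ e2) vnear := v1.
near=> r; rewrite sub0r normrN.
have r1 : r < 1 by near: r; exact: nbhs_left_lt.
have r2 : 2^-1 < r by near: r; apply: nbhs_left_gt; rewrite invf_lt1// ltr1n.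
have vr : `|v r| < e / 2.
  have : `|0 - v r| < e / 2 by near: r.
  by rewrite sub0r normrN.
have r12 : 2^-1 < r < 1 by rewrite r2.
have -> : u r = (u r - v r) + v r by ring.
apply: le_lt_trans (ler_normD _ _) _; rewrite (splitr e); apply: ler_ltD => //.
apply: le_trans (bound r r12) _.
by rewrite /d mulrCA ler_piMr ?divr_ge0 ?(ltW e0)// ler_pdivrMr// mul1r lerDl.
Unshelve. all: by end_near. Qed.

Lemma X1p_le_tail (u : R -> R) x : X1p p a0 a1 u -> 0 < x < 1 ->
  `|u x| <= tail (derive1 u) x.
Proof. by move=> Xu; have [[acu _ wu] _] := Xu; apply: AC_le_tail => //; exact: X1p_vanish. Qed.

End sobolev_space.

(** * The sharp Bliss inequality *)

Section bliss_constants.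
Context {R : realType}.

(** Writing N, nu, sigma, j, q for these numbers and P for [pstar]: P = (theta+1) p / N, and nu > 0
    is the condition theta > a1 - p. The relations j p/(p-1) = sigma and (q-1) p/(p-1) = P make
    Young's inequality return powers of the mass density exactly, and [bC] is the factor of the
    energy there. *)
Definition bN (p a1 : R) : R := a1 - p + 1.
Definition bnu (p a1 theta : R) : R := theta + 1 - bN p a1.
Definition bsigma (p a1 theta : R) : R := bnu p a1 theta / (p - 1).
Definition bj (p a1 theta : R) : R := bnu p a1 theta / p.
Definition bq (p a1 theta : R) : R := 1 + (p - 1) * (theta + 1) / bN p a1.
Definition bC (p a1 theta : R) : R := bq p a1 theta * (bN p a1 / (p - 1)) `^ (1 - p) / p.

(* [bw t = t ^ theta * W t ^ pstar], where [W t = (1 + t ^ sigma) ^ (- N / nu)]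
   is the Bliss extremal on the half-line. *)
Definition bw (p a1 theta t : R) : R :=
  t `^ theta * (1 + t `^ bsigma p a1 theta) `^ (- ((theta + 1) * p / bnu p a1 theta)).

Context (p a1 theta : R) (hp : 1 < p) (hN : 0 < a1 - p + 1) (hth : 0 <= theta)
  (hnu : a1 - p < theta).
Local Notation N := (bN p a1).
Local Notation nu := (bnu p a1 theta).
Local Notation sigma := (bsigma p a1 theta).
Local Notation j := (bj p a1 theta).
Local Notation q := (bq p a1 theta).
Local Notation P := (pstar p a1 theta).
Local Notation w := (bw p a1 theta).

Lemma bp0 : 0 < p. Proof. exact: lt_trans ltr01 hp. Qed.
Lemma bp10 : 0 < p - 1. Proof. by rewrite subr_gt0. Qed.
Lemma bth1 : 0 < theta + 1. Proof. by rewrite ltr_wpDl. Qed.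
Lemma bN0 : 0 < N. Proof. exact: hN. Qed.
Lemma bnu0 : 0 < nu. Proof. by rewrite /bnu /bN; move: hnu; lra. Qed.
Lemma bsigma0 : 0 < sigma. Proof. by rewrite divr_gt0 ?bnu0 ?bp10. Qed.
Lemma bj0 : 0 < j. Proof. by rewrite divr_gt0 ?bnu0 ?bp0. Qed.
Lemma bq1 : 1 < q.
Proof. by rewrite /bq ltrDl divr_gt0 ?bN0// mulr_gt0 ?bp10 ?bth1. Qed.
Lemma bjth : j < theta + 1.
Proof.
rewrite /bj ltr_pdivrMr ?bp0//; apply: (@lt_trans _ _ (theta + 1)).
  by rewrite /bnu; have := bN0; lra.
by rewrite ltr_pMr ?bth1.
Qed.
Lemma bpP : p < P.
Proof.
rewrite /pstar ltr_pdivlMr// mulrC ltr_pM2r ?bp0//.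
by move: hnu; lra.
Qed.
Lemma bP1 : 1 < P. Proof. exact: lt_trans hp bpP. Qed.
Lemma bP0 : 0 < P. Proof. exact: lt_trans ltr01 bP1. Qed.

Lemma bw_gt0 t : 0 < t -> 0 < w t.
Proof.
move=> t0; rewrite mulr_gt0 ?powR_gt0//.
by rewrite ltr_wpDr ?powR_ge0.
Qed.

Lemma bw_ge0 t : 0 <= w t.
Proof. by rewrite mulr_ge0 ?powR_ge0. Qed.

(* AM-GM step: [T' = r ^ theta * V ^ pstar / w T] is the derivative of the map
   transporting [r ^ theta * V ^ pstar] onto the Bliss density. *)
Lemma bliss_amgm T r V : 0 < T -> 0 < r -> 0 <= V ->
  (theta + 1) * (r `^ theta * V `^ P * (1 + T `^ sigma)) <=
  (j * T `^ (j - 1) * (r `^ theta * V `^ P / w T) * r `^ (theta + 1 - j) +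
   T `^ j * ((theta + 1 - j) * r `^ (theta + 1 - j - 1))) * V `^ q.
Proof.
move=> T0 r0; rewrite le_eqVlt => /predU1P[<-|V0].
  have q0 : 0 < q := lt_trans ltr01 bq1.
  by rewrite !powR0 ?gt_eqF ?bP0// !(mulr0, mul0r).
have th1 := bth1; have nu0 := bnu0; have p0 := bp0; have N0 := bN0.
have p10 := bp10.
pose U := 1 + T `^ sigma.
have U0 : 0 < U by rewrite ltr_wpDr ?powR_ge0.
pose s := j / (theta + 1).
have s01 : 0 < s < 1.
  by rewrite divr_gt0 ?bj0//= ltr_pdivrMr// mul1r bjth.
pose A := T `^ (j - 1) * (r `^ theta * V `^ P / w T) * r `^ (1 - j).
pose B := T `^ j * r `^ (- j).
have A0 : 0 < A by rewrite !mulr_gt0 ?powR_gt0// invr_gt0 bw_gt0.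
have B0 : 0 < B by rewrite mulr_gt0 ?powR_gt0.
have := weighted_amgm A0 B0 s01.
(* The weight s = j/(theta+1) is the one for which the powers of [r] and of [T] cancel, while the
   power of [U] hidden in [w T] becomes [U] itself. *)
have -> : A `^ s * B `^ (1 - s) = V `^ (P - q) * U.
  rewrite /A /B /bw -/U.
  (* Writing all bases as exponentials turns the identity into one that is linear in their
     logarithms. *)
  rewrite -[T]lnK// -[r]lnK// -[V]lnK// -[U]lnK// !powR_expR -?expRN -?expRD !powR_expR -!expRN -!expRD.
  rewrite !powR_expR -!expRD; congr expR.
  rewrite /s /pstar /bq /bj -/N /bnu; field.
  by rewrite !gt_eqF//; exact: nu0.
have V0q := powR_gt0 q V0.
have rth := powR_gt0 theta r0.
rewrite -(ler_pM2l (mulr_gt0 (mulr_gt0 th1 rth) V0q)).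
move=> H; apply: le_trans (le_trans H _).
  rewrite -[X in X <= _]mul1r le_eqVlt; apply/orP; left; apply/eqP.
  rewrite powRB; last by rewrite (gt_eqF V0) implybT.
  by rewrite -/U; field; rewrite gt_eqF.
rewrite le_eqVlt; apply/orP; left; apply/eqP.
have -> : r `^ (theta + 1 - j) = r `^ theta * r `^ (1 - j).
  by rewrite -powRD ?(gt_eqF r0) ?implybT// addrA.
have -> : r `^ (theta + 1 - j - 1) = r `^ theta * r `^ (- j).
  by rewrite -powRD ?(gt_eqF r0) ?implybT//; congr powR; ring.
rewrite /A /B /s; field.
by rewrite (lt0r_neq0 th1) andbT lt0r_neq0 ?bw_gt0.
Qed.

(** The weight [N / (p - 1)] makes the coefficient of the mass term exactly [theta + 1 - j], so that
    after integration it cancels against part of the bound of [bliss_amgm]. *)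
Lemma bliss_young T r V F : 0 < T -> 0 < r -> 0 <= V -> 0 <= F ->
  q * (T `^ j * r `^ (theta + 1 - j)) * V `^ (q - 1) * F <=
  (theta + 1 - j) * (r `^ theta * V `^ P * T `^ sigma) +
  bC p a1 theta * (r `^ a1 * F `^ p).
Proof.
move=> T0 r0 V0 F0.
have th1 := bth1; have nu0 := bnu0; have p0 := bp0; have N0 := bN0.
have p10 := bp10; have q0 : 0 < q := lt_trans ltr01 bq1.
pose X := T `^ j * V `^ (q - 1) * r `^ (theta * (p - 1) / p).
pose Y := r `^ (a1 / p) * F.
have X0 : 0 <= X by rewrite !mulr_ge0 ?powR_ge0.
have Y0 : 0 <= Y by rewrite mulr_ge0 ?powR_ge0.
have c0 : 0 < N / (p - 1) by rewrite divr_gt0.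
have := young_weighted hp c0 X0 Y0; rewrite -(ler_pM2l q0).
have -> : X `^ (p / (p - 1)) = r `^ theta * V `^ P * T `^ sigma.
  rewrite /X !powRM ?mulr_ge0 ?powR_ge0// -!powRrM.
  rewrite (_ : j * (p / (p - 1)) = sigma); last first.
    by rewrite /bj /bsigma; field; rewrite !gt_eqF.
  rewrite (_ : (q - 1) * (p / (p - 1)) = P); last first.
    by rewrite /bq /pstar -/N; field; rewrite !gt_eqF.
  rewrite (_ : theta * (p - 1) / p * (p / (p - 1)) = theta); last by field; rewrite !gt_eqF.
  ring.
have -> : Y `^ p = r `^ a1 * F `^ p.
  rewrite /Y powRM ?powR_ge0// -powRrM.
  by rewrite (_ : a1 / p * p = a1)//; field; rewrite gt_eqF.
have -> : X * Y = T `^ j * r `^ (theta + 1 - j) * V `^ (q - 1) * F.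
  rewrite /X /Y (_ : theta + 1 - j = theta * (p - 1) / p + a1 / p); last first.
    by rewrite /bj /bnu /bN; field; rewrite gt_eqF.
  rewrite (@powRD _ r) ?(gt_eqF r0) ?implybT//; ring.
have -> : (theta + 1 - j) = q * (N / (p - 1)) * ((p - 1) / p).
  by rewrite /bq /bj /bnu; field; rewrite !gt_eqF.
rewrite /bC !mulrA => /le_trans; apply.
by rewrite le_eqVlt; apply/orP; left; apply/eqP; ring.
Qed.

End bliss_constants.

(** * Primitives of densities on the half-line and their inverses *)

Section primitives.
Context {R : realType}.
Local Notation mu := (@lebesgue_measure R).

Definition prim (phi : R -> R) (t : R) : R := (\int[mu]_(s in `]0%R, t]) phi s)%R.

Lemma prim_is_derive (phi : R -> R) (x u : R) : 0 < x -> x < u ->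
  mu.-integrable `]0, u]%classic (EFin \o phi) -> {for x, continuous phi} ->
  is_derive x 1 (prim phi) (phi x).
Proof.
move=> x0 xu intp cp.
have [|d e] := @continuous_FTC1 _ phi (BRight 0) x u xu intp _ cp.
  exact: x0.
by apply: DeriveDef => //; rewrite -derive1E.
Qed.

Lemma continuous_powR_gt0 (s x : R) : 0 < x -> {for x, continuous (fun r => r `^ s)}.
Proof.
move=> x0; have dp : derivable ((@powR R)^~ s) x 1.
  by apply: derivable_powR; rewrite in_itv/= x0.
by move/derivable1_diffP : dp => /differentiable_continuous.
Qed.

Section bounded_density.
Implicit Types (a s t x y m L : R).
Context (phi K : R -> R) (cphi : forall x, 0 < x -> {for x, continuous phi})
  (phi_bnd : forall s t, 0 < s -> s <= t -> 0 <= phi s <= K t).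

Lemma prim_measurable t : measurable_fun `]0, t]%classic phi.
Proof.
have : measurable_fun `](0 : R), +oo[%classic phi.
  apply: open_continuous_measurable_fun; first exact: interval_open.
  by move=> x; rewrite inE/= in_itv/= andbT => x0; exact: cphi.
apply: measurable_funS; first exact: measurable_itv.
by move=> z /=; rewrite !in_itv/= andbT => /andP[].
Qed.

Lemma prim_int_le (a t : R) : 0 <= a -> a <= t ->
  (\int[mu]_(s in `]a, t]) (phi s)%:E <= (K t * (t - a))%:E)%E.
Proof.
move=> a0 at'; apply: (@le_trans _ _ (\int[mu]_(s in `]a, t]) (K t)%:E)%E).
  apply: int_le; [exact: measurable_itv| |exact: measurable_cst| |].
  - have sub : `]a, t]%classic `<=` `]0, t]%classic.
      by move=> z /=; rewrite !in_itv/= => /andP[az ->]; rewrite (le_lt_trans a0 az).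
    exact: (measurable_funS (measurable_itv _) sub (@prim_measurable t)).
  - move=> s /=; rewrite in_itv/= => /andP[s0 st].
    by have /andP[] := phi_bnd (le_lt_trans a0 s0) st.
  - move=> s /=; rewrite in_itv/= => /andP[s0 st].
    by have /andP[] := phi_bnd (le_lt_trans a0 s0) st.
rewrite int_cst; last exact: measurable_itv.
by rewrite (mu_itv_oc at') -EFinM.
Qed.

Lemma prim_integrable t : mu.-integrable `]0, t]%classic (EFin \o phi).
Proof.
apply: ge0_int_integrable; first exact: measurable_itv.
- exact: prim_measurable.
- move=> s /=; rewrite in_itv/= => /andP[s0 st].
  by have /andP[] := phi_bnd s0 st.
- have [t0|t0] := leP 0 t.
    by apply: le_lt_trans (prim_int_le (lexx 0) t0) _; rewrite ltry.
  by rewrite set_itv_ge ?integral_set0// bnd_simp -leNgt ltW.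
Qed.

Lemma prim_derive x : 0 < x -> is_derive x 1 (prim phi) (phi x).
Proof.
move=> x0; apply: (@prim_is_derive _ _ (x + 1)) => //; last exact: cphi.
  by rewrite ltrDl.
exact: prim_integrable.
Qed.

Lemma primB x y : 0 <= x -> x <= y ->
  prim phi y - prim phi x = (\int[mu]_(s in `]x, y]) phi s)%R.
Proof.
move=> x0 xy.
have := @Rintegral_itvB _ phi (BRight 0) (BRight y) x (prim_integrable y).
by rewrite !bnd_simp; apply.
Qed.

Lemma prim_le x y : 0 <= x -> x <= y -> prim phi x <= prim phi y.
Proof.
move=> x0 xy; rewrite -subr_ge0 primB//; apply: Rintegral_ge0 => s /=.
rewrite in_itv/= => /andP[xs sy].
by have /andP[] := phi_bnd (le_lt_trans x0 xs) sy.
Qed.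

Lemma prim0 : prim phi 0 = 0.
Proof. by rewrite /prim set_itv_ge ?Rintegral_set0// bnd_simp ltxx. Qed.

Lemma primB_le x y : 0 <= x -> x <= y -> prim phi y - prim phi x <= K y * (y - x).
Proof.
move=> x0 xy; rewrite primB// -lee_fin; apply: le_trans (prim_int_le x0 xy).
rewrite /Rintegral fineK//; apply: integrable_fin_num; first exact: measurable_itv.
apply: integrableS (prim_integrable y); [exact: measurable_itv|exact: measurable_itv|].
by move=> z /=; rewrite !in_itv/= => /andP[xz ->]; rewrite (le_lt_trans x0 xz).
Qed.

Lemma prim_lt x y : (forall s, 0 < s -> 0 < phi s) -> 0 < x -> x < y ->
  prim phi x < prim phi y.
Proof.
move=> phi0 x0 xy.
have d z : z \in `]x, y[ -> is_derive z 1 (prim phi) (phi z).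
  by rewrite in_itv/= => /andP[xz _]; apply: prim_derive; exact: lt_trans xz.
have c : {within `[x, y], continuous (prim phi)}.
  apply: derivable_within_continuous => z; rewrite in_itv/= => /andP[xz _].
  by have [] := prim_derive (lt_le_trans x0 xz).
have [z] := MVT xy d c; rewrite in_itv/= => /andP[xz _] e.
by rewrite -subr_gt0 e mulr_gt0 ?subr_gt0// phi0// (lt_trans x0).
Qed.

Lemma prim_gt0 x : (forall s, 0 < s -> 0 < phi s) -> 0 < x -> 0 < prim phi x.
Proof.
move=> phi0 x0; have x2 : 0 < x / 2 by rewrite divr_gt0.
apply: (@le_lt_trans _ _ (prim phi (x / 2))).
  by rewrite -prim0 prim_le// ltW.
by apply: prim_lt => //; rewrite ltr_pdivrMr// ltr_pMr// ltr1n.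
Qed.

(** Intermediate value theorem on [e, L], with [e] so small that the bound [K L] on the density
    keeps the primitive at [e] below [m]; this bypasses continuity at 0. *)
Lemma prim_surj m L : 0 < m -> 0 < L -> m <= prim phi L ->
  exists2 t, 0 < t <= L & prim phi t = m.
Proof.
move=> m0 L0 mL; have KL0 : 0 <= K L.
  by have /andP[] := phi_bnd L0 (lexx L) => /le_trans; apply.
have K1 : 0 < K L + 1 by rewrite ltr_wpDl.
pose e := Num.min L (m / (K L + 1)).
have e0 : 0 < e by rewrite lt_min L0 divr_gt0.
have eL : e <= L by rewrite ge_min lexx.
have em : prim phi e <= m.
  have /andP[_ _] := phi_bnd e0 (lexx e).
  have h : prim phi e - prim phi 0 <= K L * e.
    have int_e : (\int[mu]_(s in `]0%R, e]) (phi s)%:E <= (K L * e)%:E)%E.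
      apply: (@le_trans _ _ (\int[mu]_(s in `]0%R, e]) (K L)%:E)%E).
        apply: int_le; [exact: measurable_itv|exact: prim_measurable|exact: measurable_cst| |].
          move=> s /=; rewrite in_itv/= => /andP[s0 se].
          by have /andP[] := phi_bnd s0 se.
        move=> s /=; rewrite in_itv/= => /andP[s0 se].
        by have /andP[] := phi_bnd s0 (le_trans se eL).
      rewrite int_cst; last exact: measurable_itv.
      by rewrite (mu_itv_oc (ltW e0)) subr0 -EFinM.
    rewrite prim0 subr0 -lee_fin; apply: le_trans int_e.
    rewrite /prim /Rintegral fineK//; apply: integrable_fin_num; first exact: measurable_itv.
    exact: prim_integrable.
  rewrite prim0 subr0 in h; apply: le_trans h _.
  apply: (@le_trans _ _ (K L * (m / (K L + 1)))).
    by rewrite ler_wpM2l// ge_min lexx orbT.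
  by rewrite mulrCA ler_piMr ?(ltW m0)// ler_pdivrMr// mul1r lerDl.
have c : {within `[e, L], continuous (prim phi)}.
  apply: derivable_within_continuous => z; rewrite in_itv/= => /andP[xz _].
  by have [] := prim_derive (lt_le_trans e0 xz).
have [|t] := @IVT _ _ _ _ m eL c.
  by rewrite ge_min em/= le_max mL orbT.
rewrite in_itv/= => /andP[et tL] <-; exists t => //.
by rewrite (lt_le_trans e0 et).
Qed.

(* The inverse function of the increasing bijection [prim phi]. *)
Definition primV (m : R) : R := xget 1 [set t | 0 < t /\ prim phi t = m].

Lemma primK t : (forall s, 0 < s -> 0 < phi s) -> 0 < t -> primV (prim phi t) = t.
Proof.
move=> phi0 t0; rewrite /primV; case: xgetP => [s _ [s0 e]|/(_ t)]; last first.
  by case.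
have [st|ts|//] := ltgtP s t.
  by have := prim_lt phi0 s0 st; rewrite e ltxx.
by have := prim_lt phi0 t0 ts; rewrite e ltxx.
Qed.

Lemma primV_is_derive t : (forall s, 0 < s -> 0 < phi s) -> 0 < t ->
  is_derive (prim phi t) 1 primV (phi t)^-1.
Proof.
move=> phi0 t0; apply: is_derive_inverse.
- near=> s; apply: primK => //; near: s; exact: lt_nbhsr.
- near=> s; have s0 : 0 < s by near: s; exact: lt_nbhsr.
  have [d _] := prim_derive s0.
  by move/derivable1_diffP : d => /differentiable_continuous.
- exact: prim_derive.
- by rewrite gt_eqF// phi0.
Unshelve. all: by end_near. Qed.

End bounded_density.
End primitives.

Lemma prim_EFin {R : realType} (phi K : R -> R) (cphi : forall x, 0 < x -> {for x, continuous phi})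
  (phi_bnd : forall s t, 0 < s -> s <= t -> 0 <= phi s <= K t) (t : R) :
  (prim phi t)%:E = (\int[@lebesgue_measure R]_(s in `]0%R, t[) (phi s)%:E)%E.
Proof.
have intL := prim_integrable cphi phi_bnd t.
rewrite /prim /Rintegral fineK; last by apply: integrable_fin_num => //; exact: measurable_itv.
rewrite -integral_itv_bndo_bndc//.
apply: measurable_funS (measurable_itv _) _ (measurable_int _ intL).
by apply: subset_itvl; rewrite bnd_simp.
Qed.

Section arithmetic.
Context {R : realType}.

Lemma mass_arith1 (ma mb ml ML d : R) :
  ML - d < mb - ma -> mb <= ML -> d <= ml -> ml < ma -> False.
Proof. lra. Qed.

Lemma mass_arith2 (ma mb mc ml ML d : R) : ML - d < mb - ma -> d <= ML - ml ->
  0 <= ma -> mb <= mc -> mc < ml -> False.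
Proof. lra. Qed.

Lemma mass_arith3 (ga gc gL g1 g2 k x y e : R) : g1 <= k -> gL - g2 <= k -> k <= e / 3 ->
  g2 <= gc -> ga <= g1 -> x <= e / 3 -> gc - ga <= x + y -> gL <= y + e.
Proof. lra. Qed.

End arithmetic.

(** * The Bliss inequality by mass transport *)

Section bliss.
Context {R : realType}.
Local Notation mu := (@lebesgue_measure R).
Local Notation I01 := (`](0 : R)%R, 1%R[%classic).
Context (p a1 theta : R) (hp : 1 < p) (ha1 : 0 <= a1) (hN : 0 < a1 - p + 1)
  (hth : 0 <= theta) (hnu : a1 - p < theta).
Local Notation N := (bN p a1).
Local Notation nu := (bnu p a1 theta).
Local Notation sigma := (bsigma p a1 theta).
Local Notation j := (bj p a1 theta).
Local Notation q := (bq p a1 theta).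
Local Notation P := (pstar p a1 theta).
Local Notation w := (bw p a1 theta).
Local Notation C := (bC p a1 theta).

Let p0 : 0 < p. Proof. exact: bp0. Qed.
Let p10 : 0 < p - 1. Proof. exact: bp10. Qed.
Let th1 : 0 < theta + 1. Proof. exact: bth1. Qed.
Let N0 : 0 < N. Proof. exact: bN0. Qed.
Let nu0 : 0 < nu. Proof. exact: bnu0. Qed.
Let sigma0 : 0 < sigma. Proof. exact: bsigma0. Qed.
Let j0 : 0 < j. Proof. exact: bj0. Qed.
Let q1 : 1 < q. Proof. exact: bq1. Qed.
Let jth : 0 < theta + 1 - j. Proof. by rewrite subr_gt0; exact: bjth. Qed.
Let P0 : 0 < P. Proof. exact: bP0. Qed.

Lemma bw_continuous (x : R) : 0 < x -> {for x, continuous w}.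
Proof.
move=> x0; apply: cvgM; first exact: continuous_powR_gt0.
apply: (@continuous_comp _ _ _ (fun r => 1 + r `^ sigma)
  (fun r => r `^ (- ((theta + 1) * p / nu)))).
  by apply: cvgD; [exact: cvg_cst|exact: continuous_powR_gt0].
by apply: continuous_powR_gt0; rewrite ltr_wpDr ?powR_ge0.
Qed.

Lemma bw_bound (s t : R) : 0 < s -> s <= t -> 0 <= w s <= t `^ theta.
Proof.
move=> s0 st; rewrite bw_ge0/= /bw -[leRHS]mulr1; apply: ler_pM; rewrite ?powR_ge0//.
  by apply: ge0_ler_powR; rewrite ?nnegrE// ltW// (lt_le_trans s0).
rewrite powRN invf_le1; last by rewrite powR_gt0// ltr_wpDr ?powR_ge0.
apply: (@le_trans _ _ ((1 + s `^ sigma) `^ 0)); first by rewrite powRr0.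
apply: ler_powR; first by rewrite lerDl powR_ge0.
by rewrite divr_ge0 ?mulr_ge0// ltW.
Qed.

Lemma bw_pos (s : R) : 0 < s -> 0 < w s.
Proof. exact: bw_gt0. Qed.

(** After the change of variable t = T(r), the integral of theta + 1 + j T^sigma against the
    transported mass becomes an integral of this density. *)
Definition bg (s : R) : R := (theta + 1 + j * s `^ sigma) * w s.

Lemma bg_continuous (x : R) : 0 < x -> {for x, continuous bg}.
Proof.
move=> x0; apply: cvgM; last exact: bw_continuous.
apply: cvgD; first exact: cvg_cst.
by apply: cvgM; [exact: cvg_cst|exact: continuous_powR_gt0].
Qed.

Lemma bg_gt0 (s : R) : 0 < s -> 0 < bg s.
Proof.
by move=> s0; rewrite mulr_gt0 ?bw_gt0// ltr_wpDr// mulr_ge0 ?powR_ge0// ltW.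
Qed.

Lemma bg_bound (s t : R) : 0 < s -> s <= t ->
  0 <= bg s <= (theta + 1 + j * t `^ sigma) * t `^ theta.
Proof.
move=> s0 st; rewrite ltW ?bg_gt0//=; have /andP[w0 wt] := bw_bound s0 st.
have A0 : 0 <= theta + 1 + j * s `^ sigma.
  by apply: addr_ge0; [exact: ltW|apply: mulr_ge0; [exact: ltW|exact: powR_ge0]].
apply: (ler_pM A0 w0 _ wt); rewrite lerD2l ler_pM2l//.
have t0 := lt_le_trans s0 st.
exact: (ge0_ler_powR (ltW sigma0) (ltW s0) (ltW t0) st).
Qed.

Local Notation M := (prim w).
Local Notation G := (prim bg).

Context (f : R -> R) (hf : wL p a1 f).
Local Notation v := (tail f).
Let mass r := r `^ theta * v r `^ P.

Lemma mass_ge0 r : 0 <= mass r.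
Proof. by rewrite mulr_ge0 ?powR_ge0. Qed.

Lemma v_continuous (r : R) : 0 < r < 1 -> {for r, continuous v}.
Proof. by move=> r01; exact: (AC_loc01_continuous (tail_AC hp ha1 hf) r01). Qed.

Lemma mass_continuous (r : R) : 0 < r < 1 -> {for r, continuous mass}.
Proof.
move=> r01; have /andP[r0 _] := r01.
have -> : mass = (fun r => r `^ theta * pospow P (v r)).
  by apply/funext => s; rewrite /mass (pospowE P0 (tail_ge0 f s)).
apply: cvgM; first exact: continuous_powR_gt0.
apply: (@continuous_comp _ _ _ v (pospow P)); first exact: v_continuous.
exact: continuous_pospow.
Qed.

Lemma mass_measurable : measurable_fun I01 mass.
Proof.
apply: open_continuous_measurable_fun; first exact: interval_open.
by move=> x; rewrite inE/= in_itv/=; exact: mass_continuous.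
Qed.

(** Write v^P = v^p v^(P-p) and bound the second factor by [tail_growth]: the powers of [r] combine
    to exactly a1 - p, and the Hardy inequality applies. *)
Lemma mass_fin : (\int[mu]_(r in I01) (mass r)%:E < +oo)%E.
Proof.
have [H H0 HE] := hardy_ineq hp ha1 hN hf.
pose K := fine (wint p a1 f) + (p - 1) / (a1 - p + 1).
have K0 : 0 <= K.
  rewrite addr_ge0 ?divr_ge0 ?(ltW p10) ?(ltW hN)//.
  by apply: fine_ge0; exact: wint_ge0.
have pP : p < P := bpP hp hN hnu.
apply: (@le_lt_trans _ _ ((K `^ (P - p))%:E *
  \int[mu]_(r in I01) (r `^ (a1 - p) * v r `^ p)%:E)%E); last first.
  apply: (@le_lt_trans _ _ ((K `^ (P - p))%:E * (H%:E * wint p a1 f))%E).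
    by apply: lee_wpmul2l => //; rewrite lee_fin powR_ge0.
  by rewrite -(fineK (wint_fin_num hf)) -!EFinM ltry.
have mv : measurable_fun I01 v by exact: (AC_loc01_measurable (tail_AC hp ha1 hf)).
have mF : measurable_fun I01 (fun r => r `^ (a1 - p) * v r `^ p).
  apply: measurable_funM; first by apply: measurable_funTS; exact: measurable_powR.
  exact: (measurableT_comp (measurable_powR p)).
rewrite -(int_scale (measurable_itv _) mF
  (fun r _ => mulr_ge0 (powR_ge0 r _) (powR_ge0 (v r) p)) (powR_ge0 K _)).
apply: int_le; [exact: measurable_itv|exact: mass_measurable| | |].
- by apply: measurable_funM; [exact: measurable_cst|exact: mF].
- by move=> r _; exact: mass_ge0.
- move=> r /=; rewrite in_itv/= => /andP[r0 r1]; rewrite /mass.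
  have -> : v r `^ P = v r `^ p * v r `^ (P - p).
    by rewrite -powRD addrC subrK// (gt_eqF P0).
  have vg := tail_growth hp ha1 hN hf r0 r1.
  have Pp0 : 0 <= P - p by rewrite subr_ge0 ltW.
  have := ge0_ler_powR Pp0 (tail_ge0 f r) (mulr_ge0 K0 (powR_ge0 r _)) vg.
  rewrite powRM ?powR_ge0// -powRrM => {}vg.
  have h : 0 <= r `^ theta * v r `^ p by rewrite mulr_ge0 ?powR_ge0.
  rewrite mulrA; apply: le_trans (ler_wpM2l h vg) _.
  rewrite le_eqVlt; apply/orP; left; apply/eqP.
  rewrite [LHS](_ : _ = K `^ (P - p) * (r `^ theta * r `^ (- ((a1 - p + 1) / p) * (P - p)) * v r `^ p)); last by ring.
  rewrite -powRD; last by rewrite (gt_eqF r0) implybT.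
  congr (_ * (_ `^ _ * _)); rewrite /pstar; field.
  by rewrite (lt0r_neq0 p0) (lt0r_neq0 hN).
Qed.

Lemma mass_integrable (r : R) : r < 1 -> mu.-integrable `]0, r]%classic (EFin \o mass).
Proof.
move=> r1.
have sub : `]0, r]%classic `<=` I01.
  by move=> z /=; rewrite !in_itv/= => /andP[-> zr]; rewrite (le_lt_trans zr).
apply: ge0_int_integrable; first exact: measurable_itv.
- exact: (measurable_funS (measurable_itv _) sub mass_measurable).
- by move=> s _; exact: mass_ge0.
- apply: le_lt_trans mass_fin; apply: int_subset.
  + exact: measurable_itv.
  + exact: measurable_itv.
  + exact: mass_measurable.
  + by move=> s _; exact: mass_ge0.
  + exact: sub.
Qed.

Lemma mass_prim_derive (r : R) : 0 < r < 1 -> is_derive r 1 (prim mass) (mass r).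
Proof.
move=> r01; have /andP[r0 r1] := r01.
apply: (@prim_is_derive _ _ r ((r + 1) / 2)) => //.
- by rewrite ltr_pdivlMr//; lra.
- by apply: mass_integrable; rewrite ltr_pdivrMr//; lra.
- exact: mass_continuous.
Qed.

Lemma mass_primE (r : R) : r < 1 ->
  (prim mass r)%:E = (\int[mu]_(s in `]0%R, r]) (mass s)%:E)%E.
Proof.
move=> r1; rewrite /prim /Rintegral fineK//; apply: integrable_fin_num.
  exact: measurable_itv.
exact: mass_integrable.
Qed.

Lemma mass_primB (a b : R) : 0 <= a -> a <= b -> b < 1 ->
  prim mass b - prim mass a = (\int[mu]_(s in `]a, b]) mass s)%R.
Proof.
move=> a0 ab b1.
have := @Rintegral_itvB _ mass (BRight 0) (BRight b) a (mass_integrable b1).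
by rewrite !bnd_simp; apply.
Qed.

Lemma mass_prim_le (a b : R) : 0 <= a -> a <= b -> b < 1 -> prim mass a <= prim mass b.
Proof.
move=> a0 ab b1; rewrite -subr_ge0 mass_primB//.
by apply: Rintegral_ge0 => s _; exact: mass_ge0.
Qed.

Opaque prim.

Section transport.
Context (L : R) (L0 : 0 < L)
  (HL : (\int[mu]_(r in I01) (mass r)%:E)%E = (M L)%:E).

Lemma mass_prim_leM (r : R) : r < 1 -> prim mass r <= M L.
Proof.
move=> r1; rewrite -lee_fin -HL (mass_primE r1); apply: int_subset.
- exact: measurable_itv.
- exact: measurable_itv.
- exact: mass_measurable.
- by move=> s _; exact: mass_ge0.
- by move=> z /=; rewrite !in_itv/= => /andP[-> zr]; rewrite (le_lt_trans zr).
Qed.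

Let ML0 : 0 < M L.
Proof. exact: (prim_gt0 bw_continuous bw_bound bw_pos L0). Qed.

(** The total mass is positive, so the tail is positive somewhere; being nonincreasing, it is
    positive on an initial interval. Positivity of the transport map rests on this. *)
Lemma mass_prim_gt0 (r : R) : 0 < r < 1 -> 0 < prim mass r.
Proof.
have [r1 /andP[r10 r11] vr1] : exists2 r1, 0 < r1 < 1 & 0 < v r1.
  apply: contrapT => nv.
  have v0 s : 0 < s < 1 -> v s = 0.
    move=> s01; apply/eqP; rewrite eq_le tail_ge0 andbT leNgt; apply/negP => vs.
    by apply: nv; exists s.
  have : (M L)%:E = 0%E :> \bar R.
    rewrite -HL; apply: integral0_eq => s; rewrite /= in_itv/= => /v0 vs.
    by rewrite /mass vs powR0 ?mulr0// gt_eqF.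
  by move=> [] e; have := ML0; rewrite e ltxx.
have H s : 0 < s -> s <= r1 -> 0 < prim mass s.
  move=> s0 sr; have s20 : 0 < s / 2 by rewrite divr_gt0.
  have s2s : s / 2 < s by rewrite ltr_pdivrMr// ltr_pMr// ltr1n.
  have s1 : s < 1 := le_lt_trans sr r11.
  have d z : z \in `]s / 2, s[ -> is_derive z 1 (prim mass) (mass z).
    rewrite in_itv/= => /andP[z1 z2]; apply: mass_prim_derive.
    by rewrite (lt_trans s20 z1) (lt_trans z2).
  have c : {within `[s / 2, s], continuous (prim mass)}.
    apply: derivable_within_continuous => z; rewrite in_itv/= => /andP[z1 z2].
    have z01 : 0 < z < 1 by rewrite (lt_le_trans s20 z1) (le_lt_trans z2).
    by have [] := mass_prim_derive z01.
  have [z] := MVT s2s d c; rewrite in_itv/= => /andP[z1 z2] e.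
  have z0 := lt_trans s20 z1.
  have vz : 0 < v z.
    apply: (lt_le_trans vr1); apply: (tail_le hp ha1 hf z0 _ r11).
    exact: le_trans (ltW z2) sr.
  have mz : 0 < mass z by rewrite /mass mulr_gt0 ?powR_gt0.
  have h : 0 < prim mass s - prim mass (s / 2) by rewrite e mulr_gt0 ?subr_gt0.
  have h2 : 0 <= prim mass (s / 2) by apply: Rintegral_ge0 => t _; exact: mass_ge0.
  by move: h h2; lra.
move=> /andP[r0 rlt1]; have [rr|rr] := leP r r1; first exact: H.
apply: (lt_le_trans (H r1 r10 (lexx _))).
exact: mass_prim_le (ltW r10) (ltW rr) rlt1.
Qed.

(* The monotone map transporting [mass] onto the Bliss density. *)
Definition transport (r : R) : R := primV w (prim mass r).
Local Notation T := transport.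

Lemma transportP (r : R) : 0 < r < 1 -> [/\ 0 < T r, T r <= L & M (T r) = prim mass r].
Proof.
move=> r01; have /andP[r0 r1] := r01.
have [t /andP[t0 tL] e] := prim_surj bw_continuous bw_bound (mass_prim_gt0 r01) L0 (mass_prim_leM r1).
rewrite /T -e (primK bw_continuous bw_bound bw_pos t0); split; [exact: t0|exact: tL|by []].
Qed.

Lemma transport_derive (r : R) : 0 < r < 1 -> is_derive r 1 T ((w (T r))^-1 * mass r).
Proof.
move=> r01; have [T0 _ e] := transportP r01.
have := primV_is_derive bw_continuous bw_bound bw_pos T0.
rewrite e => d; exact: (is_derive1_comp d (mass_prim_derive r01)).
Qed.

Lemma transport_continuous (r : R) : 0 < r < 1 -> {for r, continuous T}.
Proof.
move=> r01; have [d _] := transport_derive r01.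
by move/derivable1_diffP : d => /differentiable_continuous.
Qed.

Let T_powR_continuous (s r : R) : 0 < r < 1 -> {for r, continuous (fun r => T r `^ s)}.
Proof.
move=> r01; have [T0 _ _] := transportP r01.
apply: (@continuous_comp _ _ _ T (fun x => x `^ s)); first exact: transport_continuous.
exact: continuous_powR_gt0.
Qed.

Let wT_continuous (r : R) : 0 < r < 1 -> {for r, continuous (fun r => w (T r))}.
Proof.
move=> r01; have [T0 _ _] := transportP r01.
apply: (@continuous_comp _ _ _ T w); first exact: transport_continuous.
exact: bw_continuous.
Qed.

Let T'_continuous (r : R) : 0 < r < 1 -> {for r, continuous (fun r => mass r / w (T r))}.
Proof.
move=> r01; have [T0 _ _] := transportP r01.
apply: cvgM; first exact: mass_continuous.
apply: cvgV; last exact: wT_continuous.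
by rewrite gt_eqF// bw_gt0.
Qed.

(** The weight for the integration by parts: the two terms of its derivative are those averaged in
    [bliss_amgm]. *)
Definition bZ (r : R) : R := T r `^ j * r `^ (theta + 1 - j).
Definition bZ' (r : R) : R :=
  j * T r `^ (j - 1) * (mass r / w (T r)) * r `^ (theta + 1 - j) +
  T r `^ j * ((theta + 1 - j) * r `^ (theta + 1 - j - 1)).

Lemma bZ_derive (r : R) : 0 < r < 1 -> is_derive r 1 bZ (bZ' r).
Proof.
move=> r01; have /andP[r0 r1] := r01; have [T0 _ _] := transportP r01.
have d1 := is_derive1_comp (is_derive1_powR j T0) (transport_derive r01).
have d2 := is_derive1_powR (theta + 1 - j) r0.
have d3 := is_deriveM d1 d2.
apply: (is_derive_eq d3); rewrite /bZ' /GRing.scale/=; ring.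
Qed.

Lemma bZ'_continuous (r : R) : 0 < r < 1 -> {for r, continuous bZ'}.
Proof.
move=> r01; have /andP[r0 r1] := r01.
apply: cvgD; apply: cvgM.
- apply: cvgM; last exact: T'_continuous.
  by apply: cvgM; [exact: cvg_cst|exact: T_powR_continuous].
- exact: continuous_powR_gt0.
- exact: T_powR_continuous.
- by apply: cvgM; [exact: cvg_cst|exact: continuous_powR_gt0].
Qed.

Lemma bZ'_ge0 (r : R) : 0 <= bZ' r.
Proof.
by rewrite addr_ge0// !mulr_ge0 ?powR_ge0 ?invr_ge0 ?bw_ge0// ltW.
Qed.

Let h r := mass r * (theta + 1 + j * T r `^ sigma).

(** Change of variables: as T' = mass / w(T), the integrand is the derivative of [G \o T]. *)
Lemma transport_FTC (a b : R) : 0 < a -> a < b -> b < 1 ->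
  (\int[mu]_(r in `[a, b]) (h r)%:E = (G (T b) - G (T a))%:E)%E.
Proof.
move=> a0 ab b1.
have in01 r : a <= r <= b -> 0 < r < 1.
  by move=> /andP[ar rb]; rewrite (lt_le_trans a0 ar) (le_lt_trans rb).
have d (r : R) : 0 < r < 1 -> is_derive r 1 (G \o T) (h r).
  move=> r01; have [T0 _ _] := transportP r01.
  apply: (is_derive_eq (is_derive1_comp
    (prim_derive bg_continuous bg_bound T0) (transport_derive r01))).
  by rewrite /bg /h; field; rewrite gt_eqF// bw_gt0.
have cGT : {within `[a, b], continuous (G \o T)}.
  by apply: derivable_within_continuous => r; rewrite in_itv/= => /in01 /d [].
have /(continuous_within_itvP _ ab)[_ cGa cGb] := cGT.
rewrite (@continuous_FTC2 _ h (G \o T) a b ab) => [| | |].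
- by rewrite EFinB.
- apply: continuous_in_subspaceT => r; rewrite inE/= in_itv/= => /in01 r01.
  apply: cvgM; first exact: mass_continuous.
  apply: cvgD; first exact: cvg_cst.
  by apply: cvgM; [exact: cvg_cst|exact: T_powR_continuous].
- split; [|exact: cGa|exact: cGb].
  move=> r; rewrite in_itv/= => /andP[ar rb].
  have r01 : 0 < r < 1 by rewrite (lt_trans a0 ar) (lt_trans rb).
  by have [] := d r r01.
- move=> r; rewrite in_itv/= => /andP[ar rb].
  have r01 : 0 < r < 1 by rewrite (lt_trans a0 ar) (lt_trans rb).
  by rewrite derive1E; have [_ ->] := d r r01.
Qed.

(** [bliss_amgm] bounds Z' v^q from below, integration by parts turns it into q Z v^(q-1) |f|, and
    [bliss_young] bounds the latter from above. The integral of (theta + 1 - j) T^sigma against the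
    mass occurs on both sides and cancels. *)
Lemma bliss_ineq_ab (a b : R) : 0 < a -> a < b -> b < 1 ->
  ((G (T b) - G (T a))%:E <= (L `^ j * v b `^ q)%:E + C%:E * wint p a1 f)%E.
Proof.
move=> a0 ab b1.
have in01 (r : R) : a <= r <= b -> 0 < r < 1.
  by move=> /andP[ar rb]; rewrite (lt_le_trans a0 ar) (le_lt_trans rb).
have sub01 : `]a, b]%classic `<=` I01.
  by move=> z /=; rewrite !in_itv/= => /andP[az zb]; rewrite (lt_trans a0 az) (le_lt_trans zb).
have cwithin (g : R -> R) : (forall r, 0 < r < 1 -> {for r, continuous g}) ->
    {within `[a, b], continuous g}.
  move=> cg; apply: continuous_in_subspaceT => r; rewrite inE/= in_itv/= => rab.
  by apply: cg; exact: in01.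
have mcont (g : R -> R) : (forall r, 0 < r < 1 -> {for r, continuous g}) ->
    measurable_fun `]a, b]%classic g.
  move=> cg; apply: (measurable_funS (measurable_itv _) sub01).
  apply: open_continuous_measurable_fun; first exact: interval_open.
  by move=> r; rewrite inE/= in_itv/=; exact: cg.
pose B r := mass r * T r `^ sigma.
have B0 r : 0 <= B r by rewrite mulr_ge0 ?mass_ge0 ?powR_ge0.
have mB : measurable_fun `]a, b]%classic B.
  apply: mcont => r r01; apply: cvgM; first exact: mass_continuous.
  exact: T_powR_continuous.
have h0 r : 0 <= h r.
  rewrite mulr_ge0 ?mass_ge0// addr_ge0 ?(ltW th1)//.
  by rewrite mulr_ge0 ?powR_ge0// ltW.
have mh : measurable_fun `]a, b]%classic h.
  apply: mcont => r r01; apply: cvgM; first exact: mass_continuous.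
  apply: cvgD; first exact: cvg_cst.
  by apply: cvgM; [exact: cvg_cst|exact: T_powR_continuous].
have mfab := measurable_funS (measurable_itv _) sub01 hf.1.
have mdens : measurable_fun `]a, b]%classic (fun r => r `^ a1 * `|f r| `^ p).
  exact: wdens_measurable.
have mvq (s : R) : 0 < s -> measurable_fun `]a, b]%classic (fun r => v r `^ s).
  move=> s0; apply: (measurableT_comp (measurable_powR s)).
  exact: (measurable_funS (measurable_itv _) sub01 (AC_loc01_measurable (tail_AC hp ha1 hf))).
have q0 : 0 < q := lt_trans ltr01 q1.
have q10 : 0 < q - 1 by rewrite subr_gt0.
have jth0 := ltW jth.
have C0 : 0 <= C.
  by rewrite /bC mulr_ge0 ?invr_ge0 ?(ltW p0)// mulr_ge0 ?powR_ge0// ltW.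
have := int_tail_ibp hp ha1 hf q1 a0 ab b1 (fun r rab => bZ_derive (in01 r rab))
  (cwithin _ bZ'_continuous)
  (fun r _ => mulr_ge0 (powR_ge0 _ _) (powR_ge0 _ _)) (fun r _ => bZ'_ge0 r).
have low : (\int[mu]_(r in `]a, b]) (h r + (theta + 1 - j) * B r)%:E <=
    \int[mu]_(r in `]a, b]) (bZ' r * v r `^ q)%:E)%E.
  apply: int_le; first exact: measurable_itv.
  - by apply: measurable_funD => //; exact: measurable_funM.
  - apply: measurable_funM; last exact: mvq.
    by apply: mcont => r; exact: bZ'_continuous.
  - by move=> r _; rewrite addr_ge0// mulr_ge0.
  - move=> r /=; rewrite in_itv/= => /andP[ar rb].
    have r01 : 0 < r < 1 by apply: in01; rewrite (ltW ar).
    have [T0 _ _] := transportP r01; have /andP[r0 _] := r01.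
    apply: le_trans (bliss_amgm hp hN hth hnu T0 r0 (tail_ge0 f r)).
    by rewrite le_eqVlt; apply/orP; left; apply/eqP; rewrite /h /B /mass; ring.
have up : (\int[mu]_(r in `]a, b]) (q * bZ r * v r `^ (q - 1) * `|f r|)%:E <=
    \int[mu]_(r in `]a, b]) ((theta + 1 - j) * B r + C * (r `^ a1 * `|f r| `^ p))%:E)%E.
  apply: int_le; first exact: measurable_itv.
  - apply: measurable_funM; last exact: measurableT_comp.
    apply: measurable_funM; last exact: mvq.
    apply: mcont => r r01; apply: cvgM; first exact: cvg_cst.
    have [d _] := bZ_derive r01.
    by move/derivable1_diffP : d => /differentiable_continuous.
  - by apply: measurable_funD; exact: measurable_funM.
  - by move=> r _; rewrite !mulr_ge0 ?powR_ge0// ltW.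
  - move=> r /=; rewrite in_itv/= => /andP[ar rb].
    have r01 : 0 < r < 1 by apply: in01; rewrite (ltW ar).
    have [T0 _ _] := transportP r01; have /andP[r0 _] := r01.
    exact: (bliss_young hp hN hth hnu T0 r0 (tail_ge0 f r) (normr_ge0 (f r))).
move=> ibp; have {low up ibp} := le_trans low (le_trans ibp (leeD2l _ up)).
have m1 : measurable_fun `]a, b]%classic (fun r => (theta + 1 - j) * B r) by exact: measurable_funM.
have m2 : measurable_fun `]a, b]%classic (fun r => C * (r `^ a1 * `|f r| `^ p)).
  exact: measurable_funM.
rewrite (int_add (measurable_itv _) mh m1 (fun r _ => h0 r) (fun r _ => mulr_ge0 jth0 (B0 r))).
rewrite (int_add (measurable_itv _) m1 m2 (fun r _ => mulr_ge0 jth0 (B0 r))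
  (fun r _ => mulr_ge0 C0 (wdens_ge0 p a1 f r))).
(* Since [T] is at most [L], the common term is finite and may be cancelled. *)
have Bfin : (\int[mu]_(r in `]a, b]) ((theta + 1 - j) * B r)%:E)%E \is a fin_num.
  rewrite ge0_fin_numE; last by apply: int_ge0 => r _; exact: mulr_ge0.
  have mm : measurable_fun `]a, b]%classic mass by apply: mcont => r; exact: mass_continuous.
  apply: (@le_lt_trans _ _ (\int[mu]_(r in `]a, b]) ((theta + 1 - j) * L `^ sigma * mass r)%:E)%E).
    apply: int_le; [exact: measurable_itv|exact: m1|exact: measurable_funM| |].
      by move=> r _; exact: mulr_ge0.
    move=> r /=; rewrite in_itv/= => /andP[ar rb].
    have r01 : 0 < r < 1 by apply: in01; rewrite (ltW ar).
    have [T0 TL _] := transportP r01.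
    rewrite /B -mulrA; apply: ler_wpM2l => //; rewrite mulrC; apply: ler_wpM2r; first exact: mass_ge0.
    exact: (ge0_ler_powR (ltW sigma0) (ltW T0) (ltW L0) TL).
  have k0 : 0 <= (theta + 1 - j) * L `^ sigma by rewrite mulr_ge0 ?powR_ge0.
  rewrite (int_scale (measurable_itv _) mm (fun r _ => mass_ge0 r) k0).
  have le1 : (\int[mu]_(r in `]a, b]) (mass r)%:E <= (M L)%:E)%E.
    rewrite -HL; apply: int_subset; [exact: measurable_itv|exact: measurable_itv|
      exact: mass_measurable|by move=> s _; exact: mass_ge0|exact: sub01].
  apply: (@le_lt_trans _ _ (((theta + 1 - j) * L `^ sigma)%:E * (M L)%:E)%E).
    by apply: lee_wpmul2l => //; rewrite lee_fin.
  by rewrite -EFinM ltry.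
rewrite (int_scale (measurable_itv _) mdens (fun r _ => wdens_ge0 p a1 f r) C0).
have -> : (\int[mu]_(r in `]a, b]) (h r)%:E = (G (T b) - G (T a))%:E)%E.
  rewrite -transport_FTC//; apply: integral_itv_obnd_cbnd.
  exact/measurable_EFinP.
rewrite [in X in (_ <= X)%E -> _]addeA [in X in (_ <= X)%E -> _](addeC (_ * _)%:E) -addeA addeC.
rewrite leeD2lE// => /le_trans; apply.
have b01 : 0 < b < 1 by rewrite (lt_trans a0 ab).
have [Tb0 TbL _] := transportP b01; have /andP[b0 _] := b01.
apply: leeD.
  rewrite lee_fin; apply: ler_wpM2r; first exact: powR_ge0.
  rewrite /bZ -[leRHS]mulr1; apply: ler_pM; rewrite ?powR_ge0//.
    exact: (ge0_ler_powR (ltW j0) (ltW Tb0) (ltW L0) TbL).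
  have := ge0_ler_powR jth0 (ltW b0) ler01 (ltW b1).
  by rewrite powR1.
apply: lee_wpmul2l; first by rewrite lee_fin.
exact: int_dens_le.
Qed.

(** Let the end points tend to 0 and 1: [T] then runs through almost all of (0, L], and the boundary
    term vanishes with the tail at 1. *)
Lemma bliss_transport : ((G L)%:E <= C%:E * wint p a1 f)%E.
Proof.
apply/lee_addgt0Pr => e e0.
pose K := (theta + 1 + j * L `^ sigma) * L `^ theta.
have K0 : 0 <= K.
  by have /andP[] := bg_bound L0 (lexx L) => /le_trans; apply.
have K1 : 0 < 3 * (K + 1) by rewrite mulr_gt0// ltr_wpDl.
(* As [K] bounds the density [bg] on (0, L], the primitive [G] grows by at most [e / 3] on each of
   the two end pieces of length [l1]. *)
pose l1 := Num.min (L / 2) (e / (3 * (K + 1))).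
have l10 : 0 < l1 by rewrite lt_min !divr_gt0.
have l1L : l1 <= L / 2 by rewrite ge_min lexx.
pose l2 := L - l1.
have l20 : 0 < l2 by rewrite /l2; move: l1L L0; lra.
have l2L : l2 < L by rewrite /l2 ltrBlDr ltrDl.
have Kl1 : K * l1 <= e / 3.
  apply: (@le_trans _ _ (K * (e / (3 * (K + 1))))).
    by rewrite ler_wpM2l// ge_min lexx orbT.
  by rewrite mulrA ler_pdivrMr// -subr_ge0 [leRHS](_ : _ = e) ?(ltW e0)//; field.
have G1 : G l1 <= K * l1.
  have := primB_le bg_continuous bg_bound (lexx 0) (ltW l10).
  rewrite prim0 !subr0 => /le_trans; apply; apply: ler_wpM2r; first exact: ltW.
  have l1L' : l1 <= L by move: l1L L0; lra.
  apply: ler_pM; rewrite ?powR_ge0//.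
  - by rewrite addr_ge0 ?(ltW th1)// mulr_ge0 ?powR_ge0// ltW.
  - rewrite lerD2l ler_pM2l//.
    exact: (ge0_ler_powR (ltW sigma0) (ltW l10) (ltW L0) l1L').
  - exact: (ge0_ler_powR hth (ltW l10) (ltW L0) l1L').
have G2 : G L - G l2 <= K * l1.
  have := primB_le bg_continuous bg_bound (ltW l20) (ltW l2L).
  by rewrite (_ : L - l2 = l1)// /l2; ring.
pose d := Num.min (M l1) (M L - M l2).
have Ml2 : M l2 < M L := prim_lt bw_continuous bw_bound bw_pos l20 l2L.
have d0 : 0 < d.
  by rewrite lt_min (prim_gt0 bw_continuous bw_bound bw_pos l10) subr_gt0.
(* By the choice of [d], missing less mass than [d] forces [T a] to be at most [l1], and [T] to be
   at least [l2] to the right of [b]. *)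
have [a [b [a0 ab b1 mab]]] : exists a b, [/\ 0 < a, a < b, b < 1 &
    M L - d < prim mass b - prim mass a].
  apply: contrapT => nab.
  have : ((M L)%:E <= (M L - d)%:E)%E.
    rewrite -{1}HL; apply: int_exhaust01; first exact: mass_measurable.
      by move=> r _; exact: mass_ge0.
    move=> a b a0 ab b1.
    have -> : (\int[mu]_(r in `]a, b]) (mass r)%:E = (prim mass b - prim mass a)%:E)%E.
      rewrite (mass_primB (ltW a0) (ltW ab) b1) /Rintegral fineK; first by [].
      apply: integrable_fin_num; first exact: measurable_itv.
      apply: integrableS (mass_integrable b1); [exact: measurable_itv|exact: measurable_itv|].
      by move=> z /=; rewrite !in_itv/= => /andP[az ->]; rewrite (lt_trans a0 az).
    by rewrite lee_fin leNgt; apply/negP => lt; apply: nab; exists a, b.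
  by rewrite lee_fin; move: d0; lra.
have a01 : 0 < a < 1 by rewrite a0 (lt_trans ab).
have dl1 : d <= M l1 by rewrite ge_min lexx.
have dl2 : d <= M L - M l2 by rewrite ge_min lexx orbT.
have mbL := mass_prim_leM b1.
have Ta : T a <= l1.
  have [Ta0 _ ea] := transportP a01.
  rewrite leNgt; apply/negP => lt.
  have := prim_lt bw_continuous bw_bound bw_pos l10 lt; rewrite ea => lt'.
  exact: (mass_arith1 mab mbL dl1 lt').
pose y := (e / 3 / L `^ j) `^ q^-1.
have Lj0 : 0 < L `^ j by rewrite powR_gt0.
have y0 : 0 < y by rewrite powR_gt0// !divr_gt0.
have q0 : 0 < q := lt_trans ltr01 q1.
have /cvgrPdist_lt/(_ _ y0) near1 := tail_cvg1 hp ha1 hf.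
near (1 : R)^'- => c.
have bc : b < c by near: c; exact: nbhs_left_gt.
have c1 : c < 1 by near: c; exact: nbhs_left_lt.
have vc : v c < y.
  have : `|0 - v c| < y by near: c.
  by rewrite sub0r normrN ger0_norm ?tail_ge0.
have c01 : 0 < c < 1 by rewrite (lt_trans _ bc)// (lt_trans a0).
have Tc : l2 <= T c.
  have [Tc0 _ ec] := transportP c01.
  rewrite leNgt; apply/negP => lt.
  have := prim_lt bw_continuous bw_bound bw_pos Tc0 lt; rewrite ec => lt'.
  have b0 : 0 <= b by rewrite ltW// (lt_trans a0).
  have mbc := mass_prim_le b0 (ltW bc) c1.
  exact: (mass_arith2 mab dl2 (ltW (mass_prim_gt0 a01)) mbc lt').
have [Ta0 _ _] := transportP a01.
have Gc : G l2 <= G (T c) := prim_le bg_continuous bg_bound (ltW l20) Tc.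
have Ga : G (T a) <= G l1 := prim_le bg_continuous bg_bound (ltW Ta0) Ta.
have vq : L `^ j * v c `^ q <= e / 3.
  rewrite mulrC -ler_pdivlMr//.
  have := ge0_ler_powR (ltW q0) (tail_ge0 f c) (ltW y0) (ltW vc).
  by rewrite /y -powRrM mulVf ?gt_eqF// powRr1// ltW// !divr_gt0.
have := bliss_ineq_ab a0 (lt_trans ab bc) c1.
rewrite -(fineK (wint_fin_num hf)) -!EFinM -!EFinD !lee_fin.
exact: (mass_arith3 G1 G2 Kl1 Gc Ga vq).
Unshelve. all: by end_near. Qed.

End transport.
End bliss.

Opaque prim.

Lemma scale_mass_powR {R : realType} (m i P : R) : 0 < m -> 0 < i -> 0 < P ->
  ((m / i) `^ P^-1) `^ P * i = m.
Proof.
move=> m0 i0 P0; rewrite -powRrM mulVf ?gt_eqF// powRr1; last by rewrite ltW// divr_gt0.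
by rewrite divfK// gt_eqF.
Qed.

(** Solves for the mass [i] the inequality that holds after rescaling to mass [m]. *)
Lemma scale_mass_le {R : realType} (m g c i e p P : R) :
  0 < m -> 0 < g -> 0 < c -> 0 < i -> 0 <= e -> 0 < p -> 0 < P ->
  g <= c * (((m / i) `^ P^-1) `^ p * e) -> i <= m * (c / g) `^ (P / p) * e `^ (P / p).
Proof.
move=> m0 g0 c0 i0 e0 p0 P0 H.
have H2 : i `^ (p / P) <= m `^ (p / P) * (c / g * e).
  have : g * i `^ (p / P) <= c * (m `^ (p / P) * e).
    apply: le_trans (ler_wpM2r (powR_ge0 i (p / P)) H) _.
    rewrite -powRrM (mulrC P^-1) powRM ?(ltW m0) ?invr_ge0 ?(ltW i0)//.
    rewrite (_ : i^-1 `^ (p / P) = (i `^ (p / P))^-1); last first.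
      by rewrite -(powR_inv1 (ltW i0)) -powRrM mulN1r powRN.
    rewrite le_eqVlt; apply/orP; left; apply/eqP.
    by field; rewrite gt_eqF// powR_gt0.
  rewrite -ler_pdivlMl// => /le_trans; apply; rewrite le_eqVlt; apply/orP; left; apply/eqP.
  by field; rewrite gt_eqF.
have Pp0 : 0 <= P / p by rewrite divr_ge0 ?ltW.
have CGE : 0 <= c / g * e by rewrite mulr_ge0// divr_ge0 ?ltW.
have := ge0_ler_powR Pp0 (powR_ge0 i _) (mulr_ge0 (powR_ge0 m (p / P)) CGE) H2.
rewrite (powRM _ (powR_ge0 _ _) CGE) -!powRrM (_ : p / P * (P / p) = 1); last first.
  by field; rewrite !gt_eqF.
rewrite !powRr1 ?(ltW m0) ?(ltW i0)// => /le_trans; apply.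
by rewrite powRM ?divr_ge0 ?(ltW c0) ?(ltW g0)// mulrA.
Qed.

(** * The Bliss inequality in homogeneous form *)

Section bliss_homogeneous.
Context {R : realType}.
Local Notation mu := (@lebesgue_measure R).
Local Notation I01 := (`](0 : R)%R, 1%R[%classic).
Context (p a1 theta : R) (hp : 1 < p) (ha1 : 0 <= a1) (hN : 0 < a1 - p + 1)
  (hth : 0 <= theta) (hnu : a1 - p < theta).
Local Notation P := (pstar p a1 theta).
Local Notation M := (prim (bw p a1 theta)).
Local Notation G := (prim (bg p a1 theta)).
Local Notation C := (bC p a1 theta).

Let p0 : 0 < p. Proof. exact: bp0. Qed.
Let P0 : 0 < P. Proof. exact: bP0. Qed.

Lemma wintZ (t g r : R) (f : R -> R) : 0 < r -> 0 <= t -> measurable_fun I01 f ->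
  wint r g (fun x => t * f x) = ((t `^ r)%:E * wint r g f)%E.
Proof.
move=> r0 t0 mf; rewrite /wint -(int_scale (measurable_itv _) (wdens_measurable r g mf)
  (fun x _ => wdens_ge0 r g f x) (powR_ge0 t r)).
by apply: eq_integral => x _; rewrite normrM ger0_norm// powRM// mulrCA.
Qed.

Lemma wLZ (t r g : R) (f : R -> R) : 0 < r -> 0 <= t -> wL r g f -> wL r g (fun x => t * f x).
Proof.
move=> r0 t0 [mf fin]; split; first by apply: measurable_funM => //; exact: measurable_cst.
rewrite wintZ//; have Ef : wint r g f \is a fin_num.
  by rewrite ge0_fin_numE//; exact: wint_ge0.
by rewrite -(fineK Ef) -EFinM ltry.
Qed.

Lemma tailZ (t x : R) (f : R -> R) : wL p a1 f -> 0 <= t -> 0 < x ->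
  tail (fun y => t * f y) x = t * tail f x.
Proof.
move=> hf t0 x0; have hf' := wLZ p0 t0 hf.
apply: EFin_inj; rewrite EFinM (tailE hp ha1 hf' x0) (tailE hp ha1 hf x0).
have sub : `]x, 1[%classic `<=` I01.
  by move=> z /=; rewrite !in_itv/= => /andP[xz ->]; rewrite (lt_trans x0 xz).
have mf := measurable_funS (measurable_itv _) sub hf.1.
rewrite -(int_scale (measurable_itv _) (measurableT_comp (@normr_measurable R setT) mf)
  (fun x _ => normr_ge0 (f x)) t0).
by apply: eq_integral => y _; rewrite normrM ger0_norm.
Qed.

(** The constant obtained by comparison with the extremal cut off at [L]. No limit of large [L] is
    taken: one suitable [L] suffices, because the test function with the same cut-off exceeds this
    very level. *)
Definition bS (L : R) : R := M L * (C / G L) `^ (P / p).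

Lemma bC_gt0 : 0 < C.
Proof.
apply: divr_gt0; last exact: p0.
apply: mulr_gt0; first exact: lt_trans ltr01 (bq1 hp hN hth).
by apply: powR_gt0; apply: divr_gt0; [exact: hN|exact: bp10].
Qed.

Lemma M_gt0 (L : R) : 0 < L -> 0 < M L.
Proof.
move=> L0; exact: (prim_gt0 (@bw_continuous R p a1 theta)
  (bw_bound hp hth hnu) (@bw_pos R p a1 theta) L0).
Qed.

Lemma G_gt0 (L : R) : 0 < L -> 0 < G L.
Proof.
move=> L0; exact: (prim_gt0 (@bg_continuous R p a1 theta)
  (bg_bound hp hth hnu) (bg_gt0 hp hth hnu) L0).
Qed.

Lemma bS_gt0 (L : R) : 0 < L -> 0 < bS L.
Proof. by move=> L0; rewrite mulr_gt0 ?M_gt0// powR_gt0// divr_gt0 ?bC_gt0 ?G_gt0. Qed.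

(** Multiply [f] by the constant that brings the mass to [M L], apply [bliss_transport], and undo
    the scaling. *)
Lemma bliss_ineq (L : R) (f : R -> R) : 0 < L -> wL p a1 f ->
  (\int[mu]_(r in I01) (r `^ theta * tail f r `^ P)%:E <=
    (bS L * fine (wint p a1 f) `^ (P / p))%:E)%E.
Proof.
move=> L0 hf; pose E := fine (wint p a1 f).
have EE : E%:E = wint p a1 f by rewrite fineK// wint_fin_num.
have E0 : 0 <= E by apply: fine_ge0; exact: wint_ge0.
have fin := mass_fin hp ha1 hN hnu hf.
set I := (X in (X <= _)%E).
have I0 : (0 <= I)%E.
  by apply: int_ge0 => r _; exact: mulr_ge0 (powR_ge0 _ _) (powR_ge0 _ _).
have Ifin : I \is a fin_num by rewrite ge0_fin_numE; [exact: fin|exact: I0].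
have [i iE] : exists i, I = i%:E by exists (fine I); exact: esym (fineK Ifin).
have i0 : 0 <= i by move: I0; rewrite iE lee_fin.
rewrite iE lee_fin.
have [i00|ipos] := eqVneq i 0.
  by rewrite i00; exact: mulr_ge0 (ltW (bS_gt0 L0)) (powR_ge0 _ _).
have {ipos} ip : 0 < i by rewrite lt_neqAle eq_sym ipos.
pose t := (M L / i) `^ P^-1.
have t0 : 0 < t by exact: powR_gt0 (divr_gt0 (M_gt0 L0) ip).
have hf' := wLZ p0 (ltW t0) hf.
have mass_tail : measurable_fun I01 (fun r => r `^ theta * tail f r `^ P).
  exact: (mass_measurable hp ha1 hN hnu hf).
have HL : (\int[mu]_(r in I01) (r `^ theta * tail (fun y => (t * f y)%R) r `^ P)%:E)%E = (M L)%:E.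
  transitivity (\int[mu]_(r in I01) (t `^ P * (r `^ theta * tail f r `^ P))%:E)%E.
    apply: eq_integral => r; rewrite inE /= in_itv/= => /andP[r0 r1].
    by rewrite (tailZ hf (ltW t0) r0) (powRM _ (ltW t0) (tail_ge0 _ _)) mulrCA.
  rewrite (int_scale (measurable_itv _) mass_tail
    (fun r _ => mulr_ge0 (powR_ge0 r _) (powR_ge0 (tail f r) P)) (powR_ge0 t P)).
  by rewrite -/I iE -EFinM (scale_mass_powR (M_gt0 L0) ip P0).
have := bliss_transport hp ha1 hN hth hnu hf' L0 HL.
rewrite (wintZ a1 p0 (ltW t0) hf.1) -EE -!EFinM lee_fin.
exact: (scale_mass_le (M_gt0 L0) (G_gt0 L0) bC_gt0 ip E0 p0 P0).
Qed.

End bliss_homogeneous.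

(** * A test function exceeding the concentration level *)

Section vanishing_at_0.
Context {R : realType}.
Local Notation mu := (@lebesgue_measure R).
Local Notation I01 := (`](0 : R)%R, 1%R[%classic).
Implicit Types (f phi K : R -> R) (L s t x : R).

(** Identities between primitives are obtained below by comparing derivatives; this is the
    uniqueness that concludes. *)
Lemma vanish_const f : (forall t, 0 < t -> is_derive t 1 f 0) ->
  f t @[t --> 0^'+] --> (0 : R) -> forall t, 0 < t -> f t = 0.
Proof.
move=> df f0 t t0; apply/eqP; rewrite -normr_le0; apply/ler_addgt0Pr => e e0; rewrite add0r.
have /cvgrPdist_lt/(_ _ e0) near0 := f0.
near (0 : R)^'+ => s.
have s0 : 0 < s by near: s; exact: nbhs_right_gt.
have st : s < t by near: s; exact: nbhs_right_lt.
have fs : `|0 - f s| < e by near: s.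
have d z : z \in `]s, t[ -> is_derive z 1 f 0.
  by rewrite in_itv/= => /andP[sz _]; apply: df; exact: lt_trans sz.
have c : {within `[s, t], continuous f}.
  apply: derivable_within_continuous => z; rewrite in_itv/= => /andP[sz _].
  by have [] := df _ (lt_le_trans s0 sz).
have [z _] := MVT st d c; rewrite mul0r => /eqP; rewrite subr_eq0 => /eqP ->.
by move: fs; rewrite sub0r normrN; exact: ltW.
Unshelve. all: by end_near. Qed.

Lemma prim_cvg0 phi K : (forall x, 0 < x -> {for x, continuous phi}) ->
  (forall s t, 0 < s -> s <= t -> 0 <= phi s <= K t) ->
  prim phi t @[t --> 0^'+] --> (0 : R).
Proof.
move=> cphi phi_bnd.
pose K' t := K (Num.max t 1).
have bnd' s t : 0 < s -> s <= t -> 0 <= phi s <= K' t.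
  by move=> s0 st; apply: phi_bnd => //; rewrite le_max st.
have K1 : 0 <= K 1 by have /andP[] := phi_bnd 1 1 ltr01 (lexx 1) => /le_trans; apply.
have K10 : 0 < K 1 + 1 by rewrite ltr_wpDl.
apply/cvgrPdist_lt => e e0.
have ep : 0 < e / (K 1 + 1) by rewrite divr_gt0.
near=> t; rewrite sub0r normrN.
have t0 : 0 < t by near: t; exact: nbhs_right_gt.
have t1 : t < 1 by near: t; exact: nbhs_right_lt.
have te : t < e / (K 1 + 1) by near: t; exact: nbhs_right_lt.
have pge : 0 <= prim phi t.
  have := prim_le cphi phi_bnd (lexx 0) (ltW t0).
  by rewrite prim0.
rewrite ger0_norm//.
have := primB_le cphi bnd' (lexx 0) (ltW t0); rewrite prim0 !subr0 => /le_lt_trans; apply.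
rewrite /K' max_r ?(ltW t1)//.
apply: (@le_lt_trans _ _ ((K 1 + 1) * t)).
  by rewrite ler_wpM2r ?(ltW t0)// lerDl.
by rewrite mulrC -ltr_pdivlMr.
Unshelve. all: by end_near. Qed.

Lemma cvg_mulr0 L f : 0 < L -> f t @[t --> 0^'+] --> (0 : R) ->
  f (L * t) @[t --> 0^'+] --> (0 : R).
Proof.
move=> L0 /cvgrPdist_lt f0; apply/cvgrPdist_lt => e e0.
have [/= d d0 H] := f0 e e0; exists (d / L); first by rewrite /= divr_gt0.
move=> t /= td t0; apply: H; last by rewrite mulr_gt0.
move: td; rewrite /= !sub0r !normrN !gtr0_norm ?mulr_gt0//.
by rewrite ltr_pdivlMr// mulrC.
Qed.

Lemma prim_scale L phi K : 0 < L -> (forall x, 0 < x -> {for x, continuous phi}) ->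
  (forall s t, 0 < s -> s <= t -> 0 <= phi s <= K t) ->
  forall t, 0 < t -> prim (fun s => phi (L * s)) t = prim phi (L * t) / L.
Proof.
move=> L0 cphi phi_bnd t t0.
have cphiL x : 0 < x -> {for x, continuous (fun s => phi (L * s))}.
  move=> x0; apply: (@continuous_comp _ _ _ (fun r => L * r) phi).
    by apply: cvgM; [exact: cvg_cst|exact: cvg_id].
  by apply: cphi; rewrite mulr_gt0.
have bndL s r : 0 < s -> s <= r -> 0 <= phi (L * s) <= K (L * r).
  by move=> s0 sr; apply: phi_bnd; rewrite ?mulr_gt0// ler_pM2l.
apply/eqP; rewrite -subr_eq0; apply/eqP.
apply: (@vanish_const (fun t => prim (fun s => phi (L * s)) t - prim phi (L * t) / L)) => //.
  move=> r r0.
  have d1 := prim_derive cphiL bndL r0.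
  have dL : is_derive r 1 (fun s => L * s) L.
    by have := is_deriveZ L (is_derive_id r (1 : R)); rewrite /GRing.scale/= mulr1; apply.
  have Lr0 : 0 < L * r by rewrite mulr_gt0.
  have d2 := is_derive1_comp (prim_derive cphi phi_bnd Lr0) dL.
  have d3 := is_deriveZ L^-1 d2.
  have d4 := is_deriveB d1 d3.
  rewrite (_ : (fun t => _) = prim (fun s => phi (L * s)) - L^-1 \*: (prim phi \o (fun s => L * s))).
    apply: (is_derive_eq d4).
    by rewrite /GRing.scale/=; field; rewrite gt_eqF.
  by apply/funext => s; rewrite /= !fctE/= /GRing.scale/= mulrC.
rewrite -[X in _ --> X](subrr (0 : R)); apply: cvgB; first exact: (prim_cvg0 cphiL bndL).
rewrite -[X in _ --> X](mul0r (L^-1)); apply: cvgM; last exact: cvg_cst.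
exact: (cvg_mulr0 L0 (prim_cvg0 cphi phi_bnd)).
Qed.

End vanishing_at_0.

(** * The Bliss extremal and its energy *)

Section bliss_profile.
Context {R : realType}.
Local Notation mu := (@lebesgue_measure R).
Context (p a1 theta : R) (hp : 1 < p) (hN : 0 < a1 - p + 1)
  (hth : 0 <= theta) (hnu : a1 - p < theta).
Local Notation N := (bN p a1).
Local Notation nu := (bnu p a1 theta).
Local Notation sigma := (bsigma p a1 theta).
Local Notation j := (bj p a1 theta).
Local Notation q := (bq p a1 theta).
Local Notation P := (pstar p a1 theta).
Local Notation w := (bw p a1 theta).
Local Notation M := (prim (bw p a1 theta)).
Local Notation G := (prim (bg p a1 theta)).
Local Notation C := (bC p a1 theta).
Local Notation c := (N / (p - 1)).
Implicit Types s t L x : R.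

Let p0 : 0 < p. Proof. exact: bp0. Qed.
Let p10 : 0 < p - 1. Proof. exact: bp10. Qed.
Let nu0 : 0 < nu. Proof. exact: bnu0. Qed.
Let N0 : 0 < N. Proof. exact: hN. Qed.
Let c0 : 0 < c. Proof. exact: divr_gt0. Qed.
Let sigma0 : 0 < sigma. Proof. exact: bsigma0. Qed.
Let th1 : 0 < theta + 1. Proof. exact: bth1. Qed.

(** The Bliss extremal on the half-line. [bdW] is the opposite of its derivative, and [be] below is
    its energy density. *)
Definition bW t : R := (1 + t `^ sigma) `^ (- (N / nu)).
Definition bdW t : R := c * t `^ (sigma - 1) * (1 + t `^ sigma) `^ (- (N / nu) - 1).
Local Notation W := bW.
Local Notation dW := bdW.

Let one_pow_gt0 t : 0 < 1 + t `^ sigma.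
Proof. by rewrite ltr_wpDr ?powR_ge0. Qed.

Lemma bW_gt0 t : 0 < W t. Proof. exact: powR_gt0. Qed.

Lemma bdW_ge0 t : 0 <= dW t.
Proof. exact: mulr_ge0 (mulr_ge0 (ltW c0) (powR_ge0 _ _)) (powR_ge0 _ _). Qed.

Lemma is_derive_1pow t : 0 < t ->
  is_derive t 1 (fun t => 1 + t `^ sigma) (sigma * t `^ (sigma - 1)).
Proof.
move=> t0; have d := is_deriveD (is_derive_cst (1 : R) t (1 : R)) (is_derive1_powR sigma t0).
by apply: (is_derive_eq d); rewrite add0r.
Qed.

Lemma bW_derive t : 0 < t -> is_derive t 1 W (- dW t).
Proof.
move=> t0; have d := @is_derive1_comp _ (fun x => x `^ (- (N / nu))) (fun t => 1 + t `^ sigma) t _ _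
  (is_derive1_powR (- (N / nu)) (one_pow_gt0 t)) (is_derive_1pow t0).
apply: (is_derive_eq d); rewrite /bdW /bsigma; field.
by rewrite !gt_eqF.
Qed.

Lemma bW_continuous t : 0 < t -> {for t, continuous W}.
Proof.
by move=> t0; have [d _] := bW_derive t0; move/derivable1_diffP : d => /differentiable_continuous.
Qed.

Lemma bdW_continuous t : 0 < t -> {for t, continuous dW}.
Proof.
move=> t0; apply: cvgM.
  by apply: cvgM; [exact: cvg_cst|exact: continuous_powR_gt0].
apply: (@continuous_comp _ _ _ (fun r => 1 + r `^ sigma)
  (fun r => r `^ (- (N / nu) - 1))).
  by apply: cvgD; [exact: cvg_cst|exact: continuous_powR_gt0].
exact: continuous_powR_gt0.
Qed.

Lemma bW_lt s t : 0 < s -> s < t -> W t < W s.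
Proof.
move=> s0 st; rewrite /bW !powRN ltf_pV2 ?posrE ?powR_gt0//.
have Nnu : 0 < N / nu by rewrite divr_gt0.
have sg : s `^ sigma < t `^ sigma.
  by apply: gt0_ltr_powR; rewrite ?nnegrE ?(ltW s0) ?(ltW (lt_trans s0 st)).
by apply: gt0_ltr_powR; rewrite ?nnegrE ?(ltW (one_pow_gt0 _))// ltrD2l.
Qed.

(** Interpolates between W <= 1 (k = 0) and the full decay t^(-c) at infinity (k = 1). *)
Lemma bW_le_powR (k t : R) : 0 <= k <= 1 -> 0 < t -> W t <= t `^ (- (k * c)).
Proof.
move=> /andP[k0 k1] t0.
have Nnu : 0 <= N / nu by rewrite divr_ge0// ltW.
rewrite (_ : - (k * c) = (k * sigma) * - (N / nu)); last first.
  by rewrite /bsigma; field; rewrite !gt_eqF.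
rewrite powRrM /bW !powRN lef_pV2 ?posrE ?powR_gt0//.
apply: ge0_ler_powR; rewrite ?nnegrE ?powR_ge0 ?(ltW (one_pow_gt0 _))//.
have [t1|/ltW t1] := leP t 1.
  apply: (@le_trans _ _ 1); last by rewrite lerDl powR_ge0.
  have := ge0_ler_powR (mulr_ge0 k0 (ltW sigma0)) (ltW t0 : _ \in Num.nneg) (ler01 : _ \in Num.nneg) t1.
  by rewrite powR1.
apply: (@le_trans _ _ (t `^ sigma)); last by rewrite lerDr.
by rewrite ler_powR// ler_piMl// ltW.
Qed.

Lemma bw_bW t : bw p a1 theta t = t `^ theta * W t `^ P.
Proof.
rewrite /bw /bW -powRrM; congr (_ * _ `^ _); rewrite /pstar -/N; field.
by rewrite !gt_eqF.
Qed.

Definition be t : R := c `^ p * (t `^ sigma * w t).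
Local Notation En := (prim be).

Lemma bdW_powR t : 0 < t -> t `^ a1 * dW t `^ p = be t.
Proof.
move=> t0.
rewrite /bdW /be /bw (powRM _ (mulr_ge0 (ltW c0) (powR_ge0 _ _)) (powR_ge0 _ _)) (powRM _ (ltW c0) (powR_ge0 _ _)) -!powRrM.
have e1 : t `^ a1 * t `^ ((sigma - 1) * p) = t `^ sigma * t `^ theta.
  rewrite -!powRD ?(gt_eqF t0) ?implybT//; congr powR.
  by rewrite /bsigma /bnu /bN; field; rewrite gt_eqF.
have e2 : (- (N / nu) - 1) * p = - ((theta + 1) * p / nu).
  by rewrite /bnu; field; rewrite gt_eqF//; exact: nu0.
rewrite e2; transitivity (c `^ p * (t `^ a1 * t `^ ((sigma - 1) * p)) *
  (1 + t `^ sigma) `^ (- ((theta + 1) * p / nu))); first by ring.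
by rewrite e1; ring.
Qed.

Lemma be_continuous t : 0 < t -> {for t, continuous be}.
Proof.
move=> t0; apply: cvgM; first exact: cvg_cst.
by apply: cvgM; [exact: continuous_powR_gt0|exact: bw_continuous].
Qed.

Lemma be_pos t : 0 < t -> 0 < be t.
Proof.
by move=> t0; apply: mulr_gt0 (powR_gt0 _ c0) (mulr_gt0 (powR_gt0 _ t0) (bw_gt0 p a1 theta t0)).
Qed.

Lemma be_bound s t : 0 < s -> s <= t -> 0 <= be s <= c `^ p * (t `^ sigma * t `^ theta).
Proof.
move=> s0 st; rewrite (ltW (be_pos s0))/=; apply: ler_wpM2l; first exact: powR_ge0.
have /andP[w0 wt] := bw_bound hp hth hnu s0 st.
apply: (ler_pM (powR_ge0 _ _) w0 _ wt).
exact: (ge0_ler_powR (ltW sigma0) (ltW s0 : _ \in Num.nneg) (le_trans (ltW s0) st : _ \in Num.nneg) st).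
Qed.

Lemma En_gt0 L : 0 < L -> 0 < En L.
Proof. by move=> L0; exact: (prim_gt0 be_continuous be_bound be_pos L0). Qed.

(* The difference of the two sides is [L ^ (theta + 1) * W L ^ q], whose
   derivative in [L] is [bg - C * be]. *)
Lemma energy_le L : 0 < L -> C * En L <= G L.
Proof.
move=> L0.
pose H t := t `^ (theta + 1) * W t `^ q.
have dH t : 0 < t -> is_derive t 1 H (bg p a1 theta t - C * be t).
  move=> t0.
  have d1 := is_derive1_powR (theta + 1) t0.
  have d2 := is_derive1_comp (is_derive1_powR q (bW_gt0 t)) (bW_derive t0).
  apply: (is_derive_eq (is_deriveM d1 d2)); rewrite /GRing.scale/=.
  set U := 1 + t `^ sigma.
  have eU1 : W t `^ q = U * U `^ (- ((theta + 1) * p / nu)).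
    transitivity (U `^ 1 * U `^ (- ((theta + 1) * p / nu))); last by rewrite (powRr1 (ltW (one_pow_gt0 t))).
    rewrite -powRD; last by rewrite (gt_eqF (one_pow_gt0 t)) implybT.
    rewrite /bW -/U -powRrM; congr powR; rewrite /bq /bnu; field.
    by rewrite (gt_eqF N0) gt_eqF//; exact: nu0.
  have eU2 : W t `^ (q - 1) * dW t = c * t `^ (sigma - 1) * U `^ (- ((theta + 1) * p / nu)).
    rewrite /bdW /bW -/U mulrCA -powRrM -powRD; last by rewrite (gt_eqF (one_pow_gt0 t)) implybT.
    congr (_ * _ `^ _); rewrite /bq /bnu; field.
    by rewrite (gt_eqF N0) gt_eqF//; exact: nu0.
  have eC : C * c `^ p = q * c / p.
    transitivity (q * (c `^ (1 - p) * c `^ p) / p); first by rewrite /bC; ring.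
    rewrite -powRD; last by rewrite (gt_eqF c0) implybT.
    by rewrite subrK (powRr1 (ltW c0)).
  have et1 : t `^ (theta + 1) * t `^ (sigma - 1) = t `^ theta * t `^ sigma.
    by rewrite -!powRD ?(gt_eqF t0) ?implybT//; congr powR; ring.
  rewrite /bg /be /bw -/U eU1 (_ : theta + 1 - 1 = theta); last by rewrite addrK.
  rewrite (_ : _ * (- dW t) = - (q * (W t `^ (q - 1) * dW t))); last by ring.
  rewrite eU2 mulrN (mulrCA (t `^ _)) (_ : t `^ (theta + 1) * (_ * _) = c * (t `^ (theta + 1) * t `^ (sigma - 1)) * U `^ (- ((theta + 1) * p / nu))); last by ring.
  rewrite et1 (mulrA C) eC /U /bq /bj /bnu; field.
  by rewrite !gt_eqF.
have H0 t : 0 <= H t by rewrite mulr_ge0 ?powR_ge0.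
rewrite -subr_ge0.
suff -> : G L - C * En L = H L by [].
apply/eqP; rewrite -subr_eq0; apply/eqP.
apply: (@vanish_const _ (fun t => G t - C * En t - H t)) => //.
  move=> t t0.
  have dG := prim_derive (@bg_continuous R p a1 theta) (bg_bound hp hth hnu) t0.
  have dE := is_deriveZ C (prim_derive be_continuous be_bound t0).
  by apply: (is_derive_eq (is_deriveB (is_deriveB dG dE) (dH t t0))); rewrite /GRing.scale/= subrr.
have powR_cvg0 : t `^ (theta + 1) @[t --> 0^'+] --> (0 : R).
  have e : \forall t \near (0 : R)^'+, pospow (theta + 1) t = t `^ (theta + 1).
    near=> t; apply: (pospowE th1); apply: ltW; near: t; exact: nbhs_right_gt.
  apply: cvg_trans (near_eq_cvg e) _.
  have z0 : pospow (theta + 1) (0 : R) = 0 by rewrite /pospow ltxx.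
  by apply: cvg_at_right_filter; have := @continuous_pospow _ _ th1 0; rewrite /continuous_at z0.
have Hc : H t @[t --> 0^'+] --> (0 : R).
  apply: (@squeeze_cvgr _ _ _ _ (cst 0) (fun t => t `^ (theta + 1))).
  - near=> t; rewrite H0/= /H ler_piMr ?powR_ge0//.
    have t0 : 0 < t by near: t; exact: nbhs_right_gt.
    have W1 := @bW_le_powR 0 t (introT andP (conj (lexx 0) ler01)) t0.
    have : W t <= 1 by move: W1; rewrite mul0r oppr0 powRr0.
    move=> W1'; have q0 := ltW (lt_trans ltr01 (bq1 hp hN hth)).
    have := ge0_ler_powR q0 (ltW (bW_gt0 t) : _ \in Num.nneg) (ler01 : _ \in Num.nneg) W1'.
    by rewrite powR1.
  - exact: cvg_cst.
  - exact: powR_cvg0.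
rewrite -[X in _ --> X](subr0 (0 : R)); apply: cvgB; last exact: Hc.
rewrite -[X in _ --> X](subr0 (0 : R)); apply: cvgB.
  exact: (prim_cvg0 (@bg_continuous R p a1 theta) (bg_bound hp hth hnu)).
rewrite -[X in _ --> X](mulr0 C); apply: cvgM; first exact: cvg_cst.
exact: (prim_cvg0 be_continuous be_bound).
Unshelve. all: by end_near. Qed.

(** Beyond 1 the density [be] is at most c^p t^(-1-c), which is integrable at infinity. *)
Lemma energy_bound : exists2 K : R, 0 < K & forall L, 1 <= L -> En L <= K.
Proof.
exists (En 1 + c `^ p * c^-1).
  by apply: addr_gt0 (En_gt0 ltr01) (mulr_gt0 (powR_gt0 _ c0) _); rewrite invr_gt0.
move=> L; rewrite le_eqVlt => /predU1P[<-|L1].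
  by rewrite lerDl; apply: mulr_ge0 (powR_ge0 _ _) _; rewrite invr_ge0 ltW.
rewrite -lerBlDl (primB be_continuous be_bound ler01 (ltW L1)).
have sub : `]1, L]%classic `<=` `](0 : R), L]%classic.
  by move=> z /=; rewrite !in_itv/= => /andP[z1 ->]; rewrite (lt_trans ltr01 z1).
have intb : mu.-integrable `]1, L]%classic (EFin \o be).
  apply: integrableS (prim_integrable be_continuous be_bound L); [exact: measurable_itv|exact: measurable_itv|exact: sub].
rewrite -lee_fin /Rintegral fineK; last by apply: integrable_fin_num => //; exact: measurable_itv.
rewrite -integral_itv_bndo_bndc; last first.
  apply: measurable_funS (measurable_itv _) _ (measurable_int _ intb).
  by apply: subset_itvl; rewrite bnd_simp.
have c1 : 1 < 1 + c by rewrite ltrDl.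
apply: (@le_trans _ _ ((c `^ p)%:E * \int[mu]_(r in `]1%R, L[) (r `^ (- (1 + c)))%:E)%E).
  have mpow : measurable_fun `]1, L[%classic (fun r : R => r `^ (- (1 + c))).
    by apply: measurable_funTS; exact: measurable_powR.
  rewrite -(int_scale (measurable_itv _) mpow (fun r _ => powR_ge0 r _) (powR_ge0 c p)).
  apply: int_le.
  - exact: measurable_itv.
  - apply/measurable_EFinP; apply: measurable_funS (measurable_itv _) _ (measurable_int _ intb).
    by apply: subset_itvl; rewrite bnd_simp.
  - by apply: measurable_funM; [exact: measurable_cst|exact: mpow].
  - move=> r /=; rewrite in_itv/= => /andP[r1 _]; exact: ltW (be_pos (lt_trans ltr01 r1)).
  - move=> r /=; rewrite in_itv/= => /andP[r1 _]; have r0 := lt_trans ltr01 r1.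
    rewrite /be; apply: ler_wpM2l; first exact: powR_ge0.
    rewrite bw_bW.
    have W1 := @bW_le_powR 1 r (introT andP (conj ler01 (lexx 1))) r0.
    have P0' := ltW (bP0 hp hN hnu).
    have := ge0_ler_powR P0' (ltW (bW_gt0 r) : _ \in Num.nneg) (powR_ge0 _ _ : _ \in Num.nneg) W1.
    rewrite -powRrM mul1r => WP.
    apply: le_trans (ler_wpM2l (powR_ge0 _ _) (ler_wpM2l (powR_ge0 _ _) WP)) _.
    rewrite -!powRD ?(gt_eqF r0) ?implybT// le_eqVlt; apply/orP; left; apply/eqP; congr powR.
    rewrite /pstar /bsigma /bnu -/N; field.
    by rewrite !gt_eqF.
apply: le_trans (lee_wpmul2l _ (int_powR_le c1 ltr01 L1)) _; first by rewrite lee_fin powR_ge0.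
by rewrite -EFinM lee_fin powR1 mul1r [1 + c]addrC addrK.
Qed.

End bliss_profile.

(** * Pointwise effect of the logarithmic factor *)

Section log_gain.
Context {R : realType}.
Implicit Types (P k tau y X Y : R).

(** Bernoulli's inequality for (X - Y)/X: the price of lowering the profile by [Y]. *)
Lemma bernoulli_sub P X Y : 1 < P -> 0 < X -> Y <= X ->
  X `^ P <= (X - Y) `^ P + P * Y * X `^ (P - 1).
Proof.
move=> P1 X0 YX.
have r0 : 0 <= (X - Y) / X by rewrite divr_ge0 ?subr_ge0// ltW.
have := bernoulli_powR r0 P1; rewrite -(ler_pM2l (powR_gt0 P X0)) -(powRM _ (ltW X0) r0).
rewrite mulrCA mulfV ?gt_eqF// mulr1.
rewrite (_ : X `^ P * _ = X `^ P - P * Y * X `^ (P - 1)); first by move=> h; rewrite -lerBlDr.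
have -> : X `^ P = X * X `^ (P - 1).
  transitivity (X `^ 1 * X `^ (P - 1)); last by rewrite (powRr1 (ltW X0)).
  by rewrite -powRD ?(gt_eqF X0) ?implybT//; congr powR; ring.
by field; rewrite gt_eqF.
Qed.

Lemma ln_add_ge (tau u a : R) : 1 <= tau -> 0 < a -> expR a <= u ->
  a <= `|ln (tau + `|u|)|.
Proof.
move=> t1 a0 au; have u0 : 0 < u := lt_le_trans (expR_gt0 a) au.
apply: le_trans (ler_norm _); rewrite -[leLHS]expRK gtr0_norm//.
have tau0 := le_trans ler01 t1.
by rewrite ler_ln ?posrE ?expR_gt0 ?ltr_wpDl// ler_wpDl.
Qed.

(** Where X - Y >= e the logarithm is at least 1 and does no harm. Elsewhere (X - Y)^P is at most
    e^(P(1-k)) X^(Pk), an error whose size is tuned by [k]. *)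
Lemma log_gain_weak P k tau y X Y : 1 < P -> 0 <= k <= 1 -> 1 <= tau -> 0 <= y ->
  0 < X -> Y <= X -> 0 <= Y ->
  X `^ P <= (X - Y) `^ P * `|ln (tau + `|X - Y|)| `^ y + P * Y * X `^ (P - 1)
    + expR 1 `^ (P * (1 - k)) * X `^ (P * k).
Proof.
move=> P1 /andP[k0 k1] t1 y0 X0 YX Y0; have P0 := ltW (lt_trans ltr01 P1).
apply: le_trans (bernoulli_sub P1 X0 YX) _.
rewrite -[leRHS]addrA [X in _ <= _ + X]addrC addrA lerD2r.
have u0 : 0 <= X - Y by rewrite subr_ge0.
have [ue|eu] := leP (expR 1) (X - Y).
  apply: ler_wpDr; first by rewrite mulr_ge0 ?powR_ge0.
  rewrite ler_peMr ?powR_ge0//.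
  have l1 := ln_add_ge t1 ltr01 ue.
  by rewrite -(powRr0 `|ln (tau + `|X - Y|)|) ler_powR.
apply: ler_wpDl; first by rewrite mulr_ge0 ?powR_ge0.
have [->|u1] := eqVneq (X - Y) 0.
  by rewrite powR0 ?mulr_ge0 ?powR_ge0// gt_eqF// (lt_trans ltr01).
have -> : (X - Y) `^ P = (X - Y) `^ (P * (1 - k)) * (X - Y) `^ (P * k).
  by rewrite -powRD ?u1 ?implybT//; congr powR; ring.
apply: ler_pM; rewrite ?powR_ge0//.
  have k10 : 0 <= 1 - k by rewrite subr_ge0.
  exact: (ge0_ler_powR (mulr_ge0 P0 k10) (u0 : _ \in Num.nneg) (expR_ge0 1 : _ \in Num.nneg) (ltW eu)).
apply: (ge0_ler_powR (mulr_ge0 P0 k0) (u0 : _ \in Num.nneg) (ltW X0 : _ \in Num.nneg)).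
by rewrite gerBl.
Qed.

(** Where X - Y >= exp(e) the logarithm is at least e, and its power [y] is at least e^y >= 1 +
    y. *)
Lemma log_gain_strong P tau y X Y : 1 < P -> 1 <= tau -> 0 <= y ->
  0 < X -> Y <= X -> expR (expR 1) <= X - Y ->
  X `^ P + (X - Y) `^ P * y <=
  (X - Y) `^ P * `|ln (tau + `|X - Y|)| `^ y + P * Y * X `^ (P - 1).
Proof.
move=> P1 t1 y0 X0 YX ue.
apply: le_trans (lerD (bernoulli_sub P1 X0 YX) (lexx _)) _.
rewrite addrAC lerD2r -{1}[(X - Y) `^ P]mulr1 -mulrDr ler_wpM2l ?powR_ge0//.
have l1 := ln_add_ge t1 (expR_gt0 1) ue.
apply: (@le_trans _ _ (expR 1 `^ y)).
  by rewrite powR_expR mul1r; exact: expR_ge1Dx.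
exact: (ge0_ler_powR y0 (expR_ge0 1 : _ \in Num.nneg) (normr_ge0 _ : _ \in Num.nneg) l1).
Qed.

End log_gain.

Section test_function.
Context {R : realType}.
Local Notation mu := (@lebesgue_measure R).
Local Notation I01 := (`](0 : R)%R, 1%R[%classic).
Context (p a0 a1 theta : R) (hp : 1 < p) (ha0 : 0 <= a0) (ha1 : 0 <= a1)
  (hN : 0 < a1 - p + 1) (ha01 : a1 - p <= a0) (hth : 0 <= theta) (hnu : a1 - p < theta).
Local Notation N := (bN p a1).
Local Notation W := (bW p a1 theta).
Local Notation dW := (bdW p a1 theta).
Local Notation En := (prim (be p a1 theta)).
Local Notation P := (pstar p a1 theta).
Local Notation w := (bw p a1 theta).
Local Notation M := (prim (bw p a1 theta)).
Implicit Types (L r : R).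

Let p0 : 0 < p. Proof. exact: bp0. Qed.

(** Normalises the gradient norm of [tfun L] to 1. That function is the extremal concentrated at
    scale 1/L and lowered so as to vanish at 1. *)
Definition tlam L : R := L `^ (N / p) * En L `^ (- p^-1).
Definition tfun L r : R := tlam L * (W (L * r) - W L).

Lemma En0 L : 0 < L -> 0 < En L. Proof. exact: En_gt0. Qed.

Lemma tlam_gt0 L : 0 < L -> 0 < tlam L.
Proof. by move=> L0; rewrite mulr_gt0 ?powR_gt0 ?En0. Qed.

Lemma tlam_powR L k : 0 < L -> tlam L `^ (p * k) = L `^ (N * k) * En L `^ (- k).
Proof.
move=> L0; rewrite /tlam powRM ?powR_ge0// -!powRrM; congr (_ `^ _ * _ `^ _).
  by field; rewrite gt_eqF.
by field; rewrite gt_eqF.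
Qed.

Lemma tfun_derive L r : 0 < L -> 0 < r ->
  is_derive r 1 (tfun L) (- (tlam L * (L * dW (L * r)))).
Proof.
move=> L0 r0.
have dL : is_derive r 1 (fun s => L * s) L.
  by have := is_deriveZ L (is_derive_id r (1 : R)); rewrite /GRing.scale/= mulr1; apply.
have d1 := is_derive1_comp (bW_derive hp hnu (mulr_gt0 L0 r0)) dL.
have d2 := is_deriveZ (tlam L) (is_deriveB d1 (is_derive_cst (W L) r (1 : R))).
apply: (is_derive_eq d2); rewrite subr0 /GRing.scale/=; ring.
Qed.

Lemma derive1_tfun L r : 0 < L -> 0 < r ->
  derive1 (tfun L) r = - (tlam L * (L * dW (L * r))).
Proof. by move=> L0 r0; have [_ e] := tfun_derive L0 r0; rewrite derive1E. Qed.

Lemma tfun_deriv_continuous L r : 0 < L -> 0 < r ->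
  {for r, continuous (fun r => - (tlam L * (L * dW (L * r))))}.
Proof.
move=> L0 r0; apply: cvgN; apply: cvgM; first exact: cvg_cst.
apply: cvgM; first exact: cvg_cst.
apply: (@continuous_comp _ _ _ (fun r => L * r) dW).
  by apply: cvgM; [exact: cvg_cst|exact: cvg_id].
by apply: bdW_continuous; rewrite mulr_gt0.
Qed.

Lemma tfun_AC L : 0 < L -> AC_loc01 (tfun L).
Proof.
move=> L0 a b a0' ab b1.
have d r : a <= r <= b -> is_derive r 1 (tfun L) (- (tlam L * (L * dW (L * r)))).
  by move=> /andP[ar _]; apply: tfun_derive; last exact: lt_le_trans ar.
have c : {within `[a, b], continuous (fun r => - (tlam L * (L * dW (L * r))))}.
  apply: continuous_in_subspaceT => r; rewrite inE/= in_itv/= => /andP[ar _].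
  by apply: tfun_deriv_continuous => //; exact: lt_le_trans ar.
have [K K0 HK] := C1_lipschitz d c.
apply: (@abs_continuous_comp _ a b a b K id (tfun L)) => //.
exact: abs_continuous_id.
Qed.

Lemma tfun_cvg1 L : 0 < L -> tfun L r @[r --> 1^'-] --> (0 : R).
Proof.
move=> L0; have z : tfun L 1 = 0 by rewrite /tfun mulr1 subrr mulr0.
rewrite -z; apply: cvg_at_left_filter.
have [d _] := tfun_derive L0 ltr01.
by move/derivable1_diffP : d => /differentiable_continuous.
Qed.

Lemma int_prim_scale L (phi K : R -> R) : 0 < L -> (forall x, 0 < x -> {for x, continuous phi}) ->
  (forall s t, 0 < s -> s <= t -> 0 <= phi s <= K t) ->
  (\int[mu]_(r in I01) (phi (L * r))%:E)%E = (prim phi L / L)%:E.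
Proof.
move=> L0 cphi phi_bnd; have := prim_scale L0 cphi phi_bnd ltr01; rewrite mulr1 => <-.
have cphiL x : 0 < x -> {for x, continuous (fun s => phi (L * s))}.
  move=> x0; apply: (@continuous_comp _ _ _ (fun r => L * r) phi).
    by apply: cvgM; [exact: cvg_cst|exact: cvg_id].
  by apply: cphi; rewrite mulr_gt0.
have bndL s r : 0 < s -> s <= r -> 0 <= phi (L * s) <= K (L * r).
  by move=> s0 sr; apply: phi_bnd; rewrite ?mulr_gt0// ler_pM2l.
by rewrite (prim_EFin cphiL bndL).
Qed.

Lemma tfun_wint L : 0 < L -> wint p a1 (derive1 (tfun L)) = 1%E.
Proof.
move=> L0; have l0 := tlam_gt0 L0; have E0 := En0 L0.
rewrite /wint; transitivity (\int[mu]_(r in I01) ((L / En L) * be p a1 theta (L * r))%:E)%E.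
  apply: eq_integral => r; rewrite inE/= in_itv/= => /andP[r0 _]; congr EFin.
  have dW0 : 0 <= dW (L * r) by exact: bdW_ge0.
  rewrite derive1_tfun// normrN (ger0_norm (mulr_ge0 (ltW l0) (mulr_ge0 (ltW L0) dW0))).
  rewrite -(bdW_powR hp hN hnu (mulr_gt0 L0 r0)) (powRM _ (ltW l0) (mulr_ge0 (ltW L0) dW0)) (powRM _ (ltW L0) dW0) (powRM _ (ltW L0) (ltW r0)).
  have := tlam_powR 1 L0; rewrite !mulr1 => ->.
  rewrite powRN (powRr1 (ltW E0)).
  have e : L `^ N * L `^ p = L * L `^ a1.
    transitivity (L `^ 1 * L `^ a1); last by rewrite (powRr1 (ltW L0)).
    by rewrite -!powRD ?(gt_eqF L0) ?implybT//; congr powR; rewrite /bN; ring.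
  transitivity ((L `^ N * L `^ p) / En L * (r `^ a1 * dW (L * r) `^ p)); first by ring.
  by rewrite e; ring.
have cbL (x : R) : 0 < x -> {for x, continuous (fun s => be p a1 theta (L * s))}.
  move=> x0; apply: (@continuous_comp _ _ _ (fun r => L * r) (be p a1 theta)).
    by apply: cvgM; [exact: cvg_cst|exact: cvg_id].
  by apply: be_continuous; rewrite mulr_gt0.
rewrite (@int_scale _ _ _ (fun r => be p a1 theta (L * r))).
- rewrite (int_prim_scale L0 (@be_continuous R p a1 theta) (be_bound hp hN hth hnu)) -EFinM.
  by congr EFin; field; rewrite (gt_eqF E0) (gt_eqF L0).
- exact: measurable_itv.
- apply: open_continuous_measurable_fun; first exact: interval_open.
  by move=> x; rewrite inE/= in_itv/= => /andP[x0 _]; exact: cbL.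
- move=> x /=; rewrite in_itv/= => /andP[x0 _]; apply: ltW.
  by apply: be_pos => //; exact: mulr_gt0.
- by rewrite divr_ge0 ?ltW.
Qed.

Lemma tfun_X1p L : 0 < L -> X1p p a0 a1 (tfun L).
Proof.
move=> L0; apply: (mem_X1p hp ha1 hN ha01); last exact: tfun_cvg1.
  exact: tfun_AC.
split; first by apply: AC_loc01_measurable_derive1; exact: tfun_AC.
by rewrite tfun_wint// ltry.
Qed.

Lemma tfun_grad_norm L : 0 < L -> grad_norm p a1 (tfun L) = 1%E.
Proof. by move=> L0; rewrite /grad_norm tfun_wint// poweR_EFin powR1. Qed.

End test_function.

Section powers.
Context {R : realType}.
Local Notation mu := (@lebesgue_measure R).
Local Notation I01 := (`](0 : R)%R, 1%R[%classic).

Lemma int_powR01 (e : R) : 0 < e -> (\int[mu]_(r in I01) (r `^ (e - 1))%:E <= (e^-1)%:E)%E.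
Proof.
move=> e0; apply: int_exhaust01.
- by apply: measurable_funTS; exact: measurable_powR.
- by move=> r _; exact: powR_ge0.
move=> x y x0 xy y1.
have dF (r : R) : 0 < r -> is_derive r 1 (e^-1 \*: (@powR R)^~ e) (r `^ (e - 1)).
  move=> r0; apply: (is_derive_eq (is_deriveZ e^-1 (is_derive1_powR e r0))).
  by rewrite /GRing.scale/=; field; rewrite gt_eqF.
have cF r : r \in `[x, y] -> derivable (e^-1 \*: (@powR R)^~ e) r 1.
  by rewrite in_itv/= => /andP[xr _]; have [] := dF r (lt_le_trans x0 xr).
apply: (@le_trans _ _ (\int[mu]_(r in `[x, y]) (r `^ (e - 1))%:E)%E).
  apply: int_subset => //; [|by move=> r _; exact: powR_ge0|exact: subset_itv_oc_cc].
  apply: subspace_continuous_measurable_fun => //.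
  exact: continuous_within_powR.
have := derivable_within_continuous cF => cwF.
rewrite (@continuous_FTC2 _ _ (e^-1 \*: (@powR R)^~ e))//.
- rewrite -EFinB lee_fin /= -[leRHS]mulr1 !/GRing.scale/= -mulrBr.
  rewrite ler_wpM2l ?invr_ge0 ?(ltW e0)//.
  apply: (@le_trans _ _ (y `^ e)); first by rewrite gerBl powR_ge0.
  have := ge0_ler_powR (ltW e0) (ltW (lt_trans x0 xy) : _ \in Num.nneg) (ler01 : _ \in Num.nneg) (ltW y1).
  by rewrite powR1.
- exact: continuous_within_powR.
- split.
  + by move=> r rxy; apply: cF; exact: subset_itv_oo_cc.
  + have /continuous_within_itvP[] := cwF; first exact: xy.
    by [].
  + have /continuous_within_itvP[] := cwF; first exact: xy.
    by [].
- move=> r; rewrite in_itv/= => /andP[xr _]; rewrite derive1E.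
  by have [_ ->] := dF r (lt_trans x0 xr).
Qed.

Lemma powR_near_large (s A : R) : 0 < s -> \forall L \near +oo%R, A < L `^ s.
Proof.
move=> s0; pose B := Num.max A 0 + 1.
have B0 : 0 < B by rewrite ltr_wpDl// le_max lexx orbT.
near=> L.
have LB : B `^ s^-1 < L by near: L; exact: nbhs_pinfty_gt.
have L0 := lt_trans (powR_gt0 s^-1 B0) LB.
have := gt0_ltr_powR s0 (powR_ge0 B s^-1 : _ \in Num.nneg) (ltW L0 : _ \in Num.nneg) LB.
rewrite -powRrM mulVf ?gt_eqF// (powRr1 (ltW B0)); apply: lt_trans.
by rewrite /B; apply: le_lt_trans (_ : A <= Num.max A 0) _; rewrite ?le_max ?lexx// ltrDl.
Unshelve. all: by end_near. Qed.

End powers.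

Section log_density.
Context {R : realType}.
Local Notation I01 := (`](0 : R)%R, 1%R[%classic).

Lemma measurable_fun_powR2 (D : set R) (f g : R -> R) : measurable D ->
  measurable_fun D f -> measurable_fun D g -> measurable_fun D (fun x => f x `^ g x).
Proof.
move=> mD mf mg; rewrite /powR; apply: measurable_fun_if => //.
- apply: measurable_fun_eqr => //; exact: measurable_cst.
- apply: measurable_funS (mD) _ _; first by move=> x [].
  apply: (@measurableT_comp _ _ _ _ _ _ (fun b : bool => b%:R : R)) => //.
  apply: measurable_fun_eqr => //; exact: measurable_cst.
- apply: measurable_funS (mD) _ _; first by move=> x [].
  apply: measurableT_comp; first exact: measurable_expR.
  apply: measurable_funM => //; apply: measurableT_comp => //; exact: measurable_ln.
Qed.

Definition ldens (p a1 theta tau beta : R) (u : R -> R) (r : R) : R :=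
  r `^ theta * `|u r| `^ pstar p a1 theta * `|ln (tau + `|u r|)| `^ (r `^ beta).

Lemma ldens_ge0 p a1 theta tau beta u r : 0 <= ldens p a1 theta tau beta u r.
Proof. by rewrite !mulr_ge0 ?powR_ge0. Qed.

Lemma ldens_measurable p a1 theta tau beta u : measurable_fun I01 u ->
  measurable_fun I01 (ldens p a1 theta tau beta u).
Proof.
move=> mu_; have mn : measurable_fun I01 (fun r => `|u r|).
  by exact: (measurableT_comp (@normr_measurable R setT) mu_).
apply: measurable_funM.
  apply: measurable_funM; first by apply: measurable_funTS; exact: measurable_powR.
  by apply: (measurableT_comp (measurable_powR _)).
apply: measurable_fun_powR2; first exact: measurable_itv.
  apply: (measurableT_comp (@normr_measurable R setT)).
  apply: measurableT_comp; first exact: measurable_ln.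
  by apply: measurable_funD => //; exact: measurable_cst.
by apply: measurable_funTS; exact: measurable_powR.
Qed.

End log_density.

(** * Gain and losses of the test function *)

Section exceed.
Context {R : realType}.
Local Notation mu := (@lebesgue_measure R).
Local Notation I01 := (`](0 : R)%R, 1%R[%classic).
Context (p a1 theta tau beta : R) (hp : 1 < p)
  (hN : 0 < a1 - p + 1) (hth : 0 <= theta) (hnu : a1 - p < theta)
  (htau : 1 <= tau) (hb : 0 < beta).
Local Notation N := (bN p a1).
Local Notation sigma := (bsigma p a1 theta).
Local Notation W := (bW p a1 theta).
Local Notation En := (prim (be p a1 theta)).
Local Notation P := (pstar p a1 theta).
Local Notation w := (bw p a1 theta).
Local Notation M := (prim (bw p a1 theta)).
Local Notation G := (prim (bg p a1 theta)).
Local Notation C := (bC p a1 theta).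
Local Notation lam := (tlam p a1 theta).
Local Notation c := (N / (p - 1)).
Local Notation D L := (En L `^ (- (P / p))).

Let p0 : 0 < p. Proof. exact: bp0. Qed.
Let p10 : 0 < p - 1. Proof. exact: bp10. Qed.
Let N0 : 0 < N. Proof. exact: hN. Qed.
Let th1 : 0 < theta + 1. Proof. exact: bth1. Qed.
Let P1 : 1 < P. Proof. exact: bP1. Qed.
Let P0 : 0 < P. Proof. exact: bP0. Qed.
Let c0 : 0 < c. Proof. exact: divr_gt0. Qed.
Let nu0 : 0 < bnu p a1 theta. Proof. exact: bnu0. Qed.
Let sigma0 : 0 < sigma. Proof. exact: bsigma0. Qed.

Section fixed_L.
Context (L : R) (L3 : 3 <= L).
Let L0 : 0 < L. Proof. by apply: lt_le_trans L3. Qed.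
Let l0 : 0 < lam L. Proof. exact: tlam_gt0. Qed.
Let E0 : 0 < En L. Proof. exact: En_gt0. Qed.

Lemma lam_P k : lam L `^ (P * k) = L `^ ((theta + 1) * k) * En L `^ (- (P / p * k)).
Proof.
have -> : P * k = p * (P / p * k) by field; rewrite gt_eqF.
rewrite tlam_powR//; congr (_ `^ _ * _).
by rewrite /pstar -/(bN p a1); field; rewrite !gt_eqF.
Qed.

(** Dilation invariance at the critical exponent: over (0,1) this term integrates to [D L * M L],
    which is at least [bS L] by [bS_le]. *)
Lemma main_term r : 0 < r -> r `^ theta * (lam L * W (L * r)) `^ P = D L * L * w (L * r).
Proof.
move=> r0; rewrite (powRM _ (ltW l0) (ltW (bW_gt0 _ _ _ _))) (bw_bW hN hnu) (powRM _ (ltW L0) (ltW r0)).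
have := lam_P 1; rewrite !mulr1 => ->.
have -> : L `^ (theta + 1) = L `^ theta * L.
  by rewrite powRD ?(gt_eqF L0) ?implybT// (powRr1 (ltW L0)).
by ring.
Qed.

(** W(L) is bounded with its full decay, and W(L r) with the interpolation exponent [k] for which k
    c (P-1) = theta + 1 - e. This leaves the barely integrable power r^(e-1) and a loss of order
    L^(-(c-e)). *)
Lemma bern_loss (e r : R) : 0 < e -> e < theta + 1 -> 0 < r ->
  r `^ theta * (P * (lam L * W L) * (lam L * W (L * r)) `^ (P - 1)) <=
  P * D L * L `^ (- (c - e)) * r `^ (e - 1).
Proof.
move=> e0 e1 r0; have W0 t := bW_gt0 p a1 theta t.
pose k := (theta + 1 - e) / (theta + 1 + sigma).
have ts0 : 0 < theta + 1 + sigma by rewrite addr_gt0.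
have k01 : 0 <= k <= 1.
  rewrite divr_ge0 ?subr_ge0 ?(ltW e1) ?(ltW ts0)//= ler_pdivrMr// mul1r.
  by move: e0 sigma0; lra.
have kc : k * c * (P - 1) = theta + 1 - e.
  have cs : c * (P - 1) = theta + 1 + sigma.
    rewrite /bsigma /bnu /pstar -/(bN p a1); field.
    by rewrite !gt_eqF.
  by rewrite -mulrA cs /k divfK// gt_eqF.
have lP : lam L `^ P = lam L * lam L `^ (P - 1).
  rewrite -{2}(powRr1 (ltW l0)) -powRD ?(gt_eqF l0) ?implybT//.
  by congr powR; ring.
have Lr0 : 0 < L * r by rewrite mulr_gt0.
have P10 : 0 <= P - 1 by rewrite subr_ge0 ltW.
have h1 : W L <= L `^ (- c).
  by have := @bW_le_powR _ _ _ _ hp hN hnu 1 L (introT andP (conj ler01 (lexx 1))) L0; rewrite mul1r.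
have h2 : W (L * r) `^ (P - 1) <= L `^ (- (theta + 1 - e)) * r `^ (- (theta + 1 - e)).
  have := bW_le_powR hp hN hnu k01 Lr0.
  move=> /(ge0_ler_powR P10 (ltW (W0 _) : _ \in Num.nneg) (powR_ge0 _ _ : _ \in Num.nneg)).
  by rewrite -powRrM mulNr kc -(powRM _ (ltW L0) (ltW r0)).
rewrite (powRM _ (ltW l0) (ltW (W0 _))).
apply: (@le_trans _ _ (r `^ theta * P * lam L `^ P * (W L * W (L * r) `^ (P - 1)))).
  by rewrite lP le_eqVlt; apply/orP; left; apply/eqP; ring.
have pos : 0 <= r `^ theta * P * lam L `^ P.
  exact: mulr_ge0 (mulr_ge0 (powR_ge0 _ _) (ltW P0)) (powR_ge0 _ _).
apply: le_trans (ler_wpM2l pos (ler_pM (ltW (W0 L)) (powR_ge0 _ _) h1 h2)) _.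
have := lam_P 1; rewrite !mulr1 => ->.
have eL : L `^ (theta + 1) * L `^ (- c) * L `^ (- (theta + 1 - e)) = L `^ (- (c - e)).
  by rewrite -!powRD ?(gt_eqF L0) ?implybT//; congr powR; ring.
have er : r `^ theta * r `^ (- (theta + 1 - e)) = r `^ (e - 1).
  by rewrite -powRD ?(gt_eqF r0) ?implybT//; congr powR; ring.
by rewrite -eL -er le_eqVlt; apply/orP; left; apply/eqP; ring.
Qed.

(** With x = (theta+1) k/(p-1) the loss is of order L^(-x), and the remaining power r^(theta - x p)
    is integrable when x < (theta+1)/p. *)
Lemma small_loss (K k r : R) : 0 <= k <= 1 -> En L <= K -> 0 < r ->
  r `^ theta * (expR 1 `^ (P * (1 - k)) * (lam L * W (L * r)) `^ (P * k)) <=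
  expR 1 `^ (P * (1 - k)) * K `^ (P / p * (1 - k)) * D L *
    L `^ (- ((theta + 1) * k / (p - 1))) * r `^ (theta + 1 - (theta + 1) * k / (p - 1) * p - 1).
Proof.
move=> /andP[k0 k1] EK r0; have W0 t := bW_gt0 p a1 theta t.
have Lr0 : 0 < L * r by rewrite mulr_gt0.
have Pk0 : 0 <= P * k := mulr_ge0 (ltW P0) k0.
pose x := (theta + 1) * k / (p - 1).
have h2 : W (L * r) `^ (P * k) <= L `^ (- (x * p)) * r `^ (- (x * p)).
  have := @bW_le_powR _ _ _ _ hp hN hnu 1 (L * r) (introT andP (conj ler01 (lexx 1))) Lr0.
  move=> /(ge0_ler_powR Pk0 (ltW (W0 _) : _ \in Num.nneg) (powR_ge0 _ _ : _ \in Num.nneg)).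
  rewrite -powRrM -(powRM _ (ltW L0) (ltW r0)) mul1r.
  rewrite (_ : - c * (P * k) = - (x * p))//.
  by rewrite /x /pstar -/(bN p a1); field; rewrite !gt_eqF.
have hE : En L `^ (- (P / p * k)) <= K `^ (P / p * (1 - k)) * D L.
  have -> : En L `^ (- (P / p * k)) = En L `^ (P / p * (1 - k)) * D L.
    by rewrite -powRD ?(gt_eqF E0) ?implybT//; congr powR; ring.
  apply: ler_wpM2r; first exact: powR_ge0.
  have ex : 0 <= P / p * (1 - k) by rewrite mulr_ge0 ?subr_ge0// divr_ge0 ?ltW.
  exact: (ge0_ler_powR ex (ltW E0 : _ \in Num.nneg) (le_trans (ltW E0) EK : _ \in Num.nneg) EK).
rewrite (powRM _ (ltW l0) (ltW (W0 _))) lam_P.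
set B := expR 1 `^ _.
have B0 : 0 <= B by exact: powR_ge0.
apply: (@le_trans _ _ (r `^ theta * B * L `^ ((theta + 1) * k) *
    ((K `^ (P / p * (1 - k)) * D L) * (L `^ (- (x * p)) * r `^ (- (x * p)))))).
  have pos : 0 <= r `^ theta * B * L `^ ((theta + 1) * k) by rewrite !mulr_ge0 ?powR_ge0.
  apply: le_trans (ler_wpM2l pos (ler_pM (powR_ge0 _ _) (powR_ge0 _ _) hE h2)).
  by rewrite le_eqVlt; apply/orP; left; apply/eqP; ring.
have eL : L `^ ((theta + 1) * k) * L `^ (- (x * p)) = L `^ (- x).
  rewrite -!powRD ?(gt_eqF L0) ?implybT//; congr powR.
  by rewrite /x; field; rewrite gt_eqF.
have er : r `^ theta * r `^ (- (x * p)) = r `^ (theta + 1 - x * p - 1).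
  by rewrite -powRD ?(gt_eqF r0) ?implybT//; congr powR; ring.
by rewrite -/x -eL -er le_eqVlt; apply/orP; left; apply/eqP; ring.
Qed.

(** On (1/L, 2/L) the argument of [W] stays below 2, while L >= 3; so the test function is at least
    lam (W 2 - W 3) there, and r^beta at least L^(-beta). *)
Lemma gain_term (r : R) : L^-1 < r -> r < 2 * L^-1 -> expR (expR 1) <= lam L * (W 2 - W 3) ->
  expR (expR 1) <= lam L * W (L * r) - lam L * W L /\
  D L * L * ((W 2 - W 3) `^ P * L `^ (- beta)) <=
    r `^ theta * ((lam L * W (L * r) - lam L * W L) `^ P * r `^ beta).
Proof.
move=> rL r2 big; have Li0 : 0 < L^-1 by rewrite invr_gt0.
have r0 := lt_trans Li0 rL.
have ltr0n3 : 0 < 3 :> R by [].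
have ltr0n2 : 0 < 2 :> R by [].
have lt23 : 2 < 3 :> R by rewrite ltr_nat.
have Lr2 : L * r < 2 by move: r2; rewrite ltr_pdivlMr// mulrC.
have W2 := bW_lt hp hN hnu (mulr_gt0 L0 r0) Lr2.
have W3 : W L <= W 3.
  have [h|h] := ltP 3 L; first exact: ltW (bW_lt hp hN hnu ltr0n3 h).
  have -> : L = 3 by apply/eqP; rewrite eq_le h L3.
  exact: lexx.
have h23 : W 3 < W 2 := bW_lt hp hN hnu ltr0n2 lt23.
have W23 : 0 < W 2 - W 3 by rewrite subr_gt0.
have ge : lam L * (W 2 - W 3) <= lam L * W (L * r) - lam L * W L.
  have h := lerB (ltW W2) W3.
  rewrite -(mulrBr (lam L) (W (L * r)) (W L)).
  exact: (ler_wpM2l (ltW l0) h).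
split; first exact: le_trans big ge.
have lW0 : 0 <= lam L * (W 2 - W 3) by exact: mulr_ge0 (ltW l0) (ltW W23).
have h1 := ge0_ler_powR (ltW P0) (lW0 : _ \in Num.nneg) (le_trans lW0 ge : _ \in Num.nneg) ge.
have h2 : L `^ (- beta) <= r `^ beta.
  have := ge0_ler_powR (ltW hb) (ltW Li0 : _ \in Num.nneg) (ltW r0 : _ \in Num.nneg) (ltW rL).
  by rewrite -(powR_inv1 (ltW L0)) -powRrM mulN1r.
have h3 : L `^ (- theta) <= r `^ theta.
  have := ge0_ler_powR hth (ltW Li0 : _ \in Num.nneg) (ltW r0 : _ \in Num.nneg) (ltW rL).
  by rewrite -(powR_inv1 (ltW L0)) -powRrM mulN1r.
apply: le_trans (ler_pM (powR_ge0 _ _) (mulr_ge0 (powR_ge0 _ _) (powR_ge0 _ _)) h3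
  (ler_pM (powR_ge0 _ _) (powR_ge0 _ _) h1 h2)).
rewrite (powRM _ (ltW l0) (ltW W23)).
have := lam_P 1; rewrite !mulr1 => ->.
have eL : L `^ (- theta) * L `^ (theta + 1) = L.
  by rewrite -powRD ?(gt_eqF L0) ?implybT// addKr (powRr1 (ltW L0)).
apply: (@le_trans _ _ (D L * (L `^ (- theta) * L `^ (theta + 1)) * ((W 2 - W 3) `^ P * L `^ (- beta)))).
  by rewrite eL.
set x := _ `^ P; set y := D L.
by rewrite le_eqVlt; apply/orP; left; apply/eqP; ring.
Qed.

End fixed_L.
End exceed.

Lemma ler_add_bool {R : realDomainType} (m g i l l' : R) (b : bool) :
  m <= i + l + l' -> (b -> m + g <= i + l) -> 0 <= l' -> m + g * b%:R <= i + l + l'.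
Proof.
case: b => h1 h2 h3; last by rewrite mulr0 addr0.
by rewrite mulr1; apply: ler_wpDr => //; exact: h2.
Qed.

Lemma ler_distr3 {R : realDomainType} (t x a b c y z : R) :
  x <= a + b + c -> 0 <= t -> t * b <= y -> t * c <= z -> t * x <= t * a + y + z.
Proof.
move=> h t0 hy hz; apply: le_trans (ler_wpM2l t0 h) _; rewrite !mulrDr.
by apply: lerD => //; exact: lerD.
Qed.

Lemma ler_distr2 {R : realDomainType} (t x a b g g' y : R) :
  x + g' <= a + b -> 0 <= t -> t * b <= y -> g <= t * g' -> t * x + g <= t * a + y.
Proof.
move=> h t0 hy hg; apply: le_trans (lerD (lexx _) hg) _; rewrite -mulrDr.
by apply: le_trans (ler_wpM2l t0 h) _; rewrite mulrDr lerD2l.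
Qed.

(** Each of the two losses is less than half the gain. *)
Lemma test_arith {R : realType} (L D e d q P B c beta x : R) : 0 < L -> 0 < D ->
  0 < e -> 0 < d -> 0 < q ->
  P / e * 2 / q < L `^ (c - e - beta) -> B / d * 2 / q < L `^ (x - beta) ->
  P * D * L `^ (- (c - e)) / e + B * D * L `^ (- x) / d < D * L * (q * L `^ (- beta)) / L.
Proof.
move=> L0 D0 e0 d0 q0.
have Lb0 := powR_gt0 (- beta) L0.
have -> : L `^ (- (c - e)) = L `^ (- beta) / L `^ (c - e - beta).
  by rewrite -powRN -powRD ?(gt_eqF L0) ?implybT//; congr powR; ring.
have -> : L `^ (- x) = L `^ (- beta) / L `^ (x - beta).
  by rewrite -powRN -powRD ?(gt_eqF L0) ?implybT//; congr powR; ring.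
move: (powR_gt0 (c - e - beta) L0) (powR_gt0 (x - beta) L0).
move: (L `^ (c - e - beta)) (L `^ (x - beta)) (L `^ (- beta)) Lb0 => s t l l0 s0 t0.
rewrite ltr_pdivrMr// -ltr_pdivrMl// => h1.
rewrite ltr_pdivrMr// -ltr_pdivrMl// => h2.
have -> : P * D * (l / s) / e + B * D * (l / t) / d =
   D * l * ((s^-1 * (P / e * 2)) + (t^-1 * (B / d * 2))) / 2.
  by field; rewrite !gt_eqF.
have -> : D * L * (q * l) / L = D * l * (q + q) / 2 by field; rewrite gt_eqF.
by rewrite ltr_pM2r ?invr_gt0// ltr_pM2l ?mulr_gt0// ltrD.
Qed.

Section integrated.
Context {R : realType}.
Local Notation mu := (@lebesgue_measure R).
Local Notation I01 := (`](0 : R)%R, 1%R[%classic).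
Context (p a1 theta tau beta : R) (hp : 1 < p)
  (hN : 0 < a1 - p + 1) (hth : 0 <= theta) (hnu : a1 - p < theta)
  (htau : 1 <= tau) (hb : 0 < beta).
Local Notation N := (bN p a1).
Local Notation W := (bW p a1 theta).
Local Notation En := (prim (be p a1 theta)).
Local Notation P := (pstar p a1 theta).
Local Notation w := (bw p a1 theta).
Local Notation M := (prim (bw p a1 theta)).
Local Notation G := (prim (bg p a1 theta)).
Local Notation C := (bC p a1 theta).
Local Notation lam := (tlam p a1 theta).
Local Notation c := (N / (p - 1)).
Local Notation D L := (En L `^ (- (P / p))).

Let p0 : 0 < p. Proof. exact: bp0. Qed.
Let P1 : 1 < P. Proof. exact: bP1. Qed.
Let P0 : 0 < P. Proof. exact: bP0. Qed.

Section fixed_L.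
Context (L K e k : R) (L3 : 3 <= L) (EK : En L <= K)
  (big : expR (expR 1) <= lam L * (W 2 - W 3))
  (e0 : 0 < e) (e1 : e < theta + 1) (k01 : 0 <= k <= 1)
  (d0 : 0 < theta + 1 - (theta + 1) * k / (p - 1) * p).
Let L0 : 0 < L. Proof. by apply: lt_le_trans L3. Qed.
Let l0 : 0 < lam L. Proof. exact: tlam_gt0. Qed.
Let E0 : 0 < En L. Proof. exact: En_gt0. Qed.
Local Notation A1 := (P * D L * L `^ (- (c - e))).
Local Notation A2 := (expR 1 `^ (P * (1 - k)) * K `^ (P / p * (1 - k)) * D L *
    L `^ (- ((theta + 1) * k / (p - 1)))).
Local Notation d := (theta + 1 - (theta + 1) * k / (p - 1) * p).
Local Notation g := (D L * L * ((W 2 - W 3) `^ P * L `^ (- beta))).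
Local Notation A := (`]L^-1, 2 * L^-1[%classic : set R).
Local Notation u := (tfun p a1 theta L).

Let A10 : 0 <= A1. Proof. exact: mulr_ge0 (mulr_ge0 (ltW P0) (powR_ge0 _ _)) (powR_ge0 _ _). Qed.
Let A20 : 0 <= A2.
Proof. exact: mulr_ge0 (mulr_ge0 (mulr_ge0 (powR_ge0 _ _) (powR_ge0 _ _)) (powR_ge0 _ _)) (powR_ge0 _ _). Qed.
Let DL0 : 0 <= D L * L. Proof. exact: mulr_ge0 (powR_ge0 _ _) (ltW L0). Qed.
Let g0 : 0 <= g. Proof. exact: mulr_ge0 DL0 (mulr_ge0 (powR_ge0 _ _) (powR_ge0 _ _)). Qed.

(** [log_gain_weak] everywhere, [log_gain_strong] on the interval [A]; the indicator records the
    extra gain. *)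
Lemma pointwise_gain r : 0 < r -> r < 1 ->
  D L * L * w (L * r) + g * \1_A r <=
  ldens p a1 theta tau beta u r + A1 * r `^ (e - 1) + A2 * r `^ (d - 1).
Proof.
move=> r0 r1.
pose X := lam L * W (L * r); pose Y := lam L * W L.
have X0 : 0 < X := mulr_gt0 l0 (bW_gt0 _ _ _ _).
have Y0 : 0 <= Y := ltW (mulr_gt0 l0 (bW_gt0 _ _ _ _)).
have Lr0 : 0 < L * r := mulr_gt0 L0 r0.
have YX : Y <= X.
  apply: (ler_wpM2l (ltW l0)); apply: ltW; apply: (bW_lt hp hN hnu Lr0).
  by rewrite gtr_pMr.
have uE : u r = X - Y by rewrite /tfun mulrBr.
have XY0 : 0 <= X - Y by rewrite subr_ge0.
have y0 : 0 <= r `^ beta := powR_ge0 _ _.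
have lE : ldens p a1 theta tau beta u r =
    r `^ theta * ((X - Y) `^ P * `|ln (tau + `|X - Y|)| `^ (r `^ beta)).
  by rewrite /ldens uE (ger0_norm XY0) mulrA.
have th0 : 0 <= r `^ theta := powR_ge0 _ _.
have b1 := bern_loss hp hN hth hnu L3 e0 e1 r0.
have b2 := small_loss hp hN hth hnu L3 k01 EK r0.
have w1 := log_gain_weak P1 k01 htau y0 X0 YX Y0.
have mE := main_term hp hN hth hnu L3 r0.
rewrite -mE lE indicE; apply: ler_add_bool.
- exact: ler_distr3 w1 th0 b1 b2.
- rewrite inE/= in_itv/= => /andP[rL r2].
  have [ue gt] := gain_term hp hN hth hnu hb L3 rL r2 big.
  exact: ler_distr2 (log_gain_strong P1 htau y0 X0 YX ue) th0 b1 gt.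
- exact: mulr_ge0 A20 (powR_ge0 _ _).
Qed.

Lemma integrated_gain :
  ((D L * M L + g / L)%:E <=
    log_functional p a1 theta tau beta u + (A1 / e + A2 / d)%:E)%E.
Proof.
have mA : measurable A by exact: measurable_itv.
have mI : measurable I01 by exact: measurable_itv.
have mi : measurable_fun I01 (\1_A : R -> R) by exact: measurable_indic.
have mw : measurable_fun I01 (fun r => w (L * r)).
  apply: open_continuous_measurable_fun; first exact: interval_open.
  move=> x; rewrite inE/= in_itv/= => /andP[x0 _].
  apply: (@continuous_comp _ _ _ (fun r => L * r) w).
    by apply: cvgM; [exact: cvg_cst|exact: cvg_id].
  by apply: bw_continuous; rewrite mulr_gt0.
have mg : measurable_fun I01 (fun r => g * \1_A r).
  by apply: measurable_funM; [exact: measurable_cst|exact: mi].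
have mDw : measurable_fun I01 (fun r => D L * L * w (L * r)).
  by apply: measurable_funM; [exact: measurable_cst|exact: mw].
have mp (x : R) : measurable_fun I01 (fun r => r `^ x).
  by apply: measurable_funTS; exact: measurable_powR.
have mpA (y x : R) : measurable_fun I01 (fun r => y * r `^ x).
  by apply: measurable_funM; [exact: measurable_cst|exact: mp].
have mu_ : measurable_fun I01 u := AC_loc01_measurable (tfun_AC hp hnu L0).
have ml := ldens_measurable p a1 theta tau beta mu_.
have i0 (x : R) : 0 <= \1_A x :> R by rewrite indicE.
have w0 r : I01 r -> 0 <= w (L * r) by move=> _; exact: bw_ge0.
have ew : (\int[mu]_(r in I01) (D L * L * w (L * r))%:E = (D L * M L)%:E)%E.
  rewrite (int_scale mI mw w0 DL0) (int_prim_scale L0 (@bw_continuous R p a1 theta) (bw_bound hp hth hnu)) -EFinM.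
  by congr EFin; field; rewrite gt_eqF.
have eg : (\int[mu]_(r in I01) (g * \1_A r)%:E = (g / L)%:E)%E.
  rewrite (int_scale mI mi (fun x _ => i0 x) g0) integral_indic// setIidl.
    have LL : L^-1 <= 2 * L^-1 by rewrite mulrDl mul1r lerDl invr_ge0 ltW.
    have mA' : mu A = (L^-1)%:E.
      by rewrite (mu_itv_oo LL); congr EFin; rewrite mulrDl mul1r addrK.
    transitivity (g%:E * mu A)%E; first by [].
    by rewrite mA' -EFinM.
  move=> z /=; rewrite !in_itv/= => /andP[z1 z2].
  rewrite (lt_trans _ z1) ?invr_gt0//=; apply: (lt_trans z2).
  by rewrite ltr_pdivrMr// mul1r; apply: lt_le_trans L3; rewrite ltr_nat.
have e1' : (\int[mu]_(r in I01) (A1 * r `^ (e - 1))%:E <= (A1 / e)%:E)%E.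
  rewrite (int_scale mI (mp _) (fun r _ => powR_ge0 r _) A10).
  exact: (lee_wpmul2l (A10 : (0 <= A1%:E)%E) (int_powR01 e0)).
have e2' : (\int[mu]_(r in I01) (A2 * r `^ (d - 1))%:E <= (A2 / d)%:E)%E.
  rewrite (int_scale mI (mp _) (fun r _ => powR_ge0 r _) A20).
  exact: (lee_wpmul2l (A20 : (0 <= A2%:E)%E) (int_powR01 d0)).
have Dw0 r : I01 r -> 0 <= D L * L * w (L * r) by move=> /w0; exact: mulr_ge0.
have gi0 r : I01 r -> 0 <= g * \1_A r by move=> _; exact: mulr_ge0 g0 (i0 r).
have p1 r : I01 r -> 0 <= A1 * r `^ (e - 1) by move=> _; exact: mulr_ge0 A10 (powR_ge0 _ _).
have p2 r : I01 r -> 0 <= A2 * r `^ (d - 1) by move=> _; exact: mulr_ge0 A20 (powR_ge0 _ _).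
have l0' r : I01 r -> 0 <= ldens p a1 theta tau beta u r by move=> _; exact: ldens_ge0.
rewrite EFinD -ew -eg -(int_add mI mDw mg Dw0 gi0).
apply: (@le_trans _ _ (\int[mu]_(r in I01)
   (ldens p a1 theta tau beta u r + A1 * r `^ (e - 1) + A2 * r `^ (d - 1))%:E)%E).
  apply: int_le.
  - exact: mI.
  - exact: measurable_funD mDw mg.
  - exact: measurable_funD (measurable_funD ml (mpA _ _)) (mpA _ _).
  - by move=> r Ir; exact: addr_ge0 (Dw0 r Ir) (gi0 r Ir).
  - by move=> r /=; rewrite in_itv/= => /andP[r0 r1]; exact: pointwise_gain.
rewrite (int_add mI (measurable_funD ml (mpA _ _)) (mpA _ _)
  (fun r Ir => addr_ge0 (l0' r Ir) (p1 r Ir)) p2).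
rewrite (int_add mI ml (mpA _ _) l0' p1) EFinD [leRHS]addeA.
exact: leeD (leeD (lexx _) e1') e2'.
Qed.

End fixed_L.

Lemma bS_le L : 0 < L -> bS p a1 theta L <= D L * M L.
Proof.
move=> L0; have GL0 := G_gt0 hp hth hnu L0; have E0 := En_gt0 hp hN hth hnu L0.
have C0 := bC_gt0 hp hN hth.
rewrite /bS mulrC; apply: ler_wpM2r; first exact: ltW (M_gt0 hp hth hnu L0).
have -> : D L = (En L)^-1 `^ (P / p) by rewrite -(powR_inv1 (ltW E0)) -powRrM mulN1r.
have Pp0 : 0 <= P / p := divr_ge0 (ltW P0) (ltW p0).
have CG0 : 0 <= C / G L := divr_ge0 (ltW C0) (ltW GL0).
have Ei0 : 0 <= (En L)^-1 by rewrite invr_ge0 ltW.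
apply: (ge0_ler_powR Pp0 (CG0 : _ \in Num.nneg) (Ei0 : _ \in Num.nneg)).
by rewrite ler_pdivrMr// mulrC ler_pdivlMr//; exact: energy_le.
Qed.

(** The gain is of order L^(-beta), the losses of orders L^(-(c-e)) and L^(-x). The two bounds on
    beta leave room for beta < c - e with e > 0 and for beta < x < (theta+1)/p. *)
Lemma tfun_exceeds : beta < Num.min ((theta + 1) / p) c ->
  exists2 L, 0 < L & ((bS p a1 theta L)%:E < log_functional p a1 theta tau beta (tfun p a1 theta L))%E.
Proof.
rewrite lt_min => /andP[b1 b2].
have th1 : 0 < theta + 1 := bth1 hth.
have p10 : 0 < p - 1 := bp10 hp.
have N0 : 0 < N := hN.
have [K K0 HK] := energy_bound hp hN hth hnu.
(* A decay rate between [beta] and the integrability threshold; [k] below is the interpolation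
   exponent that realises it in [small_loss]. *)
pose x := (beta + (theta + 1) / p) / 2.
have [bx x1] : beta < x /\ x < (theta + 1) / p by have [] := midf_lt b1.
clearbody x.
have xp : 0 < theta + 1 - x * p by rewrite subr_gt0 -ltr_pdivlMr.
pose k := x * (p - 1) / (theta + 1).
have kx : (theta + 1) * k / (p - 1) = x by rewrite /k; field; rewrite !gt_eqF.
have x0 : 0 < x := lt_trans hb bx.
have k01 : 0 <= k <= 1.
  apply/andP; split; first exact: divr_ge0 (mulr_ge0 (ltW x0) (ltW p10)) (ltW th1).
  rewrite /k ler_pdivrMr// mul1r.
  apply: (@le_trans _ _ (x * p)); last by move: xp; rewrite subr_gt0 => /ltW.
  by apply: (ler_wpM2l (ltW x0)); rewrite gerBl.
pose e := Num.min (c - beta) 1 / 2.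
have m0 : 0 < Num.min (c - beta) 1 by rewrite lt_min subr_gt0 b2 ltr01.
have e0 : 0 < e by rewrite divr_gt0.
have em : e < Num.min (c - beta) 1 by rewrite ltr_pdivrMr// ltr_pMr// ltr1n.
have ec : e < c - beta by apply: lt_le_trans em _; rewrite ge_min lexx.
have e1 : e < theta + 1.
  apply: (@lt_le_trans _ _ 1); last by rewrite lerDr.
  by apply: lt_le_trans em _; rewrite ge_min lexx orbT.
pose q := W 2 - W 3.
have q0 : 0 < q.
  have h2 : 0 < 2 :> R by []. have h3 : 2 < 3 :> R by rewrite ltr_nat.
  have h23 : W 3 < W 2 := bW_lt hp hN hnu h2 h3.
  by rewrite subr_gt0.
have qP0 : 0 < q `^ P := powR_gt0 _ q0.
pose B := expR 1 `^ (P * (1 - k)) * K `^ (P / p * (1 - k)).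
have Kp0 : 0 < K `^ (- p^-1) := powR_gt0 _ K0.
have Np0 : 0 < N / p := divr_gt0 N0 p0.
have s10 : 0 < c - e - beta by move: ec; lra.
have s20 : 0 < x - beta by rewrite subr_gt0.
near (+oo%R : set_system R) => L.
have L3 : 3 <= L by near: L; exact: nbhs_pinfty_ge.
have L0 : 0 < L by apply: lt_le_trans L3.
have c1 : expR (expR 1) / (K `^ (- p^-1) * q) < L `^ (N / p) by near: L; exact: powR_near_large.
have c2 : P / e * 2 / q `^ P < L `^ (c - e - beta) by near: L; exact: powR_near_large.
have c3 : B / (theta + 1 - x * p) * 2 / q `^ P < L `^ (x - beta) by near: L; exact: powR_near_large.
exists L => //.
have L1 : 1 <= L by apply: le_trans L3; rewrite ler1n.
have EK := HK L L1.
have E0 := En_gt0 hp hN hth hnu L0.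
have big : expR (expR 1) <= lam L * (W 2 - W 3).
  rewrite -/q; move: c1; rewrite ltr_pdivrMr ?mulr_gt0// mulrA => /ltW/le_trans; apply.
  apply: (ler_wpM2r (ltW q0)); rewrite /tlam; apply: (ler_wpM2l (powR_ge0 _ _)).
  rewrite !powRN lef_pV2 ?posrE ?powR_gt0//.
  have pi0 : 0 <= p^-1 by rewrite invr_ge0 ltW.
  exact: (ge0_ler_powR pi0 (ltW E0 : _ \in Num.nneg) (ltW K0 : _ \in Num.nneg) EK).
have d0 : 0 < theta + 1 - (theta + 1) * k / (p - 1) * p by rewrite kx.
have main := integrated_gain L3 EK big e0 e1 k01 d0.
have small : P * D L * L `^ (- (c - e)) / e +
   expR 1 `^ (P * (1 - k)) * K `^ (P / p * (1 - k)) * D L * L `^ (- ((theta + 1) * k / (p - 1)))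
     / (theta + 1 - (theta + 1) * k / (p - 1) * p) <
   D L * L * ((W 2 - W 3) `^ P * L `^ (- beta)) / L.
  rewrite kx -/B -/q.
  exact: (test_arith L0 (powR_gt0 _ E0) e0 xp qP0 c2 c3).
rewrite ltNge; apply/negP => le.
have := le_trans main (leeD le (lexx _)).
rewrite -EFinD lee_fin; apply/negP; rewrite -ltNge.
exact: ler_ltD (bS_le L0) small.
Unshelve. all: by end_near. Qed.

End integrated.

(** * Lower semicontinuity of the energy *)

Section shift_and_fatou.
Context {R : realType}.
Local Notation mu := (@lebesgue_measure R).
Implicit Types (D : set R) (G : R -> R).

Lemma lebesgue_measure_shift (h : R) (A : set R) : measurable A ->
  mu A = mu ((fun x => x + h) @^-1` A).
Proof.
move=> mA.
have mh : @measurable_fun _ _ (measurableTypeR R) (measurableTypeR R) setT (fun x : R => x + h).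
  by apply: measurable_funD; [exact: measurable_id|exact: measurable_cst].
pose mh_mix := isMeasurableFun.Build _ _ _ _ _ mh.
pose mhp : {mfun (measurableTypeR R) >-> (measurableTypeR R)} := HB.pack (fun x : R => x + h) mh_mix.
apply: (@lebesgue_measure_unique R (pushforward mu mhp)) => //.
move=> _ [[x y] _ <-] /=; rewrite /pushforward.
have -> : mhp @^-1` `]x, y]%classic = `]x - h, y - h]%classic.
  by apply/seteqP; split => z /=; rewrite !in_itv/= ltrBlDr lerBrDr.
have [xy|yx] := leP x y.
  by rewrite !mu_itv_oc ?lerB//; congr EFin; ring.
by rewrite !set_itv_ge ?measure0// bnd_simp -leNgt ?ltW// ltrD2r.
Qed.

Lemma int_shift (h a b : R) G : measurable_fun [set: R] G -> (forall x, 0 <= G x) ->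
  (\int[mu]_(x in `]a, b[) (G (x + h))%:E = \int[mu]_(x in `](a + h)%R, (b + h)%R[) (G x)%:E)%E.
Proof.
move=> mG G0.
have mh : @measurable_fun _ _ (measurableTypeR R) (measurableTypeR R) setT (fun x : R => x + h).
  by apply: measurable_funD; [exact: measurable_id|exact: measurable_cst].
have mEG : measurable_fun `](a + h)%R, (b + h)%R[%classic (EFin \o G).
  by apply/measurable_EFinP; exact: measurable_funTS.
have G0' : {in `](a + h)%R, (b + h)%R[%classic, forall y, (0 <= (EFin \o G) y)%E}.
  by move=> y _ /=; rewrite lee_fin.
have := @ge0_integral_pushforward _ _ (measurableTypeR R) (measurableTypeR R) R _ mh mu _ _ (measurable_itv _) mEG G0'.
have -> : (fun x => x + h) @^-1` `](a + h)%R, (b + h)%R[%classic = `]a, b[%classic.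
  by apply/seteqP; split => z /=; rewrite !in_itv/= !ltrD2r.
move=> <-.
by apply: eq_measure_integral => A mA _; exact: (esym (lebesgue_measure_shift h mA)).
Qed.

(** Fatou's lemma, with the lower limit unfolded into an eventual strict inequality. *)
Lemma int_fatou_near D (F_ : nat -> R -> R) G (c : \bar R) : measurable D ->
  (forall n, measurable_fun D (F_ n)) -> measurable_fun D G ->
  (forall n x, D x -> 0 <= F_ n x) ->
  {ae mu, forall x, D x -> F_ n x @[n --> \oo] --> G x} ->
  (c < \int[mu]_(x in D) (G x)%:E)%E ->
  \forall n \near \oo, (c < \int[mu]_(x in D) (F_ n x)%:E)%E.
Proof.
move=> mD mF mG F0 FG cG.
have mF' n : measurable_fun D (fun x => (F_ n x)%:E) by exact/measurable_EFinP.
have F0' n x : D x -> (0 <= (F_ n x)%:E)%E by move=> Dx; rewrite lee_fin F0.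
have fat := fatou mu mD mF' F0'.
have e : (\int[mu]_(x in D) (G x)%:E = \int[mu]_(x in D) limn_einf (fun n => (F_ n x)%:E))%E.
  apply: ae_eq_integral => //.
  - exact/measurable_EFinP.
  - have mN n : measurable_fun D (fun x => - (F_ n x)%:E)%E.
      exact: (measurableT_comp (@oppe_measurable R setT) (mF' n)).
    exact: (measurableT_comp (@oppe_measurable R setT) (measurable_fun_limn_esup mN)).
  - apply: (@filterS _ _ (ae_filter_ringOfSetsType mu)) FG => x H Dx.
    have cv : ((F_ n x)%:E @[n --> \oo] --> (G x)%:E)%E.
      by apply/fine_cvgP; split; [exact: nearW|exact: H Dx].
    rewrite is_cvg_limn_einfE; last by apply/cvg_ex; eexists; exact: cv.
    by apply/esym/cvg_lim.
have : (c < limn_einf (fun n => \int[mu]_(x in D) (F_ n x)%:E))%E.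
  by apply: lt_le_trans fat; rewrite -e.
set u := (fun n => _); rewrite limn_einf_lim (cvg_lim _ (ereal_nondecreasing_cvgn (nondecreasing_einfs u)))//.
move=> /ereal_sup_gt[_ [N _ <-] cN]; exists N => // n /= Nn.
by apply: lt_le_trans cN _; apply: ereal_inf_lbound; exists n.
Qed.

End shift_and_fatou.

(** A convex power lies above its tangent at [m]. *)
Lemma tangent_powR {R : realType} (p x m : R) : 1 < p -> 0 <= x -> 0 <= m ->
  p * m `^ (p - 1) * x <= x `^ p + (p - 1) * m `^ p.
Proof.
move=> p1 x0; have p0 : 0 < p := lt_trans ltr01 p1.
have p10 : 0 < p - 1 by rewrite subr_gt0.
rewrite le_eqVlt => /predU1P[<-|m0].
  by rewrite !powR0 ?gt_eqF// !(mulr0, mul0r) addr0 powR_ge0.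
have xm : 0 <= x / m by rewrite divr_ge0// ltW.
have := ler_wpM2l (powR_ge0 m p) (bernoulli_powR xm p1).
rewrite -(powRM _ (ltW m0) xm) (mulrCA m) mulfV ?gt_eqF// mulr1 => h.
rewrite -lerBlDr; apply: le_trans h.
have -> : m `^ p = m * m `^ (p - 1).
  transitivity (m `^ 1 * m `^ (p - 1)); last by rewrite (powRr1 (ltW m0)).
  by rewrite -powRD ?(gt_eqF m0) ?implybT//; congr powR; ring.
by rewrite le_eqVlt; apply/orP; left; apply/eqP; field; rewrite gt_eqF.
Qed.

Lemma slope_arith {R : realFieldType} (p T q m s y h : R) : 0 < h -> q * m = s ->
  p * T * q * (m * h) <= y + (p - 1) * (T * s) * h -> T * s <= y / h.
Proof.
move=> h0 <- H; rewrite ler_pdivlMr//; move: H.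
have -> : p * T * q * (m * h) = p * (T * (q * m) * h) by ring.
have -> : (p - 1) * (T * (q * m)) * h = p * (T * (q * m) * h) - T * (q * m) * h by ring.
lra.
Qed.

Section energy_tail.
Context {R : realType}.
Local Notation mu := (@lebesgue_measure R).
Local Notation I01 := (`](0 : R)%R, 1%R[%classic).
Context (p a1 : R) (hp : 1 < p) (ha1 : 0 <= a1) (f : R -> R) (hf : wL p a1 f).
Local Notation dens := (fun r : R => r `^ a1 * `|f r| `^ p).

Let p0 : 0 < p. Proof. exact: lt_trans ltr01 hp. Qed.
Let p10 : 0 < p - 1. Proof. by rewrite subr_gt0. Qed.

(** The energy beyond [x]. The maximum with 0 makes it nonincreasing on the whole line, hence
    measurable and free to be translated. *)
Definition etail (x : R) : R :=
  fine (\int[mu]_(r in `](Num.max 0 x)%R, 1%R[) (r `^ a1 * `|f r| `^ p)%:E).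

Let max_sub (x : R) : `](Num.max 0 x), 1%R[%classic `<=` I01.
Proof. by move=> z /=; rewrite !in_itv/= gt_max => /andP[/andP[-> _] ->]. Qed.

Let mdens : measurable_fun I01 dens.
Proof. exact: wdens_measurable hf.1. Qed.

Lemma etailE x : (etail x)%:E = (\int[mu]_(r in `](Num.max 0 x)%R, 1%R[) (dens r)%:E)%E.
Proof.
rewrite /etail fineK// ge0_fin_numE; last by apply: int_ge0 => r _; exact: wdens_ge0.
apply: (@le_lt_trans _ _ (wint p a1 f)); last exact: hf.2.
by apply: (int_dens_le hf); [exact: measurable_itv|exact: max_sub].
Qed.

Lemma etail_ge0 x : 0 <= etail x.
Proof. by rewrite -lee_fin etailE; apply: int_ge0 => r _; exact: wdens_ge0. Qed.

Lemma etail_nonincreasing x y : x <= y -> etail y <= etail x.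
Proof.
move=> xy; rewrite -lee_fin !etailE; apply: int_subset.
- exact: measurable_itv.
- exact: measurable_itv.
- exact: measurable_funS (measurable_itv _) (@max_sub x) mdens.
- by move=> r _; exact: wdens_ge0.
- move=> z /=; rewrite !in_itv/= !gt_max => /andP[/andP[-> yz] ->].
  by rewrite (le_lt_trans xy yz).
Qed.

Lemma etail_split x y : 0 < x -> x <= y -> y < 1 ->
  (etail x - etail y)%:E = (\int[mu]_(r in `]x, y]) (dens r)%:E)%E.
Proof.
move=> x0 xy y1; have y0 := lt_le_trans x0 xy.
have mx : measurable_fun `]x, 1[%classic dens.
  apply: measurable_funS (measurable_itv _) _ mdens => z /=.
  by rewrite !in_itv/= => /andP[xz ->]; rewrite (lt_trans x0 xz).
have := etailE x; rewrite (max_r (ltW x0)) => ex.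
have := etailE y; rewrite (max_r (ltW y0)) => ey.
rewrite EFinB ex ey.
have U : `]x, 1[%classic = `]x, y]%classic `|` `]y, 1[%classic.
  by rewrite -itv_bndbnd_setU// bnd_simp// ltW.
rewrite [in LHS]U ge0_integral_setU//=.
- rewrite -ey addeK//.
- by apply/measurable_EFinP; rewrite -U.
- by move=> z _; rewrite lee_fin; exact: wdens_ge0.
- apply/disj_set2P; apply/seteqP; split => z //= []; rewrite !in_itv/= => /andP[_ zy] /andP[yz _].
  by move: (le_lt_trans zy yz); rewrite ltxx.
Qed.

(** Jensen's inequality on [r, r + h], by integrating the tangent inequality at the mean slope [m].
    The weight can be frozen at [r] because r^a1 is nondecreasing. *)
Lemma tail_slope_le (r h : R) : 0 < r -> 0 < h -> r + h < 1 ->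
  r `^ a1 * `|(tail f r - tail f (r + h)) / h| `^ p <= (etail r - etail (r + h)) / h.
Proof.
move=> r0 h0 rh1; have rrh : r <= r + h by rewrite lerDl ltW.
have ti := tail_le hp ha1 hf r0 rrh rh1.
pose m := (tail f r - tail f (r + h)) / h.
have m0 : 0 <= m by rewrite divr_ge0 ?(ltW h0)// subr_ge0.
rewrite ger0_norm// -/m.
have sub : `]r, (r + h)]%classic `<=` I01.
  by move=> z /=; rewrite !in_itv/= => /andP[rz zh]; rewrite (lt_trans r0 rz) (le_lt_trans zh rh1).
have mI : measurable (`]r, (r + h)]%classic : set R) by exact: measurable_itv.
have md := measurable_funS (measurable_itv _) sub mdens.
have mf := measurable_funS (measurable_itv _) sub hf.1.
have mn : measurable_fun `]r, (r + h)]%classic (fun x => `|f x|).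
  exact: (measurableT_comp (@normr_measurable R setT) mf).
pose T := r `^ a1; rewrite -/T; have T0 : 0 <= T by exact: powR_ge0.
have k0 : 0 <= p * T * m `^ (p - 1) := mulr_ge0 (mulr_ge0 (ltW p0) T0) (powR_ge0 _ _).
have c0 : 0 <= (p - 1) * (T * m `^ p) := mulr_ge0 (ltW p10) (mulr_ge0 T0 (powR_ge0 _ _)).
have main : (\int[mu]_(x in `]r, (r + h)%R]) (p * T * m `^ (p - 1) * `|f x|)%:E <=
    \int[mu]_(x in `]r, (r + h)%R]) (dens x + (p - 1) * (T * m `^ p))%:E)%E.
  apply: int_le.
  - exact: mI.
  - by apply: measurable_funM; [exact: measurable_cst|exact: mn].
  - by apply: measurable_funD; [exact: md|exact: measurable_cst].
  - by move=> x _; exact: mulr_ge0 k0 (normr_ge0 _).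
  - move=> x /=; rewrite in_itv/= => /andP[rx _].
    have := ler_wpM2l T0 (tangent_powR hp (normr_ge0 (f x)) m0).
    have Tx : T * `|f x| `^ p <= dens x.
      apply: ler_wpM2r; first exact: powR_ge0.
      exact: (ge0_ler_powR ha1 (ltW r0 : _ \in Num.nneg) (ltW (lt_trans r0 rx) : _ \in Num.nneg) (ltW rx)).
    rewrite mulrDr (_ : T * (p * _ * _) = p * T * m `^ (p - 1) * `|f x|); last by ring.
    rewrite (_ : T * ((p - 1) * _) = (p - 1) * (T * m `^ p)); last by ring.
    by move/le_trans; apply; rewrite lerD2r.
move: main; rewrite (int_scale mI mn (fun x _ => normr_ge0 (f x)) k0).
rewrite (int_add mI md (measurable_cst _) (fun x _ => wdens_ge0 p a1 f x) (fun _ _ => c0)).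
rewrite -(tail_splitE hp ha1 hf r0 rrh rh1) -(etail_split r0 rrh rh1) int_cst// mu_itv_oc//.
rewrite -!EFinM -EFinD lee_fin (_ : r + h - r = h); last by ring.
have -> : tail f r - tail f (r + h) = m * h by rewrite /m divfK// gt_eqF.
move=> H; apply: (slope_arith h0 _ H).
have [->|mn0] := eqVneq m 0; first by rewrite !powR0 ?mulr0// gt_eqF.
transitivity (m `^ (p - 1) * m `^ 1); first by rewrite (powRr1 m0).
by rewrite -powRD ?mn0 ?implybT//; congr powR; ring.
Qed.

End energy_tail.

Opaque etail.

Section lower_semicontinuity.
Context {R : realType}.
Local Notation mu := (@lebesgue_measure R).
Local Notation I01 := (`](0 : R)%R, 1%R[%classic).
Context (p a1 : R) (hp : 1 < p) (ha1 : 0 <= a1).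

Let p0 : 0 < p. Proof. exact: lt_trans ltr01 hp. Qed.

(** A translation makes the integral telescope: what remains is at most the mean over (d, d + h] of
    a nonincreasing function. *)
Lemma etail_shift_int (f : R -> R) (hf : wL p a1 f) (d b h : R) :
  0 < d -> d < b -> 0 < h ->
  (\int[mu]_(r in `]d, b[) ((etail p a1 f r - etail p a1 f (r + h)) / h)%:E
    <= (etail p a1 f d)%:E)%E.
Proof.
move=> d0 db h0; set Q := etail p a1 f.
have Qni x y : x <= y -> Q y <= Q x := etail_nonincreasing hf (x := x) (y := y).
have Q0 x : 0 <= Q x := etail_ge0 hf x.
have mQ : measurable_fun [set: R] Q by apply: nonincreasing_measurable => // x y; exact: Qni.
have mQh : measurable_fun [set: R] (fun r => Q (r + h)).
  by apply: nonincreasing_measurable => // x y xy; apply: Qni; rewrite lerD2r.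
have mI (x y : R) : measurable (`]x, y[%classic : set R) by exact: measurable_itv.
have mIc (x y : R) : measurable (`]x, y]%classic : set R) by exact: measurable_itv.
have mD : measurable_fun `]d, b[%classic (fun r => Q r - Q (r + h)).
  by apply: measurable_funTS; exact: measurable_funB.
have D0 (x : R) : 0 <= Q x - Q (x + h) by rewrite subr_ge0; apply: Qni; rewrite lerDl ltW.
have hV : 0 <= h^-1 by rewrite invr_ge0 ltW.
have fin : (\int[mu]_(r in `]d, b[) (Q (r + h))%:E \is a fin_num)%E.
  rewrite ge0_fin_numE; last by apply: int_ge0.
  apply: (@le_lt_trans _ _ (\int[mu]_(r in `]d, b[) (Q d)%:E)%E).
    apply: int_le.
    - exact: mI.
    - exact: measurable_funTS mQh.
    - exact: measurable_cst.
    - by move=> x _; exact: Q0.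
    - move=> x /=; rewrite in_itv/= => /andP[dx _]; apply: Qni.
      by rewrite (le_trans (ltW dx))// lerDl ltW.
  by rewrite int_cst// (mu_itv_oo (ltW db)) -EFinM ltry.
have H : (\int[mu]_(r in `]d, b[) (Q r - Q (r + h))%:E <= (Q d * h)%:E)%E.
  rewrite -(leeD2rE _ _ fin).
  rewrite -(int_add (mI d b) mD (measurable_funTS mQh) (fun x _ => D0 x) (fun x _ => Q0 (x + h))).
  under eq_integral do rewrite subrK.
  rewrite (@int_shift _ h d b Q mQ Q0).
  have ddh : d <= d + h by rewrite lerDl ltW.
  have mu1 : mu `]d, (d + h)]%classic = h%:E.
    by rewrite (mu_itv_oc ddh); congr EFin; ring.
  apply: (@le_trans _ _ (\int[mu]_(r in `]d, (b + h)%R[) (Q r)%:E)%E).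
    apply: int_subset.
    - exact: mI.
    - exact: mI.
    - exact: measurable_funTS mQ.
    - by move=> x _; exact: Q0.
    - by apply: subset_itvl; rewrite bnd_simp lerDl ltW.
  have U : `]d, b + h[%classic = `]d, d + h]%classic `|` `]d + h, b + h[%classic.
    by rewrite -itv_bndbnd_setU// bnd_simp ?ltrD2r ?lerDl// ltW.
  rewrite U ge0_integral_setU//=.
  - apply: leeD; last exact: lexx.
    rewrite EFinM -mu1 -(int_cst _ (mIc _ _)).
    apply: int_le.
    + exact: mIc.
    + exact: measurable_funTS mQ.
    + exact: measurable_cst.
    + by move=> x _; exact: Q0.
    + by move=> x /=; rewrite in_itv/= => /andP[dx _]; apply: Qni; exact: ltW.
  - exact/measurable_EFinP/measurable_funTS.
  - by move=> z _; rewrite lee_fin.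
  - apply/disj_set2P; apply/seteqP; split => z //= []; rewrite !in_itv/= => /andP[_ zy] /andP[yz _].
    by move: (le_lt_trans zy yz); rewrite ltxx.
have := lee_wpmul2l (hV : (0 <= h^-1%:E)%E) H.
rewrite -(int_scale (mI d b) mD (fun x _ => D0 x) hV) -EFinM (_ : h^-1 * (Q d * h) = Q d); last first.
  by field; rewrite gt_eqF.
by move/(le_trans _); apply; rewrite le_eqVlt; apply/orP; left; apply/eqP; apply: eq_integral => r _; rewrite mulrC.
Qed.

Lemma diff_quotient_measurable (w : R -> R) (d b h : R) : AC_loc01 w ->
  0 < d -> b < 1 -> 0 < h -> b + h < 1 ->
  measurable_fun `]d, b[%classic (fun r => r `^ a1 * `|(w r - w (r + h)) / h| `^ p).
Proof.
move=> acw d0 b1 h0 bh.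
apply: (@wdens_measurable _ p a1 (fun r => (w r - w (r + h)) / h)).
apply: open_continuous_measurable_fun; first exact: interval_open.
move=> x; rewrite inE/= in_itv/= => /andP[dx xb].
have x0 := lt_trans d0 dx; have x1 := lt_trans xb b1.
apply: cvgM; last exact: cvg_cst.
apply: cvgB; first by apply: (AC_loc01_continuous acw); rewrite x0.
apply: (@continuous_comp _ _ _ (fun r => r + h) w).
  by apply: cvgD; [exact: cvg_id|exact: cvg_cst].
apply: (AC_loc01_continuous acw).
by rewrite (lt_trans x0) ?ltrDl//= (lt_trans _ bh)// ltrD2r.
Qed.

Lemma diff_quotient_cvg (w : R -> R) (x : R) (h_ : nat -> R) : derivable w x 1 ->
  (forall n, 0 < h_ n) -> h_ n @[n --> \oo] --> (0 : R) ->
  `|(w x - w (x + h_ n)) / h_ n| @[n --> \oo] --> `|derive1 w x|.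
Proof.
move=> dw h0 hc.
have hd : h_ n @[n --> \oo] --> (0 : R)^'.
  move=> A [e /= e0 H]; have /cvgrPdist_lt/(_ e e0) := hc.
  apply: filterS => n hn; apply: H => //=.
  by apply/eqP => hn0; have := h0 n; rewrite hn0 ltxx.
have := cvg_comp _ _ hd dw; rewrite -[lim _]/('D_1 w x) -derive1E => H.
have -> : (fun n => `|(w x - w (x + h_ n)) / h_ n|) =
    (fun n => `|((fun h => h^-1 *: ((w \o shift x) (h *: 1) - w x)) \o h_) n|).
  apply/funext => n /=; rewrite /GRing.scale/= mulr1 (addrC (h_ n)) -normrN.
  by congr (`|_|); ring.
exact: cvg_norm H.
Qed.

Lemma cvg_powR_ge0 (v_ : nat -> R) (v : R) (q : R) : 0 < q -> (forall n, 0 <= v_ n) -> 0 <= v ->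
  v_ n @[n --> \oo] --> v -> v_ n `^ q @[n --> \oo] --> v `^ q.
Proof.
move=> q0 v_0 v0 vc.
have -> : (fun n => v_ n `^ q) = (pospow q) \o v_.
  by apply/funext => n /=; rewrite pospowE.
rewrite -(pospowE q0 v0); apply: cvg_comp vc _; exact: continuous_pospow.
Qed.

(** Difference quotients require only pointwise convergence. Fatou's lemma for steps tending to 0
    gives one step at which the quotients of [u] already exceed [c]; Fatou's lemma in [n] passes
    this on to the tails, whose quotients are bounded by [tail_slope_le] and [etail_shift_int]. *)
Lemma tail_energy_lsc (f_ : nat -> R -> R) (u : R -> R) (d b : R) (c : \bar R) :
  (forall n, wL p a1 (f_ n)) -> AC_loc01 u ->
  (forall r, 0 < r < 1 -> tail (f_ n) r @[n --> \oo] --> u r) ->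
  0 < d -> d < b -> b < 1 ->
  (c < \int[mu]_(r in `]d, b[) (r `^ a1 * `|derive1 u r| `^ p)%:E)%E ->
  \forall n \near \oo, (c < (etail p a1 (f_ n) d)%:E)%E.
Proof.
move=> wf acu vu d0 db b1 cI.
have sub : `]d, b[%classic `<=` I01.
  by move=> z /=; rewrite !in_itv/= => /andP[dz zb]; rewrite (lt_trans d0 dz) (lt_trans zb b1).
have mI : measurable (`]d, b[%classic : set R) by exact: measurable_itv.
pose h_ (m : nat) : R := (1 - b) * m.+2%:R^-1.
have h0 m : 0 < h_ m by rewrite mulr_gt0 ?subr_gt0.
have hb m : b + h_ m < 1.
  by rewrite -ltrBrDl /h_ gtr_pMr ?subr_gt0// invf_lt1// ltr1n.
have hc : h_ m @[m --> \oo] --> (0 : R).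
  rewrite -[X in _ --> X](mulr0 (1 - b)); apply: cvgM; first exact: cvg_cst.
  have := @cvg_harmonic R; rewrite -(cvg_shiftS) /=; exact.
have := int_fatou_near (F_ := fun m r => r `^ a1 * `|(u r - u (r + h_ m)) / h_ m| `^ p) mI
  (fun m => diff_quotient_measurable acu d0 b1 (h0 m) (hb m))
  (wdens_measurable p a1 (measurable_funS (measurable_itv _) sub (AC_loc01_measurable_derive1 acu)))
  (fun m r _ => mulr_ge0 (powR_ge0 _ _) (powR_ge0 _ _)) _ cI.
have ae1 : {ae mu, forall x, `]d, b[%classic x ->
    x `^ a1 * `|(u x - u (x + h_ n)) / h_ n| `^ p @[n --> \oo] --> x `^ a1 * `|derive1 u x| `^ p}.
  apply: (@filterS _ _ (ae_filter_ringOfSetsType mu)) (AC_loc01_derivable acu) => x H Dx.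
  have := sub _ Dx; rewrite /= in_itv/= => /H dx.
  apply: cvgM; first exact: cvg_cst.
  apply: (cvg_powR_ge0 p0 (fun n => normr_ge0 _) (normr_ge0 _)).
  exact: (diff_quotient_cvg dx h0 hc).
move=> /(_ ae1) /filter_ex[m]; set h := h_ m => cm.
have := int_fatou_near (F_ := fun n r => r `^ a1 * `|(tail (f_ n) r - tail (f_ n) (r + h)) / h| `^ p) mI
  (fun n => diff_quotient_measurable (tail_AC hp ha1 (wf n)) d0 b1 (h0 m) (hb m))
  (diff_quotient_measurable acu d0 b1 (h0 m) (hb m))
  (fun n r _ => mulr_ge0 (powR_ge0 _ _) (powR_ge0 _ _)) _ cm.
have ae2 : {ae mu, forall x, `]d, b[%classic x ->
    x `^ a1 * `|(tail (f_ n) x - tail (f_ n) (x + h)) / h| `^ p @[n --> \oo] -->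
    x `^ a1 * `|(u x - u (x + h)) / h| `^ p}.
  apply: aeW => x Dx; have := Dx; rewrite /= in_itv/= => /andP[dx xb].
  have x01 : 0 < x < 1 by rewrite (lt_trans d0 dx) (lt_trans xb b1).
  have xh01 : 0 < x + h < 1.
    rewrite (lt_trans (lt_trans d0 dx)) ?ltrDl ?h0//=.
    by apply: lt_trans (hb m); rewrite ltrD2r.
  apply: cvgM; first exact: cvg_cst.
  apply: (cvg_powR_ge0 p0 (fun n => normr_ge0 _) (normr_ge0 _)); apply: cvg_norm.
  by apply: cvgM; [apply: cvgB; exact: vu|exact: cvg_cst].
move=> /(_ ae2); apply: filterS => n /lt_le_trans; apply.
apply: le_trans (etail_shift_int (wf n) d0 db (h0 m)).
apply: int_le.
- exact: mI.
- exact: (diff_quotient_measurable (tail_AC hp ha1 (wf n)) d0 b1 (h0 m) (hb m)).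
- have Qni x y : x <= y -> etail p a1 (f_ n) y <= etail p a1 (f_ n) x := etail_nonincreasing (wf n) (x := x) (y := y).
  apply: measurable_funTS; apply: measurable_funM; last exact: measurable_cst.
  apply: measurable_funB; apply: nonincreasing_measurable => // x y xy; apply: Qni => //.
  by rewrite lerD2r.
- by move=> r _; exact: mulr_ge0 (powR_ge0 _ _) (powR_ge0 _ _).
- move=> r /=; rewrite in_itv/= => /andP[dr rb]; apply: (tail_slope_le hp ha1 (wf n)).
  + exact: lt_trans dr.
  + exact: h0.
  + by apply: lt_trans (hb m); rewrite ltrD2r.
Qed.

End lower_semicontinuity.

(** * Extraction of a limit profile *)

Lemma meets_forall {T : Type} {F G : set_system T} {m : nat} (P : 'I_m -> set T) (A : set T) :
  F `#` G -> Filter G -> F A -> (forall i, G (P i)) -> exists2 x, A x & forall i, P i x.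
Proof.
move=> FG fG FA GP; have [x [Ax Px]] := FG _ _ FA (filter_forall fG GP).
by exists x.
Qed.

(* Tychonoff's theorem yields a pointwise cluster point of the sequence. *)
Lemma pointwise_cluster {R : realType} (g : nat -> R -> R) (B : R -> R) :
  (forall n x, 0 <= g n x <= B x) ->
  exists c : R -> R, forall (k m : nat) (y : 'I_m -> R) (e : R), 0 < e ->
    exists2 n : nat, (k <= n)%N & forall i, `|c (y i) - g n (y i)| < e.
Proof.
move=> gB.
have cpt := @tychonoff R (fun _ => R) (fun x => `[0, B x]%classic) (fun x => segment_compact (a := 0) (b := B x)).
have [|c [_ cl]] := cpt (g @ \oo) _.
  by exists 0%N => // n _ x /=; rewrite in_itv/=; exact: gB.
exists c => k m y e e0.
have FA : (g @ \oo) [set g n | n in [set n | (k <= n)%N]].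
  by exists k => // n /= kn; exists n.
have H i := @proj_continuous R (fun _ => R) (y i) c _ (nbhsx_ballx (c (y i)) e e0).
have [_ [n kn <-] Hn] := meets_forall cl (nbhs_filter _) FA H.
by exists n => // i; exact: (Hn i).
Qed.

Lemma half_le {R : realFieldType} (x y z : R) : z < x / 2 -> x < y + z -> x / 2 <= y.
Proof. lra. Qed.

Section extraction.
Context {R : realType}.
Local Notation mu := (@lebesgue_measure R).
Local Notation I01 := (`](0 : R)%R, 1%R[%classic).
Context (p a1 : R) (hp : 1 < p) (ha1 : 0 <= a1) (hN : 0 < a1 - p + 1)
  (f_ : nat -> R -> R) (wf : forall n, wL p a1 (f_ n)) (nf : forall n, wint p a1 (f_ n) = 1%E).
Implicit Types (a x y eta : R).

Definition growth_const : R := 1 + (p - 1) / (a1 - p + 1).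
Local Notation K := growth_const.

Lemma growth_const_ge1 : 1 <= K.
Proof. by rewrite lerDl divr_ge0// ?ltW// subr_gt0. Qed.

Lemma unit_tail_growth n x : 0 < x -> x < 1 ->
  tail (f_ n) x <= K * x `^ (- ((a1 - p + 1) / p)).
Proof. by move=> x0 x1; have := tail_growth hp ha1 hN (wf n) x0 x1; rewrite nf. Qed.

Lemma unit_tail_dist n a x y eta : 0 < a -> a <= x -> x <= y -> y < 1 -> 0 < eta ->
  `|tail (f_ n) y - tail (f_ n) x| <= eta + modulus_const p a1 a eta * (y - x).
Proof.
move=> a0 ax xy y1 e0; rewrite -lee_fin.
apply: le_trans (tail_dist_le hp ha1 (wf n) a0 ax xy y1 e0) _.
have I1 : (\int[mu]_(t in `]x, y[) (t `^ a1 * `|f_ n t| `^ p)%:E <= 1)%E.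
  rewrite -(nf n); apply: (int_dens_le (wf n)); first exact: measurable_itv.
  by move=> z /=; rewrite !in_itv/= => /andP[xz zy]; rewrite (lt_trans (lt_le_trans a0 ax) xz) (lt_trans zy).
rewrite EFinD; apply: leeD; last exact: lexx.
by have := lee_wpmul2l (ltW e0 : (0 <= eta%:E)%E) I1; rewrite mule1.
Qed.

(* On compact subintervals the functions [tail (f_ n)] share a modulus of
   continuity, so convergence on the grids [i / k.+1] suffices. *)
Lemma tail_extraction : exists (phi : nat -> nat) (c : R -> R),
  (forall k, (k <= phi k)%N) /\
  forall x, 0 < x < 1 -> tail (f_ (phi k)) x @[k --> \oo] --> c x.
Proof.
pose g n x := if 0 < x < 1 then tail (f_ n) x else 0.
pose B x := if 0 < x < 1 then K * x `^ (- ((a1 - p + 1) / p)) else 0.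
have gB n x : 0 <= g n x <= B x.
  rewrite /g /B; case: ifPn => [/andP[x0 x1]|_]; last by rewrite lexx.
  by rewrite tail_ge0; exact: unit_tail_growth.
have [c cl] := pointwise_cluster gB.
have gE n x : 0 < x < 1 -> g n x = tail (f_ n) x by rewrite /g => ->.
(* The cluster point inherits the common modulus: some index is close to it at [x] and [y]
   simultaneously. *)
have ceq a x y eta : 0 < a -> a <= x -> x <= y -> y < 1 -> 0 < eta ->
    `|c y - c x| <= eta + modulus_const p a1 a eta * (y - x).
  move=> a0 ax xy y1 eta0; apply/ler_addgt0Pr => e e0.
  have e2 : 0 < e / 2 by rewrite divr_gt0.
  have [n _ H] := cl 0%N 2%N (fun i => if i == ord0 then x else y) (e / 2) e2.
  have x0 := lt_le_trans a0 ax; have y0 := lt_le_trans x0 xy; have x1 := le_lt_trans xy y1.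
  have := H ord0; have := H ord_max; rewrite /= !gE ?x0 ?y0//.
  have := unit_tail_dist n a0 ax xy y1 eta0.
  rewrite !ler_norml !ltr_norml; move: (_ + _) => z.
  by move=> /andP[? ?] /andP[? ?] /andP[? ?]; apply/andP; split; lra.
have e_ k : 0 < k.+1%:R^-1 :> R by rewrite invr_gt0.
(* The cluster property handles finitely many points at once, here a whole grid. *)
have sel k : exists n, (k <= n)%N /\ forall i : 'I_k.+1, `|c (i%:R / k.+1%:R) - g n (i%:R / k.+1%:R)| < k.+1%:R^-1.
  by have [n kn H] := cl k k.+1 (fun i => i%:R / k.+1%:R) _ (e_ k); exists n.
have [phi Hphi] := choice sel.
exists phi, c; split; first by move=> k; have [] := Hphi k.
move=> x /andP[x0 x1]; apply/cvgrPdist_lt => e e0.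
pose a := x / 2; have a0 : 0 < a by rewrite divr_gt0.
have ax : a < x by rewrite ltr_pdivrMr// ltr_pMr// ltr1n.
pose eta := e / 8; have eta0 : 0 < eta by rewrite divr_gt0.
pose C := modulus_const p a1 a eta; have C0 : 0 <= C by exact: modulus_const_ge0.
have C10 : 0 < C + 1 by rewrite ltr_wpDl.
have small (s : R) : 0 < s -> \forall k \near \oo, k.+1%:R^-1 < s.
  move=> s0; have := @cvg_harmonic R => /cvgrPdist_lt/(_ _ s0).
  by apply: filterS => k; rewrite /= sub0r normrN ger0_norm// ltW.
near=> k; have ek := e_ k.
have k1 : k.+1%:R^-1 < a by near: k; exact: small.
have k2 : k.+1%:R^-1 < eta / (C + 1).
  by near: k; apply: small; rewrite divr_gt0.
have k3 : k.+1%:R^-1 < eta by near: k; exact: small.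
pose i := Num.truncn (x * k.+1%:R).
have k0 : 0 < k.+1%:R :> R by [].
have /andP[i1 i2] := truncn_itv (ltW (mulr_gt0 x0 k0)).
have ik : (i < k.+1)%N.
  by rewrite -(ltr_nat R); apply: le_lt_trans i1 _; rewrite gtr_pMl.
pose y : R := i%:R / k.+1%:R.
have yx : y <= x by rewrite ler_pdivrMr.
have xy : x < y + k.+1%:R^-1.
  by rewrite /y -[X in _ < _ + X]mul1r -mulrDl ltr_pdivlMr// natr1.
have ay : a <= y := half_le k1 xy.
have y0 := lt_le_trans a0 ay; have y1 := le_lt_trans yx x1.
have Hy : `|c y - tail (f_ (phi k)) y| < k.+1%:R^-1.
  by have := (Hphi k).2 (Ordinal ik); rewrite /= -/y gE// y0 y1.
have mod : eta + C * (x - y) <= eta + eta.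
  rewrite lerD2l; apply: (@le_trans _ _ ((C + 1) * k.+1%:R^-1)).
    by apply: ler_pM => //; rewrite ?subr_ge0 ?lerDl// lerBlDl ltW.
  by move: (ltW k2); rewrite ler_pdivlMr// mulrC.
have d1 := le_trans (ceq a y x eta a0 ay yx x1 eta0) mod.
have d2 := le_trans (unit_tail_dist (phi k) a0 ay yx x1 eta0) mod.
move: d1 d2 Hy k3; rewrite /eta; move: (k.+1%:R^-1) => z.
rewrite !ler_norml !ltr_norml => /andP[? ?] /andP[? ?] /andP[? ?] ?.
by apply/andP; split; lra.
Unshelve. all: by end_near. Qed.

End extraction.

(** * Properties of the limit profile *)

Section limit_profile.
Context {R : realType}.
Context (p a1 : R) (hp : 1 < p) (ha1 : 0 <= a1) (hN : 0 < a1 - p + 1)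
  (f_ : nat -> R -> R) (wf : forall n, wL p a1 (f_ n)) (nf : forall n, wint p a1 (f_ n) = 1%E)
  (c : R -> R) (fc : forall x, 0 < x < 1 -> tail (f_ n) x @[n --> \oo] --> c x).
Implicit Types (a x y eta : R).

Lemma limit_ge0 x : 0 < x < 1 -> 0 <= c x.
Proof.
move=> x01; rewrite -(cvg_lim _ (fc x01))//; apply: limr_ge.
  by apply/cvg_ex; eexists; exact: fc.
by apply: nearW => n; exact: tail_ge0.
Qed.

Lemma limit_growth x : 0 < x < 1 -> c x <= growth_const p a1 * x `^ (- ((a1 - p + 1) / p)).
Proof.
move=> x01; rewrite -(cvg_lim _ (fc x01))//; apply: limr_le.
  by apply/cvg_ex; eexists; exact: fc.
apply: nearW => n; have /andP[x0 x1] := x01.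
exact: unit_tail_growth.
Qed.

Lemma limit_nonincreasing x y : 0 < x -> x <= y -> y < 1 -> c y <= c x.
Proof.
move=> x0 xy y1.
have x01 : 0 < x < 1 by rewrite x0 (le_lt_trans xy y1).
have y01 : 0 < y < 1 by rewrite y1 (lt_le_trans x0 xy).
rewrite -(cvg_lim _ (fc x01))// -(cvg_lim _ (fc y01))//; apply: ler_lim.
- by apply/cvg_ex; eexists; exact: fc.
- by apply/cvg_ex; eexists; exact: fc.
- by apply: nearW => n; exact: (tail_le hp ha1 (wf n)).
Qed.

(** [sum_tail_dist_le] bounds each finite sum uniformly in the index, so the bound survives the
    pointwise limit. *)
Lemma limit_AC : AC_loc01 c.
Proof.
move=> a b a0 ab b1 e e0.
pose eta := e / 4; have eta0 : 0 < eta by rewrite divr_gt0.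
pose C := modulus_const p a1 a eta; have C0 : 0 <= C by exact: modulus_const_ge0.
have C10 : 0 < C + 1 by rewrite ltr_wpDl.
exists (e / 4 / (C + 1)); first by rewrite !divr_gt0.
move=> n x y xy tI d.
apply: (@le_lt_trans _ _ (e / 2)); last by rewrite ltr_pdivrMr// ltr_pMr// ltr1n.
have cv : \sum_(i < n) `|tail (f_ k) (y i) - tail (f_ k) (x i)| @[k --> \oo] -->
    \sum_(i < n) `|c (y i) - c (x i)|.
  apply: cvg_big => [|i _]; first exact: add_continuous.
  apply: cvg_norm; have [ax [xyi yb]] := xy i.
  have xi0 := lt_le_trans a0 ax; have yi1 := le_lt_trans yb b1.
  by apply: cvgB; apply: fc; [rewrite yi1 (lt_le_trans xi0 xyi)|rewrite xi0 (le_lt_trans xyi yi1)].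
rewrite -(cvg_lim _ cv)//; apply: limr_le; first by apply/cvg_ex; eexists; exact: cv.
apply: nearW => k.
have := sum_tail_dist_le hp ha1 (wf k) a0 b1 eta0 xy tI; rewrite nf mulr1 => /le_trans; apply.
have -> : e / 2 = eta + e / 4 by rewrite /eta; field.
rewrite lerD2l; apply: (@le_trans _ _ ((C + 1) * \sum_(i < n) (y i - x i))).
  apply: ler_wpM2r; last by rewrite lerDl.
  by apply: sumr_ge0 => i _; rewrite subr_ge0; have [_ []] := xy i.
by move: (ltW d); rewrite ler_pdivlMr// mulrC.
Qed.

(** The common modulus of continuity holds up to the end point 1, where every tail vanishes. *)
Lemma limit_vanish : c r @[r --> 1^'-] --> (0 : R).
Proof.
apply/cvgrPdist_lt => e e0.
pose eta := e / 4; have eta0 : 0 < eta by rewrite divr_gt0.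
pose C := modulus_const p a1 2^-1 eta; have C0 : 0 <= C by exact: modulus_const_ge0.
have C10 : 0 < C + 1 by rewrite ltr_wpDl.
have h0 : 0 < 2^-1 :> R by [].
have s0 : 0 < e / 4 / (C + 1) by rewrite !divr_gt0.
near=> x.
have x1 : x < 1 by near: x; exact: nbhs_left_lt.
have x2 : 2^-1 < x by near: x; apply: nbhs_left_gt; rewrite invf_lt1// ltr1n.
have xs : 1 - x < e / 4 / (C + 1).
  by rewrite ltrBlDl -ltrBlDr; near: x; apply: nbhs_left_gt; rewrite ltrBlDr ltrDl.
have x01 : 0 < x < 1 by rewrite x1 (lt_trans h0 x2).
rewrite sub0r normrN ger0_norm; last exact: limit_ge0.
apply: (@le_lt_trans _ _ (3 * (e / 4))); last by rewrite -subr_gt0 (_ : e - _ = e / 4) ?divr_gt0//; field.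
rewrite -(cvg_lim _ (fc x01))//; apply: limr_le.
  by apply/cvg_ex; eexists; exact: fc.
apply: nearW => n.
have /cvgrPdist_lt/(_ _ eta0) nearn := tail_cvg1 hp ha1 (wf n).
have [y [xy y1 ty]] : exists y, [/\ x <= y, y < 1 & tail (f_ n) y < eta].
  near (1 : R)^'- => y; exists y; split.
  - by near: y; exact: nbhs_left_ge.
  - by near: y; exact: nbhs_left_lt.
  - have : `|0 - tail (f_ n) y| < eta by near: y.
    by rewrite sub0r normrN ger0_norm ?tail_ge0.
have := unit_tail_dist hp ha1 wf nf n h0 (ltW x2) xy y1 eta0.
rewrite -/C ler_norml => /andP[H _].
have h3 : C * (y - x) <= e / 4.
  apply: (@le_trans _ _ ((C + 1) * (1 - x))).
    by apply: ler_pM => //; rewrite ?subr_ge0 ?lerDl// lerD2r ltW.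
  by move: (ltW xs); rewrite ler_pdivlMr// mulrC.
move: H h3 ty; rewrite /eta; move: (C * _) (tail _ _) (tail _ _) => z t t'; lra.
Unshelve. all: by end_near. Qed.

End limit_profile.

(** * The logarithmic factor near the origin *)

Section log_factor.
Context {R : realType}.
Implicit Types (p theta tau beta K a u r : R).

Lemma ln_le_id (x : R) : 1 <= x -> ln x <= x.
Proof.
move=> x1; have x0 := lt_le_trans ltr01 x1.
by rewrite -ler_expR lnK ?posrE//; apply: le_trans (expR_ge1Dx x); rewrite lerDr.
Qed.

Definition log_const tau beta K a : R := ln (tau + K) + 2 * a / beta.

Lemma log_const_ge0 tau beta K a : 1 <= tau -> 0 < beta -> 1 <= K -> 0 <= a ->
  0 <= log_const tau beta K a.
Proof.
move=> t1 b0 K1 a0; apply: addr_ge0; last by rewrite divr_ge0 ?mulr_ge0// ltW.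
by apply: ln_ge0; apply: le_trans t1 _; rewrite lerDl (le_trans ler01).
Qed.

Lemma log_factor_le tau beta K a u r : 1 <= tau -> 0 < beta -> 1 <= K -> 0 <= a ->
  0 < r -> r < 1 -> `|u| <= K * r `^ (- a) ->
  `|ln (tau + `|u|)| `^ (r `^ beta) <= expR (log_const tau beta K a * r `^ (beta / 2)).
Proof.
move=> t1 b0 K1 a0 r0 r1 uK.
have lr0 : ln r <= 0 by rewrite ln_le0// ltW.
have ra1 : 1 <= r `^ (- a).
  by rewrite /powR gt_eqF// -expR0 ler_expR mulNr oppr_ge0 mulr_ge0_le0.
have x1 : 1 <= tau + `|u| by apply: le_trans t1 _; rewrite lerDl.
have tK1 : 1 <= tau + K by apply: le_trans t1 _; rewrite lerDl (le_trans ler01).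
have tK0 : 0 < tau + K := lt_le_trans ltr01 tK1.
have ra0 : 0 < r `^ (- a) := powR_gt0 _ r0.
have xZ : `|ln (tau + `|u|)| <= (tau + K) * r `^ (- a).
  rewrite ger0_norm ?ln_ge0//; apply: le_trans (ln_le_id x1) _.
  rewrite mulrDl; apply: lerD => //.
  by rewrite ler_peMr// (le_trans ler01).
have y0 : 0 <= r `^ beta := powR_ge0 _ _.
have Z0 : 0 <= (tau + K) * r `^ (- a) := mulr_ge0 (ltW tK0) (ltW ra0).
apply: le_trans (ge0_ler_powR y0 (normr_ge0 _ : _ \in Num.nneg) (Z0 : _ \in Num.nneg) xZ) _.
have -> : ((tau + K) * r `^ (- a)) `^ (r `^ beta) =
    expR (r `^ beta * (ln (tau + K) + a * - ln r)).
  rewrite /powR [X in if X then _ else _]gt_eqF ?mulr_gt0//.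
  by rewrite lnM ?posrE// ln_powR !mulNr mulrN.
rewrite ler_expR /log_const.
have b2 : 0 < beta / 2 by rewrite divr_gt0.
have rb : r `^ beta = r `^ (beta / 2) * r `^ (beta / 2).
  by rewrite -powRD ?(gt_eqF r0) ?implybT//; congr powR; field.
have rb1 : r `^ (beta / 2) <= 1.
  apply: (@le_trans _ _ (expR 0)); last by rewrite expR0.
  by rewrite /powR gt_eqF// ler_expR (mulr_ge0_le0 (ltW b2) lr0).
have rb0 : 0 < r `^ (beta / 2) := powR_gt0 _ r0.
have lrb : r `^ (beta / 2) * - ln r <= 2 / beta.
  have i1 : 1 <= (r `^ (beta / 2))^-1 by rewrite invf_ge1.
  have := ln_le_id i1; rewrite lnV ?posrE// ln_powR.
  rewrite -(ler_pM2l rb0) mulfV ?gt_eqF// => H.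
  rewrite -(ler_pM2l b2); apply: le_trans (_ : _ <= 1) _.
    by apply: le_trans H; rewrite le_eqVlt; apply/orP; left; apply/eqP; ring.
  by rewrite le_eqVlt; apply/orP; left; apply/eqP; field; rewrite gt_eqF.
rewrite rb mulrDr mulrDl; apply: lerD.
  by rewrite [leRHS]mulrC; apply: ler_wpM2r; [exact: ln_ge0|rewrite ler_piMr// ltW].
have := ler_wpM2l (mulr_ge0 (ltW rb0) a0) lrb.
rewrite (_ : _ * (2 / beta) = 2 * a / beta * r `^ (beta / 2)); last by field; rewrite gt_eqF.
apply: le_trans; rewrite le_eqVlt; apply/orP; left; apply/eqP; ring.
Qed.

Lemma ldens_le p a1 theta tau beta (u w : R -> R) r : 0 < pstar p a1 theta -> 1 <= tau ->
  `|u r| <= `|w r| -> ldens p a1 theta tau beta u r <= ldens p a1 theta tau beta w r.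
Proof.
move=> P0 t1 uw.
have h1 := ge0_ler_powR (ltW P0) (normr_ge0 (u r) : _ \in Num.nneg) (normr_ge0 (w r) : _ \in Num.nneg) uw.
have x1 (z : R) : 1 <= tau + `|z| by apply: le_trans t1 _; rewrite lerDl.
have h2 : `|ln (tau + `|u r|)| <= `|ln (tau + `|w r|)|.
  rewrite (ger0_norm (ln_ge0 (x1 _))) (ger0_norm (ln_ge0 (x1 _))).
  rewrite ler_ln ?posrE ?(lt_le_trans ltr01 (x1 _))//.
  by rewrite lerD2l.
have h3 := ge0_ler_powR (powR_ge0 r beta) (normr_ge0 _ : _ \in Num.nneg) (normr_ge0 _ : _ \in Num.nneg) h2.
exact: ler_pM (mulr_ge0 (powR_ge0 _ _) (powR_ge0 _ _)) (powR_ge0 _ _) (ler_wpM2l (powR_ge0 _ _) h1) h3.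
Qed.

End log_factor.

(** * Energy splitting near the origin *)

(** Convexity with weights 1 - s and s, from the tangent at x + y. A factor near 1 in front of x^P
    is paid for by a large one in front of y^P. *)
Lemma powR_add_le {R : realType} (P s x y : R) : 1 < P -> 0 < s -> s < 1 ->
  0 <= x -> 0 <= y ->
  (x + y) `^ P <= (1 - s) `^ (1 - P) * x `^ P + s `^ (1 - P) * y `^ P.
Proof.
move=> P1 s0 s1 x0 y0; pose m := x + y.
have m0 : 0 <= m by rewrite addr_ge0.
have aux t z : 0 < t -> 0 <= z -> P * m `^ (P - 1) * z <= t `^ (1 - P) * z `^ P + t * ((P - 1) * m `^ P).
  move=> t0 z0; have zt : 0 <= z / t by rewrite divr_ge0// ltW.
  have := ler_wpM2l (ltW t0) (tangent_powR P1 zt m0).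
  rewrite (_ : t * (P * _ * (z / t)) = P * m `^ (P - 1) * z); last by field; rewrite gt_eqF.
  rewrite mulrDr (_ : t * (z / t) `^ P = t `^ (1 - P) * z `^ P)//.
  rewrite powRM// ?invr_ge0 ?(ltW t0)// mulrCA mulrC; congr (_ * _).
  transitivity (t `^ 1 * t `^ (- P)); last by rewrite -powRD// (gt_eqF t0) implybT.
  by rewrite (powRr1 (ltW t0)) -(powR_inv1 (ltW t0)) -powRrM mulN1r.
have s10 : 0 < 1 - s by rewrite subr_gt0.
have := lerD (aux _ _ s10 x0) (aux _ _ s0 y0).
have e : P * m `^ (P - 1) * x + P * m `^ (P - 1) * y = P * m `^ P.
  rewrite -mulrDr -/m -mulrA; congr (_ * _).
  have [->|mn0] := eqVneq m 0; first by rewrite mulr0 powR0// gt_eqF// (lt_trans ltr01).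
  transitivity (m `^ (P - 1) * m `^ 1); first by rewrite (powRr1 m0).
  by rewrite -powRD ?mn0 ?implybT//; congr powR; ring.
rewrite e -/m; move: ((1 - s) `^ _ * _) (s `^ _ * _) (m `^ P) => a b z.
rewrite (_ : a + _ + _ = a + b + (P - 1) * z); last by ring.
by rewrite mulrBl mul1r addrCA addrA -lerBlDr => h; move: h; lra.
Qed.

Lemma powR_le_id {R : realType} (e k : R) : 0 <= e -> e <= 1 -> 1 <= k -> e `^ k <= e.
Proof.
rewrite le_eqVlt => /predU1P[<- _ k1|e0 e1 k1]; last by rewrite ge1r_powR ?e0.
by rewrite powR0// gt_eqF// (lt_le_trans ltr01).
Qed.

Section bounds.
Context {R : realType}.
Local Notation mu := (@lebesgue_measure R).
Local Notation I01 := (`](0 : R)%R, 1%R[%classic).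
Context (p a1 theta tau beta L : R) (hp : 1 < p) (ha1 : 0 <= a1)
  (hN : 0 < a1 - p + 1) (hth : 0 <= theta) (hnu : a1 - p < theta)
  (htau : 1 <= tau) (hb : 0 < beta) (L0 : 0 < L).
Local Notation P := (pstar p a1 theta).
Local Notation S := (bS p a1 theta L).
Local Notation K := (growth_const p a1).
Local Notation al := ((a1 - p + 1) / p).
Local Notation B := (log_const tau beta K al).
Local Notation ld := (ldens p a1 theta tau beta).

Let p0 : 0 < p. Proof. exact: bp0. Qed.
Let P1 : 1 < P. Proof. exact: bP1. Qed.
Let P0 : 0 < P. Proof. exact: bP0. Qed.
Let S0 : 0 < S. Proof. exact: bS_gt0. Qed.
Let al0 : 0 <= al. Proof. by rewrite divr_ge0// ltW. Qed.
Let K1 : 1 <= K. Proof. exact: growth_const_ge1. Qed.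
Let B0 : 0 <= B. Proof. exact: log_const_ge0. Qed.

Lemma ldens_log_le (u : R -> R) (r d v : R) : 0 < r -> r < 1 -> r <= d ->
  `|u r| <= K * r `^ (- al) -> `|u r| <= v ->
  ld u r <= expR (B * d `^ (beta / 2)) * (r `^ theta * v `^ P).
Proof.
move=> r0 r1 rd uK uv; rewrite /ldens mulrC.
have h1 := log_factor_le htau hb K1 al0 r0 r1 uK.
have b2 : 0 <= beta / 2 by rewrite divr_ge0// ltW.
have h2 : expR (B * r `^ (beta / 2)) <= expR (B * d `^ (beta / 2)).
  rewrite ler_expR; apply: (ler_wpM2l B0).
  exact: (ge0_ler_powR b2 (ltW r0 : _ \in Num.nneg) (ltW (lt_le_trans r0 rd) : _ \in Num.nneg) rd).
have h3 := ge0_ler_powR (ltW P0) (normr_ge0 (u r) : _ \in Num.nneg) (le_trans (normr_ge0 _) uv : _ \in Num.nneg) uv.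
exact: ler_pM (powR_ge0 _ _) (mulr_ge0 (powR_ge0 _ _) (powR_ge0 _ _)) (le_trans h1 h2) (ler_wpM2l (powR_ge0 _ _) h3).
Qed.

Lemma mtail (f : R -> R) (q : R) : wL p a1 f ->
  measurable_fun I01 (fun r => r `^ theta * tail f r `^ q).
Proof.
move=> hf; apply: measurable_funM.
  by apply: measurable_funTS; exact: measurable_powR.
apply: (measurableT_comp (measurable_powR q)).
exact: (AC_loc01_measurable (tail_AC hp ha1 hf)).
Qed.

(** The growth bound keeps the logarithmic factor below [expR B] on (0,1); the Bliss inequality does
    the rest. This makes the supremum finite. *)
Lemma functional_le (f u : R -> R) : wL p a1 f -> measurable_fun I01 u ->
  (forall r, 0 < r < 1 -> `|u r| <= tail f r) ->
  (forall r, 0 < r < 1 -> `|u r| <= K * r `^ (- al)) ->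
  (log_functional p a1 theta tau beta u <=
    (expR B * (S * fine (wint p a1 f) `^ (P / p)))%:E)%E.
Proof.
move=> hf mu_ uf uK.
apply: (@le_trans _ _ (\int[mu]_(r in I01) (expR B * (r `^ theta * tail f r `^ P))%:E)%E).
  apply: int_le.
  - exact: measurable_itv.
  - exact: ldens_measurable.
  - by apply: measurable_funM; [exact: measurable_cst|exact: mtail].
  - by move=> r _; exact: ldens_ge0.
  - move=> r /=; rewrite in_itv/= => r01; have /andP[r0 r1] := r01.
    have := ldens_log_le r0 r1 (ltW r1) (uK _ r01) (uf _ r01).
    by rewrite powR1 mulr1.
rewrite (int_scale (measurable_itv _) (mtail P hf)
  (fun r _ => mulr_ge0 (powR_ge0 r _) (powR_ge0 (tail f r) P)) (expR_ge0 B)).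
rewrite EFinM; apply: lee_wpmul2l; first by rewrite lee_fin expR_ge0.
exact: (bliss_ineq hp ha1 hN hth hnu L0 hf).
Qed.

Section near_zero.
Context (f : R -> R) (hf : wL p a1 f) (nf : wint p a1 f = 1%E) (d : R) (d0 : 0 < d) (d1 : d < 1).
Let g (r : R) : R := if r <= d then f r else 0.

Let U01 : I01 = `]0, d]%classic `|` `]d, 1[%classic.
Proof. by rewrite -itv_bndbnd_setU// bnd_simp// ltW. Qed.

Let disj (x : R) : [disjoint `]x, d]%classic & `]d, 1[%classic].
Proof.
apply/disj_set2P; apply/seteqP; split => z //= []; rewrite !in_itv/= => /andP[_ zy] /andP[yz _].
by move: (le_lt_trans zy yz); rewrite ltxx.
Qed.

Let mg : measurable_fun I01 g.
Proof.
apply: measurable_fun_if; first exact: measurable_itv.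
- by apply: measurable_fun_ler; [exact: measurable_id|exact: measurable_cst].
- apply: measurable_funS hf.1; [exact: measurable_itv|by move=> z []].
- exact: measurable_cst.
Qed.

Let g_energy : (wint p a1 g + (etail p a1 f d)%:E = 1)%E.
Proof.
have m01 := @wdens_measurable _ p a1 f I01 hf.1.
have mg01 := @wdens_measurable _ p a1 g I01 mg.
rewrite -nf (etailE hf) (max_r (ltW d0)) /wint U01.
rewrite !ge0_integral_setU//=.
- rewrite [X in (_ + X + _)%E](_ : _ = 0%E); last first.
    apply: integral0_eq => r; rewrite /= in_itv/= => /andP[dr _].
    by rewrite /g leNgt dr/= normr0 powR0 ?mulr0// gt_eqF.
  rewrite adde0; congr (_ + _)%E; apply: eq_integral => r.
  by rewrite inE/= in_itv/= => /andP[_ rd]; rewrite /g rd.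
- by apply/measurable_EFinP; rewrite -U01.
- by move=> r _; rewrite lee_fin; exact: wdens_ge0.
- by apply/measurable_EFinP; rewrite -U01.
- by move=> r _; rewrite lee_fin; exact: wdens_ge0.
Qed.

Let wg : wL p a1 g.
Proof.
split; first exact: mg.
apply: (@le_lt_trans _ _ 1%E); last exact: ltry.
by rewrite -g_energy leeDl// lee_fin etail_ge0.
Qed.

Let g_energyE : fine (wint p a1 g) = 1 - etail p a1 f d.
Proof.
apply: EFin_inj; rewrite (fineK (wint_fin_num wg)) EFinB -g_energy addeK//.
Qed.

Let g_tail (r : R) : 0 < r -> r <= d -> tail f r = tail g r + tail f d.
Proof.
move=> r0 rd; apply/eqP; rewrite -subr_eq; apply/eqP; apply: EFin_inj.
rewrite (tail_splitE hp ha1 hf r0 rd d1) (tailE hp ha1 wg r0).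
have U : `]r, 1[%classic = `]r, d]%classic `|` `]d, 1[%classic.
  by rewrite -itv_bndbnd_setU// bnd_simp// ltW.
rewrite U ge0_integral_setU//=.
- rewrite [X in (_ + X)%E](_ : _ = 0%E); last first.
    apply: integral0_eq => z; rewrite /= in_itv/= => /andP[dz _].
    by rewrite /g leNgt dz/= normr0.
  rewrite adde0; apply: eq_integral => z.
  by rewrite inE/= in_itv/= => /andP[_ zd]; rewrite /g zd.
- apply/measurable_EFinP; rewrite -U; apply: (measurableT_comp (@normr_measurable R setT)).
  apply: measurable_funS mg; first exact: measurable_itv.
  by move=> z /=; rewrite !in_itv/= => /andP[rz ->]; rewrite (lt_trans r0 rz).
Qed.

(* The truncation of [f] to [(0, d]] carries the energy [1 - etail f d]. *)
Lemma functional_near0_le (s : R) : 0 < s -> s < 1 ->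
  (\int[mu]_(r in `]0%R, d]) (ld (tail f) r)%:E <=
    (expR (B * d `^ (beta / 2)) * ((1 - s) `^ (1 - P) * (S * (1 - etail p a1 f d))
       + s `^ (1 - P) * (tail f d `^ P * d `^ (theta + 1))))%:E)%E.
Proof.
move=> s0 s1.
have sub : `]0, d]%classic `<=` I01.
  by move=> z /=; rewrite !in_itv/= => /andP[-> zd]; rewrite (le_lt_trans zd).
have mI : measurable (`]0, d]%classic : set R) by exact: measurable_itv.
pose c1 := (1 - s) `^ (1 - P); pose c2 := s `^ (1 - P) * tail f d `^ P.
have c10 : 0 <= c1 := powR_ge0 _ _.
have c20 : 0 <= c2 := mulr_ge0 (powR_ge0 _ _) (powR_ge0 _ _).
pose w := expR (B * d `^ (beta / 2)); have w0 : 0 <= w := expR_ge0 _.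
have m1 : measurable_fun `]0, d]%classic (fun r => r `^ theta * tail g r `^ P).
  exact: measurable_funS (measurable_itv _) sub (mtail P wg).
have m2 : measurable_fun `]0, d]%classic (fun r : R => r `^ theta).
  by apply: measurable_funTS; exact: measurable_powR.
have m11 : measurable_fun `]0, d]%classic (fun r => c1 * (r `^ theta * tail g r `^ P)).
  by apply: measurable_funM; [exact: measurable_cst|exact: m1].
have m22 : measurable_fun `]0, d]%classic (fun r : R => c2 * r `^ theta).
  by apply: measurable_funM; [exact: measurable_cst|exact: m2].
have n1 r : 0 <= r `^ theta * tail g r `^ P := mulr_ge0 (powR_ge0 _ _) (powR_ge0 _ _).
apply: (@le_trans _ _ (\int[mu]_(r in `]0%R, d])
    (w * (c1 * (r `^ theta * tail g r `^ P) + c2 * r `^ theta))%:E)%E).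
  apply: int_le.
  - exact: mI.
  - apply: measurable_funS (measurable_itv _) sub _; apply: ldens_measurable.
    exact: (AC_loc01_measurable (tail_AC hp ha1 hf)).
  - by apply: measurable_funM; [exact: measurable_cst|exact: measurable_funD m11 m22].
  - by move=> r _; exact: ldens_ge0.
  - move=> r /=; rewrite in_itv/= => /andP[r0 rd]; have r1 := le_lt_trans rd d1.
    have tK : `|tail f r| <= K * r `^ (- al).
      rewrite (ger0_norm (tail_ge0 _ _)).
      by have := tail_growth hp ha1 hN hf r0 r1; rewrite nf.
    have tt : `|tail f r| <= tail g r + tail f d.
      by rewrite (ger0_norm (tail_ge0 _ _)) (g_tail r0 rd).
    apply: le_trans (ldens_log_le r0 r1 rd tK tt) _; apply: (ler_wpM2l w0).
    apply: le_trans (ler_wpM2l (powR_ge0 _ _) (powR_add_le P1 s0 s1 (tail_ge0 g r) (tail_ge0 f d))) _.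
    by rewrite /c1 /c2 le_eqVlt; apply/orP; left; apply/eqP; ring.
rewrite (int_scale mI (measurable_funD m11 m22)
  (fun r _ => addr_ge0 (mulr_ge0 c10 (n1 r)) (mulr_ge0 c20 (powR_ge0 r _))) w0).
rewrite (int_add mI m11 m22 (fun r _ => mulr_ge0 c10 (n1 r)) (fun r _ => mulr_ge0 c20 (powR_ge0 r _))).
rewrite (int_scale mI m1 (fun r _ => n1 r) c10) (int_scale mI m2 (fun r _ => powR_ge0 r _) c20).
have i1 : (\int[mu]_(r in `]0%R, d]) (r `^ theta * tail g r `^ P)%:E <= (S * (1 - etail p a1 f d))%:E)%E.
  apply: (@le_trans _ _ (\int[mu]_(r in I01) (r `^ theta * tail g r `^ P)%:E)%E).
    apply: int_subset.
    - exact: mI.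
    - exact: measurable_itv.
    - exact: mtail.
    - by move=> r _; exact: n1.
    - exact: sub.
  apply: le_trans (bliss_ineq hp ha1 hN hth hnu L0 wg) _.
  rewrite lee_fin g_energyE; apply: (ler_wpM2l (ltW S0)).
  (* The truncated energy is at most 1 and P/p >= 1, so its power is at most the energy itself; this
     makes the bound affine in the energy. *)
  apply: powR_le_id.
  - by rewrite -g_energyE; apply: fine_ge0; exact: wint_ge0.
  - by rewrite gerBl; exact: etail_ge0.
  - by rewrite ler_pdivlMr// mul1r ltW// bpP.
have i2 : (\int[mu]_(r in `]0%R, d]) (r `^ theta)%:E <= (d `^ (theta + 1))%:E)%E.
  apply: (@le_trans _ _ (\int[mu]_(r in `]0%R, d]) (d `^ theta)%:E)%E).
    apply: int_le.
    - exact: mI.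
    - exact: m2.
    - exact: measurable_cst.
    - by move=> r _; exact: powR_ge0.
    - move=> r /=; rewrite in_itv/= => /andP[r0 rd].
      exact: (ge0_ler_powR hth (ltW r0 : _ \in Num.nneg) (ltW d0 : _ \in Num.nneg) rd).
  rewrite int_cst// (mu_itv_oc (ltW d0)) subr0 -EFinM lee_fin.
  by rewrite powRD ?(gt_eqF d0) ?implybT// (powRr1 (ltW d0)).
have h1 := lee_wpmul2l (c10 : (0 <= c1%:E)%E) i1.
have h2 := lee_wpmul2l (c20 : (0 <= c2%:E)%E) i2.
apply: le_trans (lee_wpmul2l (w0 : (0 <= w%:E)%E) (leeD h1 h2)) _.
by rewrite -(EFinM c1) -(EFinM c2) -EFinD -EFinM lee_fin /c2 -(mulrA (s `^ _)).
Qed.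

End near_zero.
End bounds.

Section integrals.
Context {R : realType}.
Local Notation mu := (@lebesgue_measure R).
Local Notation I01 := (`](0 : R)%R, 1%R[%classic).

Lemma int_split01 (F : R -> R) (d : R) : measurable_fun I01 F -> (forall x, 0 <= F x) ->
  0 < d -> d < 1 ->
  (\int[mu]_(r in I01) (F r)%:E =
   \int[mu]_(r in `]0%R, d]) (F r)%:E + \int[mu]_(r in `]d, 1%R[) (F r)%:E)%E.
Proof.
move=> mF F0 d0 d1.
have U : I01 = `]0, d]%classic `|` `]d, 1[%classic.
  by rewrite -itv_bndbnd_setU// bnd_simp// ltW.
rewrite U ge0_integral_setU//=.
- by apply/measurable_EFinP; rewrite -U.
- by move=> r _; rewrite lee_fin.
- apply/disj_set2P; apply/seteqP; split => z //= []; rewrite !in_itv/= => /andP[_ zy] /andP[yz _].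
  by move: (le_lt_trans zy yz); rewrite ltxx.
Qed.

Lemma lt_int01_witness (F : R -> R) (k : \bar R) : measurable_fun I01 F -> (forall x, 0 <= F x) ->
  (k < \int[mu]_(r in I01) (F r)%:E)%E ->
  exists a b, [/\ 0 < a, a < b, b < 1 & (k < \int[mu]_(r in `]a, b]) (F r)%:E)%E].
Proof.
move=> mF F0 kI; apply: contrapT => H; move: kI; apply/negP; rewrite -leNgt.
apply: int_exhaust01 => // a b a0 ab b1; rewrite leNgt; apply/negP => lt.
by apply: H; exists a, b.
Qed.

(** A compact subinterval already carries all but [e] of the finite integral. *)
Lemma small_int_near0 (F : R -> R) (e : R) : measurable_fun I01 F -> (forall x, 0 <= F x) ->
  (\int[mu]_(r in I01) (F r)%:E < +oo)%E -> 0 < e ->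
  exists2 a, 0 < a < 1 & forall d, 0 < d -> d <= a -> (\int[mu]_(r in `]0%R, d]) (F r)%:E <= e%:E)%E.
Proof.
move=> mF F0 fin e0; set I := (X in (X < +oo)%E) in fin.
have I0 : (0 <= I)%E by apply: int_ge0.
have If : I \is a fin_num by rewrite ge0_fin_numE.
have lt : (I - e%:E < I)%E by rewrite lteBlDr// lteDl// lte_fin.
have [a [b [a0 ab b1 H]]] := lt_int01_witness mF F0 lt.
have a1 := lt_trans ab b1.
have sub0 (d : R) : d < 1 -> `]0, d]%classic `<=` I01.
  by move=> d1 z /=; rewrite !in_itv/= => /andP[-> zd]; rewrite (le_lt_trans zd).
exists a; first by rewrite a0.
move=> d d0 da; apply: (@le_trans _ _ (\int[mu]_(r in `]0%R, a]) (F r)%:E)%E).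
  apply: int_subset.
  - exact: measurable_itv.
  - exact: measurable_itv.
  - exact: measurable_funS (measurable_itv _) (sub0 a a1) mF.
  - by move=> r _.
  - by move=> z /=; rewrite !in_itv/= => /andP[-> zd]; rewrite (le_trans zd).
have E := int_split01 mF F0 a0 a1; rewrite -/I in E.
have ab_le : (\int[mu]_(r in `]a, b]) (F r)%:E <= \int[mu]_(r in `]a, 1%R[) (F r)%:E)%E.
  apply: int_subset.
  - exact: measurable_itv.
  - exact: measurable_itv.
  - apply: measurable_funS (measurable_itv _) _ mF => z /=; rewrite !in_itv/= => /andP[az ->].
    by rewrite (lt_trans a0 az).
  - by move=> r _.
  - by move=> z /=; rewrite !in_itv/= => /andP[-> zb]; rewrite (le_lt_trans zb).
have := lt_le_trans H ab_le; rewrite lteBlDr// => H2.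
have If2 : (\int[mu]_(r in `]a, 1%R[) (F r)%:E \is a fin_num)%E.
  rewrite ge0_fin_numE; last by apply: int_ge0.
  by apply: le_lt_trans fin; rewrite E leeDr// int_ge0.
by move: H2; rewrite E addeC lteD2lE// => /ltW.
Qed.

Lemma powR_cvg_at0 (q : R) : 0 < q -> t `^ q @[t --> 0^'+] --> (0 : R).
Proof.
move=> q0.
have e : \forall t \near (0 : R)^'+, pospow q t = t `^ q.
  near=> t; apply: (pospowE q0); apply: ltW; near: t; exact: nbhs_right_gt.
apply: cvg_trans (near_eq_cvg e) _.
have z0 : pospow q (0 : R) = 0 by rewrite /pospow ltxx.
by apply: cvg_at_right_filter; have := @continuous_pospow _ _ q0 0; rewrite /continuous_at z0.
Unshelve. all: by end_near. Qed.

End integrals.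

(** * Scaling of the functional *)

Section scaling.
Context {R : realType}.
Local Notation mu := (@lebesgue_measure R).
Local Notation I01 := (`](0 : R)%R, 1%R[%classic).
Context (p a0 a1 theta tau beta : R) (hp : 1 < p) (ha0 : 0 <= a0) (ha1 : 0 <= a1)
  (hN : 0 < a1 - p + 1) (ha01 : a1 - p <= a0) (hnu : a1 - p < theta) (htau : 1 <= tau).
Local Notation P := (pstar p a1 theta).
Local Notation F := (log_sup p a0 a1 theta tau beta).
Let p0 : 0 < p. Proof. exact: bp0. Qed.
Let P0 : 0 < P. Proof. exact: bP0. Qed.

Lemma wint_derive1Z (l : R) (c : R -> R) : 0 <= l -> AC_loc01 c ->
  wint p a1 (derive1 (fun r => l * c r)) = ((l `^ p)%:E * wint p a1 (derive1 c))%E.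
Proof.
move=> l0 acc.
have acl : AC_loc01 (fun r => l * c r).
  by move=> a b a0' ab b1; apply: abs_continuousZ; exact: acc.
have md := AC_loc01_measurable_derive1 acc.
rewrite -(wintZ a1 p0 l0 md) /wint; apply: ae_eq_integral.
- exact: measurable_itv.
- by apply/measurable_EFinP; apply: wdens_measurable; exact: AC_loc01_measurable_derive1.
- apply/measurable_EFinP; apply: wdens_measurable.
  by apply: measurable_funM; [exact: measurable_cst|exact: md].
- apply: (@filterS _ _ (ae_filter_ringOfSetsType mu)) (AC_loc01_derivable acc) => x H.
  rewrite /= in_itv/= => /H dx; congr (_ * `|_| `^ _)%:E.
  have d := is_deriveZ l (derivableP dx).
  rewrite derive1E; have [_ ->] := d.
  by rewrite /GRing.scale/= derive1E.
Qed.

(** Normalise to w = l c with l = T^(-1/p) >= 1, a competitor for the supremum. Then |c|^P = T^(P/p)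
    |w|^P <= T |w|^P because P >= p, and the logarithmic factor of w is at least that of c. *)
Lemma functional_scale (c : R -> R) (T : R) : AC_loc01 c -> c r @[r --> 1^'-] --> (0 : R) ->
  0 < T <= 1 -> wint p a1 (derive1 c) = T%:E ->
  (log_functional p a1 theta tau beta c <= T%:E * F)%E.
Proof.
move=> acc c1 /andP[T0 T1] wT.
pose l := T `^ (- p^-1); have l0 : 0 < l := powR_gt0 _ T0.
have lp : l `^ p = T^-1 by rewrite -powRrM mulNr mulVf ?gt_eqF// -[RHS](powR_inv1 (ltW T0)).
have l1 : 1 <= l.
  rewrite /l powRN invf_ge1 ?powR_gt0//.
  have pi0 : 0 <= p^-1 by rewrite invr_ge0 ltW.
  have := ge0_ler_powR pi0 (ltW T0 : _ \in Num.nneg) (ler01 : _ \in Num.nneg) T1.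
  by rewrite powR1.
pose w r := l * c r.
have acw : AC_loc01 w.
  by move=> a b a0' ab b1; apply: abs_continuousZ; exact: acc.
have ww : wint p a1 (derive1 w) = 1%E.
  by rewrite wint_derive1Z ?(ltW l0)// wT lp -EFinM mulVf// gt_eqF.
have w1 : w r @[r --> 1^'-] --> (0 : R).
  by rewrite -[X in _ --> X](mulr0 l); apply: cvgM; [exact: cvg_cst|exact: c1].
have Xw : X1p p a0 a1 w.
  apply: (mem_X1p hp ha1 hN ha01 acw); last exact: w1.
  by split; [exact: AC_loc01_measurable_derive1|rewrite ww ltry].
have Fw : (log_functional p a1 theta tau beta w <= F)%E.
  apply: ereal_sup_ubound; exists w => //; split => //.
  by rewrite /grad_norm ww poweR_EFin powR1.
have ml := @ldens_measurable R p a1 theta tau beta _ (AC_loc01_measurable acw).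
apply: le_trans (lee_wpmul2l (ltW T0 : (0 <= T%:E)%E) Fw).
rewrite -(int_scale (measurable_itv _) ml (fun r _ => ldens_ge0 p a1 theta tau beta w r) (ltW T0)).
apply: int_le.
- exact: measurable_itv.
- by apply: ldens_measurable; exact: AC_loc01_measurable.
- by apply: measurable_funM; [exact: measurable_cst|exact: ml].
- by move=> r _; exact: ldens_ge0.
- move=> r _.
  have cw : `|c r| <= `|w r| by rewrite /w normrM (gtr0_norm l0) ler_peMl.
  have cP : `|c r| `^ P <= T * `|w r| `^ P.
    rewrite /w normrM (gtr0_norm l0) powRM ?(ltW l0)// mulrA ler_peMl ?powR_ge0//.
    rewrite -powRrM -{1}(powRr1 (ltW T0)) -powRD ?(gt_eqF T0) ?implybT//.
    have PP : 1 <= P / p by rewrite ler_pdivlMr// mul1r ltW// bpP.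
    have e0 : 1 + - p^-1 * P <= 0 by rewrite mulNr mulrC subr_le0.
    rewrite -[leLHS](powRr0 T); apply: ger_powR => //.
    by rewrite T0.
  have x1 (z : R) : 1 <= tau + `|z| by apply: le_trans htau _; rewrite lerDl.
  have h2 : `|ln (tau + `|c r|)| <= `|ln (tau + `|w r|)|.
    rewrite (ger0_norm (ln_ge0 (x1 _))) (ger0_norm (ln_ge0 (x1 _))).
    rewrite ler_ln ?posrE ?(lt_le_trans ltr01 (x1 _))//.
    by rewrite lerD2l.
  have h3 := ge0_ler_powR (powR_ge0 r beta) (normr_ge0 _ : _ \in Num.nneg) (normr_ge0 _ : _ \in Num.nneg) h2.
  rewrite /ldens mulrA (mulrCA T).
  exact: ler_pM (mulr_ge0 (powR_ge0 _ _) (powR_ge0 _ _)) (powR_ge0 _ _) (ler_wpM2l (powR_ge0 _ _) cP) h3.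
Qed.

End scaling.

(** * Passage to the limit in the functional *)

Section limit_functional.
Context {R : realType}.
Local Notation mu := (@lebesgue_measure R).
Local Notation I01 := (`](0 : R)%R, 1%R[%classic).
Context (p a1 theta tau beta L : R) (hp : 1 < p) (ha1 : 0 <= a1)
  (hN : 0 < a1 - p + 1) (hth : 0 <= theta) (hnu : a1 - p < theta)
  (htau : 1 <= tau) (hb : 0 < beta) (L0 : 0 < L).
Context (f_ : nat -> R -> R) (wf : forall n, wL p a1 (f_ n)) (nf : forall n, wint p a1 (f_ n) = 1%E)
  (c : R -> R) (fc : forall x, 0 < x < 1 -> tail (f_ n) x @[n --> \oo] --> c x).
Local Notation P := (pstar p a1 theta).
Local Notation S := (bS p a1 theta L).
Local Notation K := (growth_const p a1).
Local Notation al := ((a1 - p + 1) / p).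
Local Notation B := (log_const tau beta K al).
Local Notation ld := (ldens p a1 theta tau beta).

Let p0 : 0 < p. Proof. exact: bp0. Qed.
Let P0 : 0 < P. Proof. exact: bP0. Qed.
Let al0 : 0 <= al. Proof. by rewrite divr_ge0// ltW. Qed.
Let K1 : 1 <= K. Proof. exact: growth_const_ge1. Qed.

Lemma ldens_cvg (v_ : nat -> R) (v r : R) : 0 < r -> (forall n, 0 <= v_ n) -> 0 <= v ->
  v_ n @[n --> \oo] --> v ->
  ld (cst (v_ n)) r @[n --> \oo] --> ld (cst v) r.
Proof.
move=> r0 v_0 v0 vc; rewrite /ldens /=.
have nv : `|v_ n| @[n --> \oo] --> `|v| by exact: cvg_norm.
have x1 (z : R) : 1 <= tau + `|z| by apply: le_trans htau _; rewrite lerDl.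
apply: cvgM.
  by apply: cvgM; [exact: cvg_cst|exact: cvg_powR_ge0 (fun n => normr_ge0 _) (normr_ge0 _) nv].
apply: (cvg_powR_ge0 (powR_gt0 beta r0) (fun n => normr_ge0 _) (normr_ge0 _)).
apply: cvg_norm; apply: (@cvg_comp _ _ _ (fun n => tau + `|v_ n|) (@ln R)).
  by apply: cvgD; [exact: cvg_cst|exact: nv].
apply: continuous_ln; exact: lt_le_trans ltr01 (x1 v).
Qed.

(** Dominated convergence: away from the origin the common growth bound provides a constant
    majorant. *)
Lemma int_ldens_cvg (d : R) : 0 < d -> d < 1 ->
  (\int[mu]_(r in `]d, 1%R[) (ld (tail (f_ n)) r)%:E @[n --> \oo] -->
   \int[mu]_(r in `]d, 1%R[) (ld c r)%:E)%E.
Proof.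
move=> d0 d1.
have sub : `]d, 1[%classic `<=` I01.
  by move=> z /=; rewrite !in_itv/= => /andP[dz ->]; rewrite (lt_trans d0 dz).
have mI : measurable (`]d, 1[%classic : set R) by exact: measurable_itv.
pose M := expR (B * 1 `^ (beta / 2)) * (1 * (K * d `^ (- al)) `^ P).
have mld u : AC_loc01 u -> measurable_fun `]d, 1[%classic (EFin \o ld u).
  move=> acu; apply/measurable_EFinP; apply: measurable_funS (measurable_itv _) sub _.
  by apply: ldens_measurable; exact: AC_loc01_measurable.
have [] := @dominated_convergence _ _ _ mu _ mI (fun n => EFin \o ld (tail (f_ n))) (EFin \o ld c)
  (cst M%:E).
- by move=> n; apply: mld; exact: (tail_AC hp ha1 (wf n)).
- by apply: mld; exact: (limit_AC hp ha1 wf nf fc).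
- apply: aeW => r Dr; have := sub _ Dr; rewrite /= in_itv/= => r01.
  have /andP[r0 _] := r01.
  apply/fine_cvgP; split; first exact: nearW.
  exact: (ldens_cvg r0 (fun n => tail_ge0 (f_ n) r) (limit_ge0 fc r01) (fc r01)).
- apply/integrableP; split; first exact: measurable_cst.
  rewrite (eq_integral (fun _ => `|M|%:E))//.
  by rewrite int_cst// (mu_itv_oo (ltW d1)) -EFinM ltry.
- apply: aeW => r n Dr; have := sub _ Dr; rewrite /= in_itv/= => /andP[r0 r1].
  rewrite /= lee_fin (ger0_norm (ldens_ge0 p a1 theta tau beta (tail (f_ n)) r)).
  have tK : `|tail (f_ n) r| <= K * r `^ (- al).
    by rewrite (ger0_norm (tail_ge0 _ _)); exact: (unit_tail_growth hp ha1 hN wf nf).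
  have dr : d <= r by move: Dr; rewrite /= in_itv/= => /andP[/ltW].
  have rd : r `^ (- al) <= d `^ (- al).
    rewrite !powRN lef_pV2 ?posrE ?powR_gt0//.
    exact: (ge0_ler_powR al0 (ltW d0 : _ \in Num.nneg) (ltW r0 : _ \in Num.nneg) dr).
  have tK2 := le_trans tK (ler_wpM2l (le_trans ler01 K1) rd).
  apply: le_trans (ldens_log_le hp hN hnu htau hb r0 r1 (ltW r1) tK tK2) _.
  rewrite /M; apply: ler_wpM2l; first exact: expR_ge0.
  apply: ler_wpM2r; first exact: powR_ge0.
  have := ge0_ler_powR hth (ltW r0 : _ \in Num.nneg) (ler01 : _ \in Num.nneg) (ltW r1).
  by rewrite powR1.
- by move=> _ _ H; exact: H.
Qed.

Lemma wint_limit_le1 : (wint p a1 (derive1 c) <= 1)%E.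
Proof.
have acc := limit_AC hp ha1 wf nf fc.
apply: int_exhaust01.
- by apply: wdens_measurable; exact: AC_loc01_measurable_derive1.
- by move=> r _; exact: wdens_ge0.
move=> x y x0 xy y1; rewrite leNgt; apply/negP => lt.
have sub : `]x, y]%classic `<=` I01.
  by move=> z /=; rewrite !in_itv/= => /andP[xz zy]; rewrite (lt_trans x0 xz) (le_lt_trans zy y1).
have lt' : (1 < \int[mu]_(r in `]x, y[) (r `^ a1 * `|derive1 c r| `^ p)%:E)%E.
  rewrite integral_itv_bndo_bndc//; apply/measurable_EFinP; apply: wdens_measurable.
  apply: measurable_funS (AC_loc01_measurable_derive1 acc); first exact: measurable_itv.
  by move=> z /= zz; apply: sub; apply: subset_itv_oo_oc zz.
have [n] := filter_ex (tail_energy_lsc hp ha1 wf acc fc x0 xy y1 lt').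
apply/negP; rewrite -leNgt (etailE (wf n)) -(nf n); apply: (int_dens_le (wf n)).
  exact: measurable_itv.
by move=> z /=; rewrite !in_itv/= gt_max => /andP[/andP[-> _] ->].
Qed.

(** On (d, 1) the integrals converge. On (0, d] [functional_near0_le] applies, the energy beyond [d]
    being eventually above [q] by lower semicontinuity. *)
Lemma limit_functional_ge (F d b s q : R) (e_ : nat -> R) :
  0 < d -> d < b -> b < 1 -> 0 < s -> s < 1 ->
  e_ n @[n --> \oo] --> (0 : R) ->
  (forall n, ((F - e_ n)%:E <= log_functional p a1 theta tau beta (tail (f_ n)))%E) ->
  (q%:E < \int[mu]_(r in `]d, b[) (r `^ a1 * `|derive1 c r| `^ p)%:E)%E ->
  (log_functional p a1 theta tau beta c < +oo)%E ->
  F <= expR (B * d `^ (beta / 2)) * ((1 - s) `^ (1 - P) * (S * (1 - q))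
       + s `^ (1 - P) * (c d `^ P * d `^ (theta + 1))) + fine (log_functional p a1 theta tau beta c).
Proof.
move=> d0 db b1 s0 s1 ec FP qI cfin; have d1 := lt_trans db b1.
have d01 : 0 < d < 1 by rewrite d0.
have acc := limit_AC hp ha1 wf nf fc.
pose w := expR (B * d `^ (beta / 2)); have w0 : 0 < w := expR_gt0 _.
pose A v := w * ((1 - s) `^ (1 - P) * (S * (1 - q)) + s `^ (1 - P) * (v `^ P * d `^ (theta + 1))).
have mI : measurable (`]d, 1[%classic : set R) by exact: measurable_itv.
have sub : `]d, 1[%classic `<=` I01.
  by move=> z /=; rewrite !in_itv/= => /andP[dz ->]; rewrite (lt_trans d0 dz).
have Jc := int_ldens_cvg d0 d1.
pose J u := (\int[mu]_(r in `]d, 1%R[) (ld u r)%:E)%E.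
have J0 u : (0 <= J u)%E by apply: int_ge0 => r _; exact: ldens_ge0.
have Jle : (J c <= log_functional p a1 theta tau beta c)%E.
  apply: int_subset.
  - exact: mI.
  - exact: measurable_itv.
  - by apply: ldens_measurable; exact: AC_loc01_measurable.
  - by move=> r _; exact: ldens_ge0.
  - exact: sub.
have Jcf : J c \is a fin_num by rewrite ge0_fin_numE ?J0//; exact: le_lt_trans Jle cfin.
have Pc0 : (0 <= log_functional p a1 theta tau beta c)%E.
  by apply: int_ge0 => r _; exact: ldens_ge0.
have Jle' : fine (J c) <= fine (log_functional p a1 theta tau beta c).
  by apply: fine_le => //; rewrite ge0_fin_numE.
apply: le_trans (_ : A (c d) + fine (J c) <= _); last by rewrite lerD2l.
have := Jc; rewrite -/(J c) -(fineK Jcf) => /fine_cvgP[Jfin Jcv].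
have Acv : (A (tail (f_ n) d) + fine (J (tail (f_ n))) + e_ n) @[n --> \oo] --> A (c d) + fine (J c) + 0.
  apply: cvgD ec; apply: cvgD; last exact: Jcv.
  apply: cvgM; first exact: cvg_cst.
  apply: cvgD; first exact: cvg_cst.
  apply: cvgM; first exact: cvg_cst.
  apply: cvgM; last exact: cvg_cst.
  exact: (cvg_powR_ge0 P0 (fun n => tail_ge0 (f_ n) d) (limit_ge0 fc d01) (fc d01)).
rewrite -[leRHS]addr0 -(cvg_lim _ Acv)//; apply: limr_ge.
  by apply/cvg_ex; eexists; exact: Acv.
have lsc := tail_energy_lsc hp ha1 wf acc fc d0 db b1 qI.
near=> n.
have qn : (q%:E < (etail p a1 (f_ n) d)%:E)%E by near: n; exact: lsc.
have Jn : J (tail (f_ n)) \is a fin_num by near: n; exact: Jfin.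
rewrite -lerBlDr -lee_fin; apply: le_trans (FP n) _.
have ml : measurable_fun I01 (ld (tail (f_ n))).
  by apply: ldens_measurable; exact: (AC_loc01_measurable (tail_AC hp ha1 (wf n))).
have l0 r : 0 <= ld (tail (f_ n)) r by exact: ldens_ge0.
rewrite /log_functional (int_split01 ml l0 d0 d1) EFinD (fineK Jn); apply: leeD; last exact: lexx.
apply: le_trans (functional_near0_le hp ha1 hN hth hnu htau hb L0 (wf n) (nf n) d0 d1 s0 s1) _.
rewrite lee_fin /A -/w; apply: (ler_wpM2l (ltW w0)); rewrite lerD2r.
apply: ler_wpM2l; first exact: powR_ge0.
apply: ler_wpM2l; first exact: (ltW (bS_gt0 hp hN hth hnu L0)).
by rewrite lerD2l lerN2; move: qn; rewrite lte_fin => /ltW.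
Unshelve. all: by end_near. Qed.

End limit_functional.

(** Continuity at s = 0. The same [s] serves as convexity weight and as slack in the energy. *)
Lemma split_parameter {R : realType} (P S T D : R) : S * (1 - T) < D ->
  exists s, [/\ 0 < s, s < 1 & (1 - s) `^ (1 - P) * (S * (1 - (T - s))) < D].
Proof.
move=> H.
have cv : (1 - s) `^ (1 - P) * (S * (1 - (T - s))) @[s --> 0^'+] --> 1 * (S * (1 - (T - 0))).
  apply: cvg_at_right_filter; apply: cvgM.
    have e1 : (1 - 0) `^ (1 - P) = 1 :> R by rewrite subr0 powR1.
    rewrite -[X in _ --> X]e1.
    apply: (@continuous_comp _ _ _ (fun s : R => 1 - s) (fun x => x `^ (1 - P))).
      by apply: cvgB; [exact: cvg_cst|exact: cvg_id].
    by apply: continuous_powR_gt0; rewrite subr0.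
  apply: cvgM; first exact: cvg_cst.
  apply: cvgB; first exact: cvg_cst.
  by apply: cvgB; [exact: cvg_cst|exact: cvg_id].
rewrite mul1r subr0 in cv; have lt := cvgr_lt _ cv _ H.
near (0 : R)^'+ => s; exists s; split.
- by near: s; exact: nbhs_right_gt.
- by near: s; exact: nbhs_right_lt.
- by near: s; exact: lt.
Unshelve. all: by end_near. Qed.

Lemma exp_parameter {R : realType} (x D : R) : x < D ->
  exists2 h, 0 < h & expR h * (x + h) < D.
Proof.
move=> H.
have cv : expR h * (x + h) @[h --> 0^'+] --> expR 0 * (x + 0).
  apply: cvg_at_right_filter; apply: cvgM; first exact: continuous_expR.
  by apply: cvgD; [exact: cvg_cst|exact: cvg_id].
rewrite expR0 mul1r addr0 in cv; have lt := cvgr_lt _ cv _ H.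
near (0 : R)^'+ => h; exists h.
- by near: h; exact: nbhs_right_gt.
- by near: h; exact: lt.
Unshelve. all: by end_near. Qed.

Section energy_gap.
Context {R : realType}.
Local Notation mu := (@lebesgue_measure R).
Local Notation I01 := (`](0 : R)%R, 1%R[%classic).
Context (p a1 theta tau beta L : R) (hp : 1 < p) (ha1 : 0 <= a1)
  (hN : 0 < a1 - p + 1) (hth : 0 <= theta) (hnu : a1 - p < theta)
  (htau : 1 <= tau) (hb : 0 < beta) (L0 : 0 < L).
Context (f_ : nat -> R -> R) (wf : forall n, wL p a1 (f_ n)) (nf : forall n, wint p a1 (f_ n) = 1%E)
  (c : R -> R) (fc : forall x, 0 < x < 1 -> tail (f_ n) x @[n --> \oo] --> c x).
Local Notation P := (pstar p a1 theta).
Local Notation S := (bS p a1 theta L).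
Local Notation K := (growth_const p a1).
Local Notation al := ((a1 - p + 1) / p).
Local Notation B := (log_const tau beta K al).

Let p0 : 0 < p. Proof. exact: bp0. Qed.
Let P0 : 0 < P. Proof. exact: bP0. Qed.
Let acc : AC_loc01 c. Proof. exact: (limit_AC hp ha1 wf nf fc). Qed.
Let wc : wL p a1 (derive1 c).
Proof.
split; first exact: AC_loc01_measurable_derive1.
exact: le_lt_trans (wint_limit_le1 hp ha1 wf nf fc) (ltry _).
Qed.
Let c_le_tail x : 0 < x < 1 -> `|c x| <= tail (derive1 c) x.
Proof. by move=> x01; exact: (AC_le_tail hp ha1 acc wc (limit_vanish hp ha1 wf nf fc) x01). Qed.

Lemma limit_functional_le :
  (log_functional p a1 theta tau beta c <=
    (expR B * (S * fine (wint p a1 (derive1 c)) `^ (P / p)))%:E)%E.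
Proof.
apply: (functional_le hp ha1 hN hth hnu htau hb L0 wc).
- exact: AC_loc01_measurable.
- exact: c_le_tail.
- by move=> r r01; rewrite (ger0_norm (limit_ge0 fc r01)); exact: (limit_growth hp ha1 hN wf nf fc).
Qed.

Let mcP : measurable_fun I01 (fun r => r `^ theta * `|c r| `^ P).
Proof. by apply: wdens_measurable; exact: AC_loc01_measurable. Qed.

Let cP_fin : (\int[mu]_(r in I01) (r `^ theta * `|c r| `^ P)%:E < +oo)%E.
Proof.
apply: (@le_lt_trans _ _ (\int[mu]_(r in I01) (r `^ theta * tail (derive1 c) r `^ P)%:E)%E).
  apply: int_le.
  - exact: measurable_itv.
  - exact: mcP.
  - exact: (mtail theta hp ha1 P wc).
  - by move=> r _; exact: mulr_ge0 (powR_ge0 _ _) (powR_ge0 _ _).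
  - move=> r /=; rewrite in_itv/= => r01; apply: ler_wpM2l; first exact: powR_ge0.
    exact: (ge0_ler_powR (ltW P0) (normr_ge0 _ : _ \in Num.nneg) (tail_ge0 _ _ : _ \in Num.nneg) (c_le_tail r01)).
exact: le_lt_trans (bliss_ineq hp ha1 hN hth hnu L0 wc) (ltry _).
Qed.

(** As c is nonincreasing, the integrand is at least (d/2)^theta c(d)^P on (d/2, d]. Hence c(d)^P
    d^(theta+1) vanishes with d, by smallness of the integral near 0. *)
Let point_mass (d : R) : 0 < d -> d < 1 ->
  (((d / 2) `^ (theta + 1) * c d `^ P)%:E <= \int[mu]_(r in `]0%R, d]) (r `^ theta * `|c r| `^ P)%:E)%E.
Proof.
move=> d0 d1; have d20 : 0 < d / 2 by rewrite divr_gt0.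
have d2d : d / 2 < d by rewrite ltr_pdivrMr// ltr_pMr// ltr1n.
have sub : `](d / 2), d]%classic `<=` `]0, d]%classic.
  by move=> z /=; rewrite !in_itv/= => /andP[dz ->]; rewrite (lt_trans d20 dz).
have sub01 : `]0, d]%classic `<=` I01.
  by move=> z /=; rewrite !in_itv/= => /andP[-> zd]; rewrite (le_lt_trans zd).
have md := measurable_funS (measurable_itv _) sub01 mcP.
have c0 := limit_ge0 fc (introT andP (conj d0 d1)).
apply: (@le_trans _ _ (\int[mu]_(r in `](d / 2)%R, d]) ((d / 2) `^ theta * c d `^ P)%:E)%E).
  rewrite int_cst; last exact: measurable_itv.
  rewrite (mu_itv_oc (ltW d2d)) -EFinM lee_fin.
  rewrite powRD ?(gt_eqF d20) ?implybT// (powRr1 (ltW d20)) le_eqVlt; apply/orP; left; apply/eqP.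
  by field.
apply: (@le_trans _ _ (\int[mu]_(r in `](d / 2)%R, d]) (r `^ theta * `|c r| `^ P)%:E)%E).
  apply: int_le.
  - exact: measurable_itv.
  - exact: measurable_cst.
  - exact: measurable_funS (measurable_itv _) sub md.
  - by move=> r _; exact: mulr_ge0 (powR_ge0 _ _) (powR_ge0 _ _).
  - move=> r /=; rewrite in_itv/= => /andP[r2 rd]; have r0 := lt_trans d20 r2.
    have cr := le_trans (limit_nonincreasing hp ha1 wf fc r0 rd d1) (ler_norm (c r)).
    have h1 := ge0_ler_powR hth (ltW d20 : _ \in Num.nneg) (ltW r0 : _ \in Num.nneg) (ltW r2).
    have h2 := ge0_ler_powR (ltW P0) (c0 : _ \in Num.nneg) (normr_ge0 _ : _ \in Num.nneg) cr.
    exact: ler_pM (powR_ge0 _ _) (powR_ge0 _ _) h1 h2.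
apply: int_subset.
- exact: measurable_itv.
- exact: measurable_itv.
- exact: md.
- by move=> r _; exact: mulr_ge0 (powR_ge0 _ _) (powR_ge0 _ _).
- exact: sub.
Qed.

(** If it failed, the slack would leave room to choose [s], then [h], then [d] so small that the
    logarithmic factor, the term in c(d) and the missing energy all fit in, against
    [limit_functional_ge]. *)
Lemma limit_energy_gap (F : R) (e_ : nat -> R) : e_ n @[n --> \oo] --> (0 : R) ->
  (forall n, ((F - e_ n)%:E <= log_functional p a1 theta tau beta (tail (f_ n)))%E) ->
  F <= S * (1 - fine (wint p a1 (derive1 c))) + fine (log_functional p a1 theta tau beta c).
Proof.
move=> ec FP; set T := fine _; set Phi := fine _; rewrite leNgt; apply/negP; rewrite -ltrBrDr => gap.
have [s [s0 s1 Hs]] := split_parameter P gap.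
set D := (1 - s) `^ _ * _ in Hs.
have [h h0 Hh] := exp_parameter Hs.
have cfin := le_lt_trans limit_functional_le (ltry _).
have TE : wint p a1 (derive1 c) = T%:E by rewrite /T (fineK (wint_fin_num wc)).
have qT : ((T - s)%:E < wint p a1 (derive1 c))%E by rewrite TE lte_fin ltrBlDr ltrDl.
have [a [b [a0 ab b1 Hab]]] := lt_int01_witness
  (wdens_measurable p a1 (AC_loc01_measurable_derive1 acc)) (wdens_ge0 p a1 (derive1 c)) qT.
(* The power of 2 pays for d/2 in [point_mass], so that the term in c(d) is at most [h]. *)
pose m := h / (s `^ (1 - P) * 2 `^ (theta + 1)).
have sP0 : 0 < s `^ (1 - P) := powR_gt0 _ s0.
have tw0 : 0 < 2 `^ (theta + 1) :> R by exact: powR_gt0.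
have m0 : 0 < m by rewrite divr_gt0// mulr_gt0.
have [a2 /andP[a20 a21] Ha2] := small_int_near0 mcP (fun r => mulr_ge0 (powR_ge0 _ _) (powR_ge0 _ _)) cP_fin m0.
have b2 : 0 < beta / 2 by rewrite divr_gt0.
have B0 : 0 <= B by apply: log_const_ge0 => //; [exact: growth_const_ge1|rewrite divr_ge0// ltW].
have Bc : B * d `^ (beta / 2) @[d --> 0^'+] --> B * 0.
  by apply: cvgM; [exact: cvg_cst|exact: powR_cvg_at0].
rewrite mulr0 in Bc; have Blt := cvgr_lt _ Bc _ h0.
near (0 : R)^'+ => d.
have d0 : 0 < d by near: d; exact: nbhs_right_gt.
have da : d < a by near: d; exact: nbhs_right_lt.
have da2 : d < a2 by near: d; exact: nbhs_right_lt.
have Bd : B * d `^ (beta / 2) < h by near: d; exact: Blt.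
have d1 : d < 1 := lt_trans da2 a21.
(* A larger right end, since [Hab] concerns a half-open interval and [limit_functional_ge] an open
   one. *)
pose b' := (b + 1) / 2.
have bb' : b < b' by rewrite /b' ltr_pdivlMr//; move: b1; lra.
have b'1 : b' < 1 by rewrite /b' ltr_pdivrMr//; move: b1; lra.
have db' : d < b' := lt_trans (lt_trans da ab) bb'.
have qI : ((T - s)%:E < \int[mu]_(r in `]d, b'[) (r `^ a1 * `|derive1 c r| `^ p)%:E)%E.
  apply: lt_le_trans Hab _; apply: int_subset.
  - exact: measurable_itv.
  - exact: measurable_itv.
  - apply: wdens_measurable; apply: measurable_funS (AC_loc01_measurable_derive1 acc).
      exact: measurable_itv.
    by move=> z /=; rewrite !in_itv/= => /andP[dz zb]; rewrite (lt_trans d0 dz) (lt_trans zb b'1).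
  - by move=> r _; exact: wdens_ge0.
  - by move=> z /=; rewrite !in_itv/= => /andP[az zb]; rewrite (lt_trans da az) (le_lt_trans zb bb').
have := limit_functional_ge hp ha1 hN hth hnu htau hb L0 wf nf fc d0 db' b'1 s0 s1 ec FP qI cfin.
apply/negP; rewrite -ltNge -ltrBrDr -/Phi; apply: le_lt_trans Hh.
have pm := le_trans (point_mass d0 d1) (Ha2 d d0 (ltW da2)).
rewrite lee_fin in pm.
have mass : s `^ (1 - P) * (c d `^ P * d `^ (theta + 1)) <= h.
  have e : d `^ (theta + 1) = 2 `^ (theta + 1) * (d / 2) `^ (theta + 1).
    by rewrite -powRM ?divr_ge0 ?(ltW d0)//; congr powR; field.
  have sp := ler_wpM2l (ltW (mulr_gt0 sP0 tw0)) pm.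
  have em : s `^ (1 - P) * 2 `^ (theta + 1) * m = h.
    by rewrite /m mulrC divfK// gt_eqF// mulr_gt0.
  rewrite em in sp.
  by apply: le_trans sp; rewrite e le_eqVlt; apply/orP; left; apply/eqP; ring.
have D0 : 0 <= D + s `^ (1 - P) * (c d `^ P * d `^ (theta + 1)).
  apply: addr_ge0; last exact: mulr_ge0 (ltW sP0) (mulr_ge0 (powR_ge0 _ _) (powR_ge0 _ _)).
  apply: mulr_ge0; first exact: powR_ge0.
  apply: mulr_ge0; first exact: (ltW (bS_gt0 hp hN hth hnu L0)).
  rewrite opprB addrA addrAC; apply: addr_ge0; last exact: ltW.
  by rewrite subr_ge0 -lee_fin -TE; exact: (wint_limit_le1 hp ha1 wf nf fc).
have eh : expR (B * d `^ (beta / 2)) <= expR h by rewrite ler_expR ltW.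
by apply: (ler_pM (expR_ge0 _) D0 eh); rewrite lerD2l.
Unshelve. all: by end_near. Qed.

End energy_gap.

(** The two inequalities combine to (F - S)(1 - T) <= 0. *)
Lemma fixed_point_bound {R : realFieldType} (F S T Phi : R) : S < F -> T <= 1 ->
  F <= S * (1 - T) + Phi -> Phi <= T * F -> T = 1 /\ F <= Phi.
Proof.
move=> SF T1 h1 h2.
have h3 : (F - S) * (1 - T) <= 0.
  have : F <= S * (1 - T) + T * F by apply: le_trans h1 _; rewrite lerD2l.
  have -> : (F - S) * (1 - T) = F - (S * (1 - T) + T * F) by ring.
  by rewrite subr_le0.
have T1' : T = 1.
  apply/eqP; rewrite eq_le T1/= -subr_le0.
  by rewrite pmulr_rle0 ?subr_gt0 in h3.
by split => //; move: h1; rewrite T1' subrr mulr0 add0r.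
Qed.

Lemma grad_norm1_wint {R : realType} (p a1 : R) (u : R -> R) : 0 < p -> wL p a1 (derive1 u) ->
  grad_norm p a1 u = 1%E -> wint p a1 (derive1 u) = 1%E.
Proof.
move=> p0 wu; rewrite /grad_norm -(fineK (wint_fin_num wu)); set x := fine _.
have x0 : 0 <= x by apply: fine_ge0; exact: wint_ge0.
rewrite poweR_EFin => -[e]; congr EFin.
have : (x `^ p^-1) `^ p = x by rewrite -powRrM mulVf ?gt_eqF// (powRr1 x0).
by rewrite e powR1.
Qed.

Theorem theorem1p4 (R : realType) (p a0 a1 theta tau beta : R)
    (hp : 1 < p) (ha0 : 0 <= a0) (ha1 : 0 <= a1) (htheta : 0 <= theta)
    (ha1p : 0 < a1 - p + 1) (ha01 : a1 - p <= a0) (hthetap : a1 - p < theta)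
    (htau : 1 <= tau) (hbeta0 : 0 < beta)
    (hbeta : beta < Num.min ((theta + 1) / p) ((a1 - p + 1) / (p - 1))) :
  exists u : R -> R,
    [/\ X1p p a0 a1 u,
        grad_norm p a1 u = 1%E &
        log_functional p a1 theta tau beta u
          = log_sup p a0 a1 theta tau beta].
Proof.
have p0 : 0 < p := bp0 hp.
have P0 : 0 < pstar p a1 theta := bP0 hp ha1p hthetap.
set F := log_sup p a0 a1 theta tau beta.
have [L L0 SL] := tfun_exceeds hp ha1p htheta hthetap htau hbeta0 hbeta.
set S := bS p a1 theta L in SL.
have S0 : 0 < S := bS_gt0 hp ha1p htheta hthetap L0.
have SF : (S%:E < F)%E.
  apply: lt_le_trans SL _; apply: ereal_sup_ubound; exists (tfun p a1 theta L) => //; split.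
    exact: tfun_X1p.
  exact: tfun_grad_norm.
have unit_wL u : X1p p a0 a1 u -> wL p a1 (derive1 u) by move=> [[]].
have unit_tail u : X1p p a0 a1 u -> forall r, 0 < r < 1 -> `|u r| <= tail (derive1 u) r.
  by move=> Xu r r01; exact: (X1p_le_tail hp ha0 ha1 Xu r01).
have Ffin : F \is a fin_num.
  rewrite ge0_fin_numE; last exact: le_trans (ltW S0 : (0 <= S%:E)%E) (ltW SF).
  pose M := expR (log_const tau beta (growth_const p a1) ((a1 - p + 1) / p)) * (S * 1 `^ (pstar p a1 theta / p)).
  apply: (@le_lt_trans _ _ M%:E); last exact: ltry.
  apply: ge_ereal_sup => _ [u [Xu nu] <-].
  have wu := grad_norm1_wint p0 (unit_wL _ Xu) nu.
  have uK r : 0 < r < 1 -> `|u r| <= growth_const p a1 * r `^ (- ((a1 - p + 1) / p)).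
    move=> r01; apply: le_trans (unit_tail _ Xu r r01) _; have /andP[r0 r1] := r01.
    by have := tail_growth hp ha1 ha1p (unit_wL _ Xu) r0 r1; rewrite wu.
  have [[acu _ _] _] := Xu.
  have := functional_le hp ha1 ha1p htheta hthetap htau hbeta0 L0 (unit_wL _ Xu)
    (AC_loc01_measurable acu) (unit_tail _ Xu) uK.
  by rewrite wu.
have FE := fineK Ffin; set Fr := fine F in FE.
have sel n : exists u, [/\ X1p p a0 a1 u, grad_norm p a1 u = 1%E &
    ((Fr - n.+1%:R^-1)%:E < log_functional p a1 theta tau beta u)%E].
  have n0 : 0 < n.+1%:R^-1 :> R by rewrite invr_gt0.
  have [_ [u [Xu nu] <-] H] := ub_ereal_sup_adherent n0 Ffin.
  exists u; split; [exact: Xu|exact: nu|].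
  by rewrite EFinB FE; exact: H.
have [u_ Hu] := choice sel.
have Xu n : X1p p a0 a1 (u_ n) by have [] := Hu n.
have wf n : wL p a1 (derive1 (u_ n)) by exact: unit_wL.
have nf n : wint p a1 (derive1 (u_ n)) = 1%E.
  by apply: grad_norm1_wint => //; have [] := Hu n.
have [phi [c [phin fc]]] := tail_extraction hp ha1 ha1p wf nf.
pose f_ k := derive1 (u_ (phi k)).
have wf' k : wL p a1 (f_ k) by exact: wf.
have nf' k : wint p a1 (f_ k) = 1%E by exact: nf.
have ec : n.+1%:R^-1 @[n --> \oo] --> (0 : R) by exact: cvg_harmonic.
(* The functional is monotone in |u|, so the tails remain a maximising sequence; [phin] keeps the
   error below 1/(n+1). *)
have FP n : ((Fr - n.+1%:R^-1)%:E <= log_functional p a1 theta tau beta (tail (f_ n)))%E.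
  have [_ _ /ltW H] := Hu (phi n).
  apply: (@le_trans _ _ (Fr - (phi n).+1%:R^-1)%:E).
    by rewrite lee_fin lerD2l lerN2 lef_pV2 ?posrE// ler_nat ltnS; exact: phin.
  apply: le_trans H _; apply: int_le.
  - exact: measurable_itv.
  - by have [[acu _ _] _] := Xu (phi n); apply: ldens_measurable; exact: AC_loc01_measurable.
  - by apply: ldens_measurable; exact: (AC_loc01_measurable (tail_AC hp ha1 (wf' n))).
  - by move=> r _; exact: ldens_ge0.
  - move=> r /=; rewrite in_itv/= => r01; apply: ldens_le => //.
    by rewrite (ger0_norm (tail_ge0 _ _)); exact: unit_tail.
have acc := limit_AC hp ha1 wf' nf' fc.
have c1 := limit_vanish hp ha1 wf' nf' fc.
have wc1 := wint_limit_le1 hp ha1 wf' nf' fc.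
have wc : wL p a1 (derive1 c).
  by split; [exact: AC_loc01_measurable_derive1|exact: le_lt_trans wc1 (ltry _)].
have Xc : X1p p a0 a1 c := mem_X1p hp ha1 ha1p ha01 acc wc c1.
pose T := fine (wint p a1 (derive1 c)).
pose Phi := log_functional p a1 theta tau beta c.
have gap : Fr <= S * (1 - T) + fine Phi :=
  limit_energy_gap hp ha1 ha1p htheta hthetap htau hbeta0 L0 wf' nf' fc ec FP.
have Phile : (Phi <= (expR (log_const tau beta (growth_const p a1) ((a1 - p + 1) / p)) *
    (S * T `^ (pstar p a1 theta / p)))%:E)%E :=
  limit_functional_le hp ha1 ha1p htheta hthetap htau hbeta0 L0 wf' nf' fc.
have TE : T%:E = wint p a1 (derive1 c) := fineK (wint_fin_num wc).
have Phi0 : (0 <= Phi)%E by apply: int_ge0 => r _; exact: ldens_ge0.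
have Phifin : Phi \is a fin_num.
  by rewrite ge0_fin_numE//; exact: le_lt_trans Phile (ltry _).
have T0 : 0 <= T by apply: fine_ge0; exact: wint_ge0.
have T1 : T <= 1 by rewrite -lee_fin TE.
have PhiT : fine Phi <= T * Fr.
  rewrite -lee_fin (fineK Phifin).
  (* For T = 0 the limit cannot be normalised, but then [Phile] already bounds the functional by
     0. *)
  have [Tz|Tn] := eqVneq T 0.
    move: Phile; rewrite Tz mul0r powR0 ?mulr0// gt_eqF// divr_gt0//.
  rewrite EFinM FE; apply: (functional_scale beta hp ha1 ha1p ha01 hthetap htau acc c1) => //.
  by rewrite lt_neqAle eq_sym Tn T0.
have SFr : S < Fr by rewrite -lte_fin FE.
(* Since the supremum lies strictly above the Bliss level, no energy is lost in the limit. *)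
have [T1' FPhi] := fixed_point_bound SFr T1 gap PhiT.
have nc : grad_norm p a1 c = 1%E by rewrite /grad_norm -TE T1' poweR_EFin powR1.
exists c; split; [exact: Xc|exact: nc|].
have PhiF : (Phi <= F)%E.
  rewrite /F /log_sup; apply: ereal_sup_ubound.
  by exists c; [split; [exact: Xc|exact: nc]|reflexivity].
have FPhi' : (F <= Phi)%E by rewrite -FE -(fineK Phifin) lee_fin.
by apply: le_anti; rewrite PhiF FPhi'.
Qed.
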